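(* (a) There is a bounded, (strictly) positive, continuous function $f$ on $\mathbb{R}$ and a tempered distribution $g$ on $\mathbb{R}$ such that the $\mathscr{S}'$-product $f\odot g$ is well-defined and equal to zero even though $g$ is not identically zero. (b) There is a nontrivial probability measure $\mu$ on $\mathbb{Z}$ (that is, $\mu$ is not a Dirac measure) and a function $h$ on $\mathbb{Z}$ such that $\lim_{|x|\to\infty}|x|^{-\varepsilon}h(x)=0$ for every $\varepsilon>0$ and $h*\mu=h$, but $h$ is not constant, and hence not a polynomial. (c) For every $d \ge 1$ there is a Lévy operator $L$ on $\mathbb{R}^d$ and a smooth function $h$ on $\mathbb{R}^d$ such that $L$ is not concentrated on a proper closed subgroup of $\mathbb{R}^d$, for every $\varepsilon>0$ we have $\lim_{|x|\to\infty}|x|^{-\varepsilon}h(x)=0$, and $Lh=0$ (both pointwise and in the weak sense), but $h$ is not constant, and hence not a polynomial.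
   Context: $\mathscr{S}$ is the Schwartz class, $\mathscr{S}'$ the space of tempered distributions. $\mathscr{S}'$-product: the product of $f,g\in\mathscr{S}'$ is well-defined if there is a tempered distribution $f\odot g$ such that $\langle f\odot g,\varphi\rangle=\lim_{n\to\infty}\int (f*\alpha_n)(x)\,(g*\beta_n)(x)\,\varphi(x)\,dx$ for every $\varphi\in\mathscr{S}$ and all sequences $\alpha_n,\beta_n$ of nonnegative smooth compactly supported functions with integral $1$ and supports shrinking to $\{0\}$. Lévy operator: an operator of the form $$Lf(x) = \sum_{j,k=1}^d a_{jk}\partial_{jk} f(x) + \sum_{j=1}^d b_j \partial_j f(x) + \int_{\mathbb{R}^d\setminus\{0\}} \Bigl(f(x+y) - f(x) - \mathbf{1}_B(y)\sum_{j=1}^d y_j\partial_j f(x)\Bigr)\nu(dy),$$ where $B$ is the unit ball, $(a_{jk})$ is a real symmetric nonnegative definite matrix, $(b_j)\in\mathbb{R}^d$, and $\nu$ is a nonnegative measure on $\mathbb{R}^d\setminus\{0\}$ with $\int \min\{1,|y|^2\}\,\nu(dy)<\infty$. Its characteristic exponent is $$\Psi(\xi) = \sum_{j,k} a_{jk}\xi_j\xi_k - i b\xi + \int_{\mathbb{R}^d\setminus\{0\}} \bigl(1 - e^{i\xi y} + i\xi y\,\mathbf{1}_B(y)\bigr)\nu(dy).$$ $L$ is not concentrated on a proper closed subgroup of $\mathbb{R}^d$ if $\Psi(\xi)=0$ only for $\xi=0$. The dual $L^\dagger$ is the Lévy operator with matrix $(a_{jk})$, vector $(-b_j)$ and Lévy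 measure $\nu^\dagger(A)=\nu(-A)$. $Lh=0$ pointwise means that the integral defining $Lh(x)$ converges absolutely and $Lh(x)=0$ for every $x$. $Lh=0$ in the weak sense means $\int_{\mathbb{R}^d} h(x)L^\dagger\varphi(x)\,dx=0$ for every smooth compactly supported $\varphi$, the integral being absolutely convergent. *)

(* Defs.v *)
From HB Require Import structures.
From mathcomp Require Import all_boot all_order all_algebra complex.
From mathcomp Require Import all_classical all_reals all_analysis.
From mathcomp Require mpoly.
Set Implicit Arguments.
Unset Strict Implicit.
Unset Printing Implicit Defensive.
Import Order.TTheory GRing.Theory Num.Theory.
Import numFieldNormedType.Exports.
Local Open Scope classical_set_scope.
Local Open Scope ring_scope.

Section complex_valued.
Context {R : realType}.
Implicit Types (f g : R -> R) (phi : R -> R[i]).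

Definition cint d (T : measurableType d) (mu : {measure set T -> \bar R})
    (D : set T) (F : T -> R[i]) : R[i] :=
  ((\int[mu]_(x in D) complex.Re (F x)) +i*
   (\int[mu]_(x in D) complex.Im (F x)))%C.

Definition expi (t : R) : R[i] := (cos t +i* sin t)%C.

Definition cabs (z : R[i]) : R := Normc.normc z.

Definition ccvg (u : nat -> R[i]) (l : R[i]) :=
  cabs (u n - l) @[n --> \oo] --> (0 : R).

Definition smooth f := forall k x, derivable (derive1n k f) x 1.

Definition csmooth phi :=
  smooth (fun x => complex.Re (phi x)) /\ smooth (fun x => complex.Im (phi x)).

Definition cderiv (k : nat) phi (x : R) : R[i] :=
  (derive1n k (fun y => complex.Re (phi y)) x +i*
   derive1n k (fun y => complex.Im (phi y)) x)%C.

End complex_valued.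

Section tempered.
Context {R : realType}.
Implicit Types (phi : R -> R[i]) (T F G H : (R -> R[i]) -> R[i]).

Definition schwartz phi :=
  csmooth phi /\
  forall j k : nat, exists C : R,
    forall x, `|x| ^+ j * cabs (cderiv k phi x) <= C.

Definition schwartz_cvg (phi_ : nat -> R -> R[i]) phi :=
  forall (j k : nat) (e : R), 0 < e ->
    \forall n \near \oo, forall x,
      `|x| ^+ j * cabs (cderiv k (fun y => phi_ n y - phi y) x) <= e.

(* A distribution is a functional on all functions, of which only the values  *)
(* at Schwartz functions matter.  The Schwartz class being metrizable,        *)
(* sequential continuity is continuity.                                       *)
Definition tempered T :=
  (forall (a : R[i]) phi psi, schwartz phi -> schwartz psi ->
     T (fun x => a * phi x + psi x) = a * T phi + T psi) /\
  (forall (phi_ : nat -> R -> R[i]) phi,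
     (forall n, schwartz (phi_ n)) -> schwartz phi ->
     schwartz_cvg phi_ phi -> ccvg (fun n => T (phi_ n)) (T phi)).

Definition distr_of_fun (f : R -> R) : (R -> R[i]) -> R[i] :=
  fun phi => cint lebesgue_measure setT (fun x => (f x)%:C%C * phi x).

Definition distr_conv T (alpha : R -> R) (x : R) : R[i] :=
  T (fun y => (alpha (x - y))%:C%C).

Definition approx_identity (alpha : nat -> R -> R) :=
  [/\ forall n, smooth (alpha n),
      forall n, compact (closure [set x | alpha n x != 0]),
      forall n x, 0 <= alpha n x,
      forall n, \int[lebesgue_measure]_(x in [set: R]) alpha n x = 1 &
      forall U, nbhs (0 : R) U ->
        \forall n \near \oo, closure [set x | alpha n x != 0] `<=` U].

(* The product of F and G is well-defined and equal to H. *)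
Definition sproduct F G H :=
  [/\ tempered F, tempered G, tempered H &
      forall phi alpha beta, schwartz phi ->
        approx_identity alpha -> approx_identity beta ->
        ccvg (fun n => cint lebesgue_measure setT (fun x =>
                distr_conv F (alpha n) x * distr_conv G (beta n) x * phi x))
             (H phi)].

End tempered.

Definition tends0_at_infinity {R : realType} {T : Type} (nrm : T -> R)
    (u : T -> R) :=
  forall e : R, 0 < e -> exists M : R, forall x, M < nrm x -> `|u x| < e.

Definition nonconstant {T U : Type} (h : T -> U) := ~ exists c, h = cst c.

HB.instance Definition _ := isPointed.Build int 0.
HB.instance Definition _ := @isMeasurable.Build default_measure_display
  int discrete_measurable discrete_measurable0
  discrete_measurableC discrete_measurableU.

Section integers.
Context {R : realType}.

Definition int_norm (x : int) : R := `|x|%:~R.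

Definition is_dirac (mu : probability int R) :=
  exists a : int, forall A : set int, mu A = \d_a A.

Definition int_conv_is (h : int -> R) (mu : probability int R) (g : int -> R) :=
  forall x : int,
    mu.-integrable setT (EFin \o (fun y => h (x - y))) /\
    \int[mu]_(y in setT) h (x - y) = g x.

Definition int_polynomial (h : int -> R) :=
  exists p : {poly R}, forall x : int, h x = p.[x%:~R].

End integers.

(* The product sigma-algebra, as for n.-tuple; on row vectors of reals it     *)
(* coincides with the Borel sigma-algebra.                                    *)
Definition measure_rV_display : measure_display.
Proof. by constructor. Qed.

Section measurable_rV.
Context {R : realType} (n : nat).

Let coord (i : 'I_n) (v : 'rV[R]_n) : R := v 0 i.

Let rV_set0 : g_sigma_preimage coord set0.
Proof. exact: sigma_algebra0. Qed.

Let rV_setC A : g_sigma_preimage coord A -> g_sigma_preimage coord (~` A).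
Proof. exact: sigma_algebraC. Qed.

Let rV_bigcup (F : _^nat) : (forall i, g_sigma_preimage coord (F i)) ->
  g_sigma_preimage coord (\bigcup_i (F i)).
Proof. exact: sigma_algebra_bigcup. Qed.

HB.instance Definition _ := @isMeasurable.Build measure_rV_display
  'rV[R]_n (g_sigma_preimage coord) rV_set0 rV_setC rV_bigcup.

Lemma measurable_rV_coord (i : 'I_n) :
  measurable_fun setT (fun v : 'rV[R]_n => v 0 i).
Proof.
move=> _ Y mY; rewrite setTI; apply: sub_sigma_algebra => /=.
rewrite -bigcup_seq/=; exists i => /=; first by rewrite mem_index_enum.
by exists Y => //; rewrite setTI.
Qed.

Lemma measurable_fun_rV d (T : measurableType d) (f : T -> 'rV[R]_n) :
  (forall i, measurable_fun setT (fun t => f t 0 i)) -> measurable_fun setT f.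
Proof.
move=> mf _ Y mY; rewrite setTI.
suff : g_sigma_preimage coord `<=` [set B | measurable (f @^-1` B)]
  by move=> sS; exact: (sS Y mY).
apply: smallest_sub.
  split=> [|A mA|F mF] /=.
  - by rewrite preimage_set0.
  - by rewrite setTD preimage_setC; exact: measurableC.
  - by rewrite preimage_bigcup; apply: bigcup_measurable => k _; exact: mF.
move=> B; rewrite -bigcup_seq/= => -[i _ [A mA <-]] /=.
by rewrite setTI -[X in measurable X]setTI; exact: mf.
Qed.

End measurable_rV.

Section image_measure.
Context d d' (T : measurableType d) (T' : measurableType d') (R : realType).
Variables (mu : {measure set T -> \bar R}) (f : {mfun T >-> T'}).

Definition image_measure : set T' -> \bar R := pushforward mu f.

Let image_measure0 : image_measure set0 = 0%E.
Proof. exact: measure0. Qed.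

Let image_measure_ge0 A : (0 <= image_measure A)%E.
Proof. exact: measure_ge0. Qed.

Let image_measure_sigma_additive : semi_sigma_additive image_measure.
Proof. exact: (@measure_semi_sigma_additive _ _ _ (pushforward mu f)). Qed.

HB.instance Definition _ := isMeasure.Build _ _ _ image_measure
  image_measure0 image_measure_ge0 image_measure_sigma_additive.

End image_measure.

Section lebesgue_rV.
Context {R : realType}.

Definition rV_cons n (p : 'rV[R]_n * measurableTypeR R) : 'rV[R]_n.+1 :=
  \row_i oapp (fun j => p.1 0 j) p.2 (unlift ord0 i).

Lemma measurable_rV_cons n : measurable_fun setT (@rV_cons n).
Proof.
apply: measurable_fun_rV => i; under eq_fun do rewrite mxE.
case: (unlift ord0 i) => [j|] /=; last exact: measurable_snd.
by apply: (measurableT_comp (measurable_rV_coord j)); exact: measurable_fst.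
Qed.

HB.instance Definition _ n := isMeasurableFun.Build _ _ _ _ (@rV_cons n)
  (@measurable_rV_cons n).

Fixpoint lebesgue_rV n : {measure set 'rV[R]_n -> \bar R} :=
  match n with
  | 0 => \d_(0 : 'rV[R]_0)
  | n'.+1 => image_measure (lebesgue_rV n' \x lebesgue_measure)%E (@rV_cons n')
  end.

Definition rV_opp n (x : 'rV[R]_n) : 'rV[R]_n := - x.

Lemma measurable_rV_opp n : measurable_fun setT (@rV_opp n).
Proof.
apply: measurable_fun_rV => i; under eq_fun do rewrite mxE.
by apply: measurableT_comp => //; exact: measurable_rV_coord.
Qed.

HB.instance Definition _ n := isMeasurableFun.Build _ _ _ _ (@rV_opp n)
  (@measurable_rV_opp n).

End lebesgue_rV.

Section rV_calculus.
Context {R : realType} {d : nat}.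
Implicit Types (f : 'rV[R]_d -> R) (x y xi : 'rV[R]_d).

Definition dot x y : R := \sum_i x 0 i * y 0 i.

(* The library norm on 'rV is the sup norm. *)
Definition enorm x : R := Num.sqrt (\sum_i x 0 i ^+ 2).

(* For a Levy triplet, taking the closed ball instead only changes the drift. *)
Definition eball : set 'rV[R]_d := [set y | enorm y < 1].

Definition punctured : set 'rV[R]_d := ~` [set 0].

Definition partial (i : 'I_d) f x : R := 'D_(delta_mx 0 i) f x.

Definition partials (s : seq 'I_d) f : 'rV[R]_d -> R := foldr partial f s.

Definition smooth_rV f :=
  forall s : seq 'I_d, continuous (partials s f) /\
    forall i x, derivable (partials s f) x (delta_mx 0 i).

Definition test_function f :=
  smooth_rV f /\ compact (closure [set x | f x != 0]).

Definition polynomial_rV f :=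
  exists p : mpoly.mpoly d R, forall x, f x = mpoly.meval (fun i => x 0 i) p.

End rV_calculus.

Section levy.
Context {R : realType} {d : nat}.
Implicit Types (f h : 'rV[R]_d -> R) (x y xi : 'rV[R]_d).

(* A measure on the punctured space is encoded as a measure on the whole      *)
(* space giving no mass to the origin.                                        *)
Record triplet := Triplet {
  tmat : 'M[R]_d;
  tdrift : 'rV[R]_d;
  tmeas : {measure set 'rV[R]_d -> \bar R}
}.

Definition levy_triplet (L : triplet) :=
  [/\ (tmat L)^T = tmat L,
      forall xi, 0 <= \sum_j \sum_k tmat L j k * xi 0 j * xi 0 k,
      tmeas L [set 0] = 0%E &
      (\int[tmeas L]_(y in punctured) (Num.min 1 (enorm y ^+ 2))%:E < +oo)%E].

Definition levy_integrand f x y : R :=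
  f (x + y) - f x - \1_eball y * \sum_j y 0 j * partial j f x.

Definition levy_operator (L : triplet) f x : R :=
  \sum_j \sum_k tmat L j k * partial j (partial k f) x +
  \sum_j tdrift L 0 j * partial j f x +
  \int[tmeas L]_(y in punctured) levy_integrand f x y.

Definition char_exponent (L : triplet) xi : R[i] :=
  ((\sum_j \sum_k tmat L j k * xi 0 j * xi 0 k)%:C
   - (0 +i* dot (tdrift L) xi)
   + cint (tmeas L) punctured (fun y =>
       1 - expi (dot xi y) + (0 +i* (dot xi y * \1_eball y))))%C.

Definition not_concentrated_on_subgroup (L : triplet) :=
  forall xi, char_exponent L xi = 0 -> xi = 0.

Definition dual (L : triplet) : triplet :=
  Triplet (tmat L) (- tdrift L) (image_measure (tmeas L) (@rV_opp R d)).

Definition harmonic_pointwise (L : triplet) h :=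
  forall x,
    (tmeas L).-integrable punctured (EFin \o levy_integrand h x) /\
    levy_operator L h x = 0.

Definition harmonic_weak (L : triplet) h :=
  forall phi, test_function phi ->
    (lebesgue_rV d).-integrable setT
      (EFin \o (fun x => h x * levy_operator (dual L) phi x)) /\
    \int[lebesgue_rV d]_(x in setT) (h x * levy_operator (dual L) phi x) = 0.

End levy.
Arguments triplet : clear implicits.

(* Main.v *)
From HB Require Import structures.
Require Import Defs.
From mathcomp Require Import all_boot all_order all_algebra complex.
From mathcomp Require Import all_classical all_reals all_analysis.
From mathcomp Require Import measurable_realfun.
From mathcomp Require mpoly.
From mathcomp Require Import ring lra zify.
Set Implicit Arguments.
Unset Strict Implicit.
Unset Printing Implicit Defensive.
Import Order.TTheory GRing.Theory Num.Theory.
Import numFieldNormedType.Exports.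
Local Open Scope classical_set_scope.
Local Open Scope ring_scope.

(** All three examples are limits of one recursion.  At stage n there is an
    operator L_n, a function h_n and a residual r_n = L_n h_n.  A new term of
    weight p, acting at a scale far beyond everything built so far, is added to
    the operator; the function is then corrected at the new scale, with height
    of order |r_n| / p, so that the new term carries the correction back onto
    r_n and cancels it.  What remains is a residual that lives entirely at the
    new scale.  As the scales grow the residuals escape, and the limit
    satisfies L h = 0 exactly, although h keeps the shape of the first h_0.

    Parts (b) and (c).  The operators are L = sum_k p_k T_(y_k) - 1, with T_y
    the translation by y.  Given a finite stage and a new jump y, put
      h' = h - p^-1 r(. - y)   and   L' = L + p T_y;
    then L' h' = p h(. + y) - p^-1 (L r)(. - y) is supported around -y and y
    (sparse_harmonic).  The height of the correction is known before |y| is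
    chosen, so h can be made to grow more slowly than every power.  On the
    integers the recursion starts from the indicator of 0.  On R^d it starts
    from a smooth bump, and its first 2d jumps are e_j and 2 pi e_j: a zero xi
    of the exponent then has cos(xi_j) = cos(2 pi xi_j) = 1, and xi_j = 0
    because pi is irrational (cos_eq1_incommensurable).  All jumps lie outside
    the unit ball, so the compensator vanishes; on a given ball only finitely
    many jumps matter, so the pointwise equation is a finite sum, and the weak
    equation follows from the translation invariance of Lebesgue measure.  As
    h(0) = 1 while h vanishes at infinitely many multiples of one vector, h is
    neither constant nor a polynomial.

    Part (a).  Multiplication by cos(K x) is a frequency shift, so the same
    recursion runs on the Fourier side:
      f_(n+1) = f_n + p_n cos(K_n x),
      g_(n+1) = g_n - (2 / p_n) cos(K_n x) f_n g_n.
    By 2 cos^2 = 1 + cos(2 .), the product r_n = f_n g_n satisfies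
      r_(n+1) = cos(K_n x) q_n - cos(2 K_n x) r_n
    (lac_rS), which oscillates at the new frequency.  The f_n converge
    uniformly to a continuous f with 1 <= f <= 3; the g_n converge as
    distributions, to a limit close to g_0 when the K_n grow fast enough,
    whereas r_n tends to 0.  The two factors of the product are mollified
    independently, so the estimates have to be uniform in the mollifiers.  They
    all rest on antiperiodicity: u(x + a) + u(x) is small for a = pi / K.  This
    survives convolution and multiplication by a Lipschitz function, and it
    makes integrals small (antiM, conv_anti, anti_integral).  Only the product
    of the two new terms of stage n+1 has no oscillation at frequency K_(n+1);
    but K_(n+1) is a multiple of 4 K_n, so cos(K_(n+1) x) has the periods
    pi / K_n and pi / (2 K_n), for which r_(n+1) is antiperiodic
    (two_scale_integral).  The mollified pairings at consecutive stages are
    therefore summably close (mol_pair_step), and letting the mollifiers shrink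
    at a fixed stage shows that the product is 0 (pairing_small). *)

(** * The sparse recursion *)

Lemma dependent_sequence (T : Type) (G : nat -> T -> Prop)
    (Q : nat -> T -> T -> Prop) (s0 : T) :
  G 0%N s0 ->
  (forall n s, G n s -> exists s', G n.+1 s' /\ Q n s s') ->
  exists S : nat -> T,
    [/\ S 0%N = s0, forall n, G n (S n) & forall n, Q n (S n) (S n.+1)].
Proof.
move=> G0 step.
have /choice[F FP] (ns : nat * T) : exists s', G ns.1 ns.2 ->
    G ns.1.+1 s' /\ Q ns.1 ns.2 s'.
  have [Gs|nG] := pselect (G ns.1 ns.2); last by exists ns.2.
  by have [s' Gs'] := step _ _ Gs; exists s'.
pose S := fix S n := if n is n'.+1 then F (n', S n') else s0.
have GS n : G n (S n).
  by elim: n => [//|n IH] /=; exact: (FP (n, S n) IH).1.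
by exists S; split=> // n; exact: (FP (n, S n) (GS n)).2.
Qed.

Section translation_combinations.
Context {R : realType} {V : zmodType}.
Implicit Types (l : seq (R * V)) (f g : V -> R).

(** Operators are kept as finite lists of weighted shifts, so that the
    operator of one stage can be applied to its own output (tcomb_comp) and
    all stages remain combinations of translates of the same initial
    function. *)
Definition tcomb l f x : R := \sum_(cv <- l) cv.1 * f (x + cv.2).

Lemma tcomb_nil f x : tcomb [::] f x = 0.
Proof. by rewrite /tcomb big_nil. Qed.

Lemma tcomb_cons c v l f x : tcomb ((c, v) :: l) f x = c * f (x + v) + tcomb l f x.
Proof. by rewrite /tcomb big_cons. Qed.

Lemma tcomb_rcons c v l f x :
  tcomb (rcons l (c, v)) f x = tcomb l f x + c * f (x + v).
Proof. by rewrite /tcomb -cats1 big_cat big_seq1. Qed.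

Lemma tcomb_sub_transl l f g c y x :
  tcomb l (fun z => f z - c * g (z - y)) x = tcomb l f x - c * tcomb l g (x - y).
Proof.
rewrite /tcomb mulr_sumr -sumrB; apply: eq_bigr => cv _.
by rewrite mulrBr addrAC mulrCA.
Qed.

Lemma tcomb_comp l l' f : exists l'', tcomb l (tcomb l' f) = tcomb l'' f.
Proof.
exists [seq (cv.1 * cv'.1, cv.2 + cv'.2) | cv <- l, cv' <- l'].
apply/funext => x; rewrite /tcomb big_allpairs_dep; apply: eq_bigr => cv _.
rewrite mulr_sumr; apply: eq_bigr => cv' _ /=.
by rewrite mulrA addrA.
Qed.

Lemma tcomb_sub l l' c y f :
  exists l'', (fun x => tcomb l f x - c * tcomb l' f (x - y)) = tcomb l'' f.
Proof.
exists (l ++ [seq (- (c * cv.1), cv.2 - y) | cv <- l']).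
apply/funext => x; rewrite /tcomb big_cat /= mulr_sumr; congr (_ + _).
rewrite big_map -sumrN; apply: eq_bigr => cv' _ /=.
by rewrite mulNr mulrA [cv'.2 - y]addrC addrA.
Qed.

Lemma tcomb_id f : tcomb [:: (1, 0)] f = f.
Proof. by apply/funext => x; rewrite /tcomb big_seq1 mul1r addr0. Qed.

Lemma tcomb_bounded l f (C : R) : (forall x, `|f x| <= C) ->
  exists C' : R, forall x, `|tcomb l f x| <= C'.
Proof.
move=> fC; exists (\sum_(cv <- l) `|cv.1| * C) => x.
apply: (le_trans (ler_norm_sum _ _ _)); apply: ler_sum => cv _.
by rewrite normrM ler_wpM2l.
Qed.

End translation_combinations.

Section sparse_harmonic.
Context {R : realType} {V : zmodType} (nrm : V -> R) (u : V).
Hypothesis nrmD : forall x y, nrm (x + y) <= nrm x + nrm y.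
Hypothesis nrmN : forall x, nrm (- x) = nrm x.
Hypothesis nrm_ge0 : forall x, 0 <= nrm x.
Hypothesis nrmu : forall n, nrm (u *+ n) = n%:R.
Implicit Types (l : seq (R * V)) (f g : V -> R).

Definition supported (rho : R) f := forall x, rho < nrm x -> f x = 0.

Lemma nrm_subl x y : nrm y - nrm x <= nrm (x + y).
Proof.
rewrite lerBlDr; have := nrmD (x + y) (- x).
by rewrite nrmN [x + y]addrC addrK.
Qed.

Lemma supported_le rho rho' f : rho <= rho' -> supported rho f -> supported rho' f.
Proof. by move=> le sf x lex; apply: sf; exact: le_lt_trans lex. Qed.

Lemma supported_tcomb l f rho rho' :
  (forall cv, cv \in l -> nrm cv.2 <= rho) -> supported rho' f ->
  supported (rho + rho') (tcomb l f).
Proof.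
move=> lr sf x lex; rewrite /tcomb big_seq big1 // => cv /lr cvr.
rewrite sf ?mulr0 //; apply: lt_le_trans (_ : nrm x - nrm cv.2 <= _).
  by lra.
by rewrite [x + _]addrC; exact: nrm_subl.
Qed.

Context (p : nat -> R).
Hypothesis p_gt0 : forall n, 0 < p n.

(** The operator, the function, and a radius that bounds both the jumps of the
    operator and the support of the function. *)
Definition sparse_state : Type := (seq (R * V) * (V -> R) * R)%type.

Definition sparse_good (h0 : V -> R) (s : sparse_state) : Prop :=
  let: (l, h, rho) := s in
  [/\ 0 <= rho, forall cv, cv \in l -> nrm cv.2 <= rho, supported rho h,
      exists C : R, forall x, `|h x| <= C & exists l', h = tcomb l' h0].

(** The constants 5 and 3 create a gap: when h vanishes beyond rho and the
    jumps are at most rho, the correction is supported at distance at least t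
    - 2 rho from the origin and the new residual at distance at least t - 3
    rho, while t - 3 rho exceeds 2 rho + n.  The last clause bounds the height
    of the correction; it can be met because this height is fixed before t is
    chosen. *)
Definition sparse_step (n : nat) (s s' : sparse_state) (t : nat) : Prop :=
  let: (l, h, rho) := s in
  s' = (rcons l (p n, u *+ t),
        fun x => h x - (p n)^-1 * tcomb l h (x - u *+ t),
        t%:R + 2 * rho) /\
  5 * rho + n.+2%:R <= t%:R /\
  forall x z, t%:R - 3 * rho <= nrm x ->
    (p n)^-1 * `|tcomb l h z| <= n.+1%:R^-1 * nrm x `^ n.+1%:R^-1.

Lemma sparse_step_good h0 n s s' t :
  sparse_good h0 s -> sparse_step n s s' t -> sparse_good h0 s'.
Proof.
case: s => [[l h] rho] [rho0 lr sh [C hC] [l' hl']] [-> [tge _]].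
have t0 : 0 <= t%:R :> R by [].
split; first by lra.
- move=> cv; rewrite mem_rcons inE => /predU1P[->/=|/lr cvr].
    by rewrite nrmu; lra.
  by apply: (le_trans cvr); lra.
- move=> x lex; rewrite sh; last by lra.
  rewrite (supported_tcomb lr sh) ?mulr0 ?subrr//.
  have := nrm_subl (- (u *+ t)) x; rewrite nrmN nrmu [- _ + x]addrC; lra.
- have [C' hC'] := tcomb_bounded l hC; exists (C + (p n)^-1 * C') => x.
  apply: (le_trans (ler_normB _ _)); apply: lerD => //.
  by rewrite normrM gtr0_norm ?invr_gt0// ler_wpM2l// invr_ge0 ltW.
- rewrite hl'; have [l1 hl1] := tcomb_comp l l' h0; rewrite hl1.
  exact: tcomb_sub.
Qed.

Lemma sparse_step_exists h0 n s :
  sparse_good h0 s -> exists s' t, sparse_step n s s' t.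
Proof.
case: s => [[l h] rho] [rho0 lr sh [C hC] _].
have [C' hC'] := tcomb_bounded l hC.
pose q := (p n)^-1 * C' * n.+1%:R.
have C0 : 0 <= C' by apply: le_trans (hC' 0).
have q0 : 0 <= q by rewrite !mulr_ge0 // invr_ge0 ltW.
pose A := 5 * rho + n.+2%:R + q `^ n.+1%:R.
pose t := Num.bound A.
have A0 : 0 <= A.
  have q1 : 0 <= q `^ n.+1%:R by exact: powR_ge0.
  by have n0 : 0 <= n.+2%:R :> R by []; rewrite /A; lra.
have tA : A < t%:R by exact: archi_boundP.
have qn : 0 <= q `^ n.+1%:R by exact: powR_ge0.
eexists; exists t; split; first reflexivity.
split; first by move: tA; rewrite /A; lra.
move=> x z tx.
have qx : q <= nrm x `^ n.+1%:R^-1.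
  have -> : q = (q `^ n.+1%:R) `^ n.+1%:R^-1.
    by rewrite -powRrM divff ?pnatr_eq0// powRr1.
  apply: ge0_ler_powR; rewrite ?nnegrE ?invr_ge0//.
  by move: tA; rewrite /A; have : 0 <= n.+1%:R :> R by []; lra.
apply: (@le_trans _ _ (n.+1%:R^-1 * q)); last by rewrite ler_wpM2l ?invr_ge0.
rewrite /q mulrCA mulVf ?pnatr_eq0// mulr1.
by rewrite ler_wpM2l// invr_ge0 ltW.
Qed.

(** The correction of stage n is -p^-1 r_n translated by the new jump y.
    Adding p T_y to the operator cancels r_n, and leaves p h_n(. + y) - p^-1
    (L_n r_n)(. - y), which vanishes on the ball of radius a_n = t_n - 3
    rho_n.  The a_n increase to infinity and corrections of later stages
    vanish on that ball, so the limit is eventually equal to h_n there and has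
    residual zero. *)
Theorem sparse_harmonic (m : nat) (s : nat -> V) (h0 : V -> R) (rho0 C0 : R) :
  0 <= rho0 -> (forall k, (k < m)%N -> nrm (s k) <= rho0) ->
  supported rho0 h0 -> (forall x, `|h0 x| <= C0) ->
  exists (y : nat -> V) (h : V -> R),
    [/\ (forall k, (k < m)%N -> y k = s k) /\
        (forall k, (m <= k)%N -> exists t, (k < t)%N /\ y k = u *+ t),
        forall rho, exists K, forall x, nrm x <= rho ->
          (forall k, (K <= k)%N -> h (x + y k) = 0) /\
          \sum_(k < K) p k * h (x + y k) = h x,
        forall rho, exists l, forall x, nrm x <= rho -> h x = tcomb l h0 x,
        forall n, exists M, forall x, M <= nrm x ->
          `|h x| <= n.+1%:R^-1 * nrm x `^ n.+1%:R^-1 &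
        (forall x, nrm x <= rho0 -> h x = h0 x) /\
        (forall n, exists k, (n <= k)%N /\ h (u *+ k) = 0)].
Proof.
move=> rho00 sr sh0 h0C.
pose l0 : seq (R * V) := (-1, 0) :: [seq (p k, s k) | k <- iota 0 m].
have nrm0 : nrm 0 = 0 by rewrite -(mulr0n u) nrmu.
have good0 : sparse_good h0 (l0, h0, rho0).
  split=> //.
  - move=> cv; rewrite inE => /predU1P[->/=|]; first by rewrite nrm0.
    by move=> /mapP[k]; rewrite mem_iota add0n => /andP[_ km] ->; exact: sr.
  - by exists C0.
  - by exists [:: (1, 0)]; rewrite tcomb_id.
have [S [S0 SG SS]] := dependent_sequence
  (G := fun n => sparse_good h0)
  (Q := fun n s s' => exists t, sparse_step (m + n) s s' t)
  good0 (fun n st G =>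
    let: ex_intro s' (ex_intro t H) := sparse_step_exists (m + n) G in
    ex_intro _ s' (conj (sparse_step_good G H) (ex_intro _ t H))).
have [t {}SS] := choice SS.
pose l_ n := (S n).1.1; pose h_ n := (S n).1.2; pose rho_ n := (S n).2.
(* The jumps s_0, ..., s_(m-1) are present from the start; stage n adds the
   jump of index m + n. *)
pose y k := if (k < m)%N then s k else u *+ t (k - m)%N.
have SE n : S n = (l_ n, h_ n, rho_ n) by rewrite /l_ /h_ /rho_; case: (S n) => -[].
have lS n : l_ n.+1 = rcons (l_ n) (p (m + n)%N, u *+ t n).
  by have := SS n; rewrite (SE n) /l_ => -[-> _].
have hS n x : h_ n.+1 x =
    h_ n x - (p (m + n)%N)^-1 * tcomb (l_ n) (h_ n) (x - u *+ t n).
  by have := SS n; rewrite (SE n) [h_ n.+1]/h_ => -[-> _].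
have rhoS n : rho_ n.+1 = (t n)%:R + 2 * rho_ n.
  by have := SS n; rewrite (SE n) [rho_ n.+1]/rho_ => -[-> _].
have tge n : 5 * rho_ n + (m + n).+2%:R <= (t n)%:R :> R.
  by have := SS n; rewrite (SE n) => -[_ []].
have grow n x z : (t n)%:R - 3 * rho_ n <= nrm x ->
    (p (m + n)%N)^-1 * `|tcomb (l_ n) (h_ n) z| <=
    (m + n).+1%:R^-1 * nrm x `^ (m + n).+1%:R^-1.
  by have := SS n; rewrite (SE n) => -[_ [_]]; exact.
have rho_ge0 n : 0 <= rho_ n by have := SG n; rewrite (SE n) => -[].
have lr n cv : cv \in l_ n -> nrm cv.2 <= rho_ n.
  by have := SG n; rewrite (SE n) => -[_ + _ _ _]; exact.
have sh n : supported (rho_ n) (h_ n) by have := SG n; rewrite (SE n) => -[].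
have hl n : exists l, h_ n = tcomb l h0 by have := SG n; rewrite (SE n) => -[].
have lE n : l_ n = (-1, 0) :: [seq (p k, y k) | k <- iota 0 (m + n)].
  elim: n => [|n IH].
    rewrite addn0 /l_ S0 /= /l0; congr (_ :: _); apply/eq_in_map => k.
    by rewrite mem_iota add0n /y => /andP[_ ->].
  rewrite lS IH addnS -[(m + n).+1]addn1 (iotaD 0 (m + n)) /= cats1 map_rcons add0n -rcons_cons; congr rcons.
  by rewrite /y ltnNge leq_addr /= addKn.
have opE n f x : tcomb (l_ n) f x = \sum_(k < m + n) p k * f (x + y k) - f x.
  rewrite lE tcomb_cons addr0 mulN1r addrC; congr (_ - _).
  by rewrite /tcomb big_map /= -{1}[(m + n)%N]subn0 big_mkord.
pose a n : R := (t n)%:R - 3 * rho_ n.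
have age n : 2 * rho_ n + (m + n).+2%:R <= a n by rewrite /a; have := tge n; lra.
have aS n : a n <= a n.+1.
  have := age n.+1; rewrite rhoS [a n]/a.
  have : 0 <= (m + n.+1).+2%:R :> R by []. by have := rho_ge0 n; have : 0 <= (t n)%:R :> R by []; lra.
have aW n n' : (n <= n')%N -> a n <= a n'.
  by move=> le; apply: (homo_leq (r := fun x y : R => x <= y)) => //;
    exact: le_trans.
have rhoW n n' : (n <= n')%N -> rho_ n <= rho_ n'.
  move=> le; apply: (homo_leq (r := fun x y : R => x <= y)) => //.
    exact: le_trans.
  by move=> k; rewrite rhoS; have := rho_ge0 k; have : 0 <= (t k)%:R :> R by []; lra.
have rho_a n : rho_ n < a n.
  have := age n; have : 0 < (m + n).+2%:R :> R by []. by have := rho_ge0 n; have : 0 <= (t n)%:R :> R by []; lra.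
have a_nat n : n.+1%:R <= a n.
  have := age n; have : n.+1%:R <= (m + n).+2%:R :> R by rewrite ler_nat; lia.
  by have := rho_ge0 n; have : 0 <= (t n)%:R :> R by []; lra.
have nrm_sub n x : (t n)%:R - nrm x <= nrm (x + u *+ t n).
  by have := nrm_subl x (u *+ t n); rewrite nrmu.
have nrm_sub' n x : (t n)%:R - nrm x <= nrm (x - u *+ t n).
  by have := nrm_subl x (- (u *+ t n)); rewrite nrmN nrmu.
have sr2 n : supported (rho_ n + rho_ n) (tcomb (l_ n) (h_ n)).
  exact: (supported_tcomb (@lr n) (@sh n)).
have natE2 n : (m + n).+2%:R = m%:R + n%:R + 2 :> R.
  by rewrite -addn2 !natrD.
(* Inside the ball of radius a_n the correction vanishes, and so does the new
   residual. *)
have hS_in n x : nrm x < a n -> h_ n.+1 x = h_ n x.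
  move=> xa; rewrite hS sr2 ?mulr0 ?subr0//.
  by have := nrm_sub' n x; move: xa; rewrite /a; have := rho_ge0 n; lra.
have rS_in n x : nrm x < a n -> tcomb (l_ n.+1) (h_ n.+1) x = 0.
  move=> xa; rewrite lS tcomb_rcons.
  have -> : h_ n.+1 = fun x => h_ n x -
      (p (m + n)%N)^-1 * tcomb (l_ n) (h_ n) (x - u *+ t n).
    by apply/funext => z; exact: hS.
  rewrite tcomb_sub_transl addrK mulrBr mulrA divff ?gt_eqF// mul1r.
  rewrite (supported_tcomb (@lr n) (@sr2 n)); last first.
    by have := nrm_sub' n x; move: xa; rewrite /a; lra.
  rewrite sh; last by have := nrm_sub n x; move: xa; rewrite /a; have := rho_ge0 n; lra.
  by ring.
have h_in n n' x : (n <= n')%N -> nrm x < a n -> h_ n' x = h_ n x.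
  move=> /subnK <-; elim: (n' - n)%N => [//|k IH] xa.
  rewrite addSn hS_in ?IH//; apply: (lt_le_trans xa); apply: aW; exact: leq_addl.
(* As n + 1 <= a_n, stage n is final on the ball of radius n + 1. *)
pose h x := h_ (Num.truncn (nrm x)) x.
have hE n x : nrm x < a n -> h x = h_ n x.
  move=> xa; have xt : nrm x < a (Num.truncn (nrm x)).
    by apply: lt_le_trans (a_nat _); exact: truncnS_gt.
  have [le|/ltnW le] := leqP n (Num.truncn (nrm x)).
    by rewrite /h (h_in n).
  by rewrite /h -(h_in _ _ _ le).
exists y, h; split.
- split=> k; first by rewrite /y => ->.
  move=> mk; exists (t (k - m)%N); rewrite /y [(k < m)%N]ltnNge mk; split=> //.
  rewrite -(ltr_nat R); have := tge (k - m)%N.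
  rewrite natE2 -natrD subnKC//; have := rho_ge0 (k - m)%N; lra.
- move=> rho; pose N := (Num.truncn rho).+1.
  have rN n : (N <= n)%N -> rho < a n /\ rho <= rho_ n.+1.
    move=> Nn; have rn : rho < n%:R.
      apply: (lt_le_trans (truncnS_gt rho)); rewrite ler_nat; exact: Nn.
    split; first by apply: lt_le_trans (a_nat n); rewrite -addn1 natrD; lra.
    rewrite rhoS; have := tge n; rewrite natE2.
    by have := rho_ge0 n; have : 0 <= m%:R :> R by []; lra.
  exists (m + N.+1)%N => x xr; split.
    move=> k Kk; rewrite /y ltnNge (leq_trans (leq_addr _ _) Kk)/=.
    have [n nE] : exists n, (k - m)%N = n.+1 /\ (N <= n)%N.
      exists (k - m).-1; split; move: Kk; rewrite /N; lia.
    rewrite nE.1; have [ra rr] := rN _ nE.2; have [ra' rr'] := rN _ (leqW nE.2).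
    (* Near the jump added at stage n + 1, h is the correction of that stage,
       a multiple of the previous residual, which vanishes on the ball. *)
    rewrite (hE n.+2).
      rewrite hS addrK sh; last first.
        have := nrm_sub n.+1 x; have := age n.+1; rewrite /a.
        by have := rho_ge0 n.+1; have : 0 < (m + n.+1).+2%:R :> R by []; lra.
      by rewrite rS_in ?mulr0 ?subr0//; exact: le_lt_trans ra.
    have := nrmD x (u *+ t n.+1); rewrite nrmu.
    have := rho_a n.+2; rewrite rhoS; have := rho_ge0 n.+1; lra.
  have [ra rr] := rN N (leqnn _).
  have := rS_in N x (le_lt_trans xr ra); rewrite opE => /eqP; rewrite subr_eq0.
  move=> /eqP rE; rewrite (hE N.+1) -?rE; last first.
    by apply: le_lt_trans (xr) _; apply: (lt_le_trans ra); exact: aS.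
  apply: eq_bigr => k _; rewrite (hE N.+1)//.
  have yk : nrm (y k) <= rho_ N.+1.
    apply: (lr N.+1 (p k, y k)); rewrite lE inE; apply/orP; right.
    by apply/mapP; exists (val k) => //; rewrite mem_iota /= add0n.
  have := nrmD x (y k); have := age N.+1.
  by have := rho_ge0 N.+1; have : 0 < (m + N.+1).+2%:R :> R by []; lra.
- move=> rho; pose n := Num.truncn rho; have [l hnl] := hl n.
  exists l => x xr; rewrite (hE n) ?hnl//; apply: le_lt_trans xr _.
  by apply: lt_le_trans (a_nat _); exact: truncnS_gt.
- move=> n; exists (rho_ n + 1) => x xM.
  have x1 : 1 <= nrm x by have := rho_ge0 n; have : 0 <= (t n)%:R :> R by []; lra.
  have x0 : 0 < nrm x by lra.
  suff H k : `|h_ (n + k)%N x| <= n.+1%:R^-1 * nrm x `^ n.+1%:R^-1.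
    pose N := maxn n (Num.truncn (nrm x)).
    rewrite (hE N); last first.
      apply: (lt_le_trans (truncnS_gt _)); apply: le_trans (a_nat _).
      by rewrite ler_nat ltnS leq_maxr.
    by rewrite -[N](subnKC (leq_maxl n (Num.truncn (nrm x)))); exact: H.
  have b0 : 0 <= n.+1%:R^-1 * nrm x `^ n.+1%:R^-1.
    by rewrite mulr_ge0 ?powR_ge0 ?invr_ge0.
  elim: k => [|k IH]; first by rewrite addn0 sh ?normr0//; lra.
  rewrite addnS; have [xa|ax] := ltP (nrm x) (a (n + k)%N).
    by rewrite hS_in.
  rewrite hS sh ?sub0r ?normrN; last by apply: lt_le_trans ax.
  rewrite normrM gtr0_norm ?invr_gt0//.
  apply: (le_trans (grow _ _ _ ax)).
  have le1 : n.+1%:R <= (m + (n + k)).+1%:R :> R by rewrite ler_nat; lia.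
  apply: ler_pM; rewrite ?invr_ge0 ?powR_ge0//.
    by rewrite lef_pV2 ?posrE.
  by rewrite ler_powR// lef_pV2 ?posrE.
- split=> [x xr|n].
    have h00 : h_ 0%N = h0 by rewrite /h_ S0.
    rewrite (hE 0%N) ?h00//; apply: (le_lt_trans xr).
    by have := rho_a 0%N; rewrite {1}/rho_ S0.
  pose k := (Num.truncn (rho_ n)).+1.
  have r0 := rho_ge0 n.
  have k1 : rho_ n < k%:R by exact: truncnS_gt.
  exists (maxn n k); split; first exact: leq_maxl.
  have Mr : rho_ n < (maxn n k)%:R.
    by apply: lt_le_trans k1 _; rewrite ler_nat leq_maxr.
  rewrite (hE n) ?sh ?nrmu//.
  have k2 : k%:R <= rho_ n + 1.
    by rewrite /k -addn1 natrD lerD2r truncn_le.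
  have := age n; rewrite natE2; have : 0 <= m%:R :> R by [].
  have n0 : 0 <= n%:R :> R by [].
  have [_|_] := leqP k n; last by lra.
  by lra.
Qed.

End sparse_harmonic.

(** * A slowly growing harmonic function on the integers *)

Section weights.
Context {R : realType}.

(** A probability on the naturals that charges every point; it plays the part
    of the weights p_k. *)
Definition weight_measure : probability nat R := poisson_prob (1 : R) 0%N.

Definition weight (k : nat) : R := fine (weight_measure [set k]).

Lemma weight_gt0 k : 0 < weight k.
Proof.
rewrite /weight /= /poisson_prob ltr01 esum_set1 ?lee_fin ?poisson_pmf_ge0//=.
by rewrite /poisson_pmf ltr01 expr1n mul1r mulr_gt0 ?expR_gt0// invr_gt0 ltr0n fact_gt0.
Qed.

Lemma weightE k : weight_measure [set k] = (weight k)%:E.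
Proof. by rewrite fineK// fin_num_measure. Qed.

Lemma measurable_nat d (T : measurableType d) (f : nat -> T) :
  measurable_fun setT f.
Proof. by []. Qed.

Lemma weight_measureT : (weight_measure : {measure set nat -> \bar R}) setT = 1%E.
Proof. exact: (@probability_setT _ _ _ weight_measure). Qed.

Lemma weight_integrable_bounded (f : nat -> R) (M : R) :
  (forall k, `|f k| <= M) -> weight_measure.-integrable setT (EFin \o f).
Proof.
move=> fM; apply: measurable_bounded_integrable => //.
  by rewrite weight_measureT ltry.
exists M; split; first exact: num_real.
move=> M' /ltW MM' k _; exact: le_trans (fM k) MM'.
Qed.

Lemma eventually0_bounded (f : nat -> R) K :
  (forall k, (K <= k)%N -> f k = 0) -> exists M : R, forall k, `|f k| <= M.
Proof.
move=> f0; exists (\sum_(i < K) `|f i|) => k.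
have [kK|/f0->] := ltnP k K; last by rewrite normr0 sumr_ge0.
by rewrite (bigD1 (Ordinal kK))//= lerDl sumr_ge0.
Qed.

Lemma weight_Rintegral_sum (f : nat -> R) K :
  (forall k, (K <= k)%N -> f k = 0) ->
  \int[weight_measure]_(k in setT) f k = \sum_(k < K) weight k * f k.
Proof.
elim: K f => [|K IH] f f0.
  rewrite big_ord0 (_ : f = cst 0) ?Rintegral_cst ?mul0r//.
  by apply/funext => k; exact: f0.
rewrite big_ord_recr /=.
pose g k := if k == K then 0 else f k.
pose e k := f K * \1_[set K] k.
have fE k : f k = g k + e k.
  rewrite /g /e indicE; have [->|/eqP kK] := eqVneq k K.
    by rewrite mem_set// add0r mulr1.
  by rewrite memNset// mulr0 addr0.
have g0 k : (K <= k)%N -> g k = 0.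
  rewrite leq_eqVlt /g => /predU1P[->|Kk]; first by rewrite eqxx.
  by rewrite f0// if_same.
have [Mg hMg] := eventually0_bounded g0.
have i1 : weight_measure.-integrable setT (EFin \o (\1_[set K] : nat -> R)).
  apply: (@weight_integrable_bounded _ 1) => k.
  by rewrite indicE; case: (_ \in _); rewrite ?normr1 ?normr0.
under eq_Rintegral do rewrite fE.
rewrite RintegralD//; last 2 first.
- exact: weight_integrable_bounded hMg.
- apply: (@weight_integrable_bounded _ `|f K|) => k.
  by rewrite /e indicE; case: (_ \in _); rewrite ?mulr1 ?mulr0 ?normr0.
congr (_ + _).
  rewrite IH//; apply: eq_bigr => k _; congr (_ * _).
  by rewrite /g ltn_eqF.
rewrite RintegralZl// /Rintegral integral_indic// setIT mulrC.
by rewrite /weight.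
Qed.

Lemma weight_Rintegral_subc (f : nat -> R) K (c : R) :
  (forall k, (K <= k)%N -> f k = 0) ->
  weight_measure.-integrable setT (EFin \o (fun k => f k - c)) /\
  \int[weight_measure]_(k in setT) (f k - c) = \sum_(k < K) weight k * f k - c.
Proof.
move=> f0; have [M hM] := eventually0_bounded f0; split.
  apply: (@weight_integrable_bounded _ (M + `|c|)) => k.
  by apply: (le_trans (ler_normB _ _)); rewrite lerD2r.
rewrite RintegralB//; last 2 first.
- exact: weight_integrable_bounded hM.
- exact: (@weight_integrable_bounded _ `|c|).
rewrite (weight_Rintegral_sum f0) Rintegral_cst//; congr (_ - _).
by rewrite weight_measureT /= mulr1.
Qed.

End weights.

Section jumps.
Context {R : realType} d (T : measurableType d) (y : nat -> T).

Definition jump (k : nat) : T := y k.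

HB.instance Definition _ := isMeasurableFun.Build _ _ _ _ jump
  (measurable_nat jump).

Definition jump_measure : set T -> \bar R :=
  image_measure (@weight_measure R) jump.

HB.instance Definition _ := Measure.on jump_measure.

Lemma jump_measure_setT : jump_measure setT = 1%E.
Proof. by rewrite /jump_measure /image_measure/= /pushforward preimage_setT weight_measureT. Qed.

HB.instance Definition _ :=
  @Measure_isProbability.Build _ _ R jump_measure jump_measure_setT.

Lemma jump_measure_ge k A : A (y k) -> ((weight k)%:E <= jump_measure A)%E.
Proof.
move=> Ak; rewrite -weightE; apply: le_measure; rewrite ?inE//.
by move=> _ ->.
Qed.

(** Integrals against the law of the jumps become integrals over the index
    k. *)
Lemma jump_integral (D : set T) (F : T -> R) :
  measurable D -> (forall k, D (y k)) -> measurable_fun setT F ->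
  weight_measure.-integrable setT (EFin \o (fun k => F (y k))) ->
  jump_measure.-integrable D (EFin \o F) /\
  \int[jump_measure]_(t in D) F t = \int[@weight_measure R]_(k in setT) F (y k).
Proof.
move=> mD Dy mF iF.
have DT : y @^-1` D = setT by rewrite -subTset => k _; exact: Dy.
have /measurable_EFinP mEF := mF.
split.
  apply: (@integrable_pushforward _ _ _ _ _ jump (measurable_nat jump)) => //.
  by rewrite DT.
rewrite /Rintegral; congr fine.
rewrite (@integral_pushforward _ _ _ _ _ jump (measurable_nat jump)) ?DT//.
Qed.

End jumps.
Arguments jump_measure {R d T} y _.

Section integers.
Context {R : realType}.

Lemma int_normD (x y : int) : int_norm (x + y) <= int_norm x + int_norm y :> R.
Proof. by rewrite /int_norm -intrD ler_int ler_normD. Qed.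

Lemma poly_natzeros (q : {poly R}) :
  (forall n, exists k, (n <= k)%N /\ q.[k%:R] = 0) -> q = 0.
Proof.
move=> qz; apply/eqP; apply: contraT => q0.
have /choice[F FP] := qz.
pose Z n := iter n (fun k => F k.+1) (F 0%N).
have Zlt n : (Z n < Z n.+1)%N by exact: (FP _).1.
have Zmono : {mono Z : m n / (m <= n)%N} by apply: leq_mono; apply: homo_ltn => //; exact: ltn_trans.
have Zroot n : root q (Z n)%:R.
  by apply/rootP; case: n => [|n]; exact: (FP _).2.
have := max_poly_roots q0 (rs := [seq (Z n)%:R | n <- iota 0 (size q)]).
rewrite size_map size_iota ltnn; apply.
  by apply/allP => _ /mapP[n _ ->]; exact: Zroot.
rewrite map_inj_uniq ?iota_uniq// => m n /eqP; rewrite eqr_nat => /eqP.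
exact: (incn_inj Zmono).
Qed.

(** For x large, |h(x)| is at most (n + 1)^-1 |x|^(1 / (n + 1)) for every n:
    take n with 1 / (n + 1) <= eps. *)
Lemma tends0_of_growth (T : Type) (nrm : T -> R) (h : T -> R) :
  (forall x, 0 <= nrm x) ->
  (forall n, exists M, forall x, M <= nrm x ->
     `|h x| <= n.+1%:R^-1 * nrm x `^ n.+1%:R^-1) ->
  forall eps : R, 0 < eps ->
    tends0_at_infinity nrm (fun x => nrm x `^ (- eps) * h x).
Proof.
move=> n0 gr eps eps0 e e0.
pose n := Num.bound (Num.max eps^-1 e^-1).
have nb : Num.max eps^-1 e^-1 < n.+1%:R.
  have : Num.max eps^-1 e^-1 < n%:R.
    by apply: archi_boundP; rewrite le_max invr_ge0 ltW.
  by move/lt_trans; apply; rewrite ltr_nat.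
have [neps ne] : n.+1%:R^-1 <= eps /\ n.+1%:R^-1 < e.
  move: nb; rewrite gt_max => /andP[a b].
  by split; [apply/ltW|]; rewrite invf_plt ?posrE.
have [M hM] := gr n; exists (Num.max M 1) => x.
rewrite gt_max => /andP[/ltW xM x1]; rewrite normrM ger0_norm ?powR_ge0//.
apply: le_lt_trans ne.
apply: (le_trans (ler_wpM2l (powR_ge0 _ _) (hM x xM))).
have xn0 : nrm x != 0 by rewrite gt_eqF// (lt_trans ltr01).
rewrite mulrCA -powRD; last by rewrite xn0 implybT.
rewrite ger_pMr ?invr_gt0// -[leRHS](powRr0 (nrm x)) ler_powR// ?(ltW x1)//.
by rewrite addrC subr_le0.
Qed.

(** The law of the jumps is reflected because the convolution evaluates h at x
    - y.  It is not a Dirac measure as it charges two different points. *)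
Theorem slowly_growing_harmonic_on_int :
  exists (mu : probability int R) (h : int -> R),
     [/\ ~ is_dirac mu,
         forall eps : R, 0 < eps ->
           tends0_at_infinity int_norm (fun x => int_norm x `^ (- eps) * h x),
         int_conv_is h mu h,
         nonconstant h &
         ~ int_polynomial h].
Proof.
have nrmn n : int_norm (1 *+ n) = n%:R :> R.
  by rewrite /int_norm normrMn normr1 natz -pmulrn.
pose h0 (x : int) : R := (x == 0)%:R.
have int_normN x : int_norm (- x) = int_norm x :> R by rewrite /int_norm normrN.
have int_norm_ge0 x : 0 <= int_norm x :> R by rewrite /int_norm ler0z.
have h0s : supported (@int_norm R) 0 h0.
  by move=> x; rewrite /int_norm ltr0z normr_gt0 /h0 => /negPf ->.
have h0b x : `|h0 x| <= 1 by rewrite /h0; case: eqP; rewrite ?normr0 ?normr1.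
have [y [h [[_ ysp] hloc _ hgr [h0E hz]]]] :=
  sparse_harmonic int_normD int_normN int_norm_ge0 nrmn (@weight_gt0 R)
    (m := 0) (s := fun=> 0) (lexx 0) (fun k H => False_ind _ (notF H)) h0s h0b.
have hN0 : h 0 = 1 by rewrite h0E ?/h0 ?eqxx// /int_norm normr0.
have np : ~ int_polynomial h.
  move=> [q hq]; suff q0 : q = 0.
    by move: hN0; rewrite hq q0 horner0 => /eqP; rewrite eq_sym oner_eq0.
  apply: poly_natzeros => n; have [k [nk hk]] := hz n.
  by exists k; split=> //; move: hk; rewrite hq natz -pmulrn.
exists (jump_measure (fun k => - y k)), h; split=> //.
- move=> [a mua].
  have ya k : a = - y k.
    have := @jump_measure_ge R _ _ (fun k => - y k) k [set - y k] erefl.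
    rewrite mua diracE lee_fin; case: (boolP (a \in _)) => [|_].
      by rewrite inE.
    by rewrite leNgt weight_gt0.
  have [t [_ yt]] := ysp 0%N isT; have [t' [tt' yt']] := ysp t isT.
  move: (ya 0%N); rewrite (ya t) => /oppr_inj; rewrite yt yt' => /(congr1 int_norm).
  move=> /(_ R); rewrite !nrmn => /eqP; rewrite eqr_nat => /eqP tt.
  by move: tt'; rewrite tt ltnn.
- exact: tends0_of_growth.
- move=> x; have [K hK] := hloc (int_norm x); have [h0K hs] := hK x (lexx _).
  have [] := @jump_integral R _ int (fun k => - y k) setT (fun z => h (x - z)).
  - by [].
  - by [].
  - by [].
  - under eq_fun do rewrite opprK.
    have [M hM] := eventually0_bounded h0K.
    exact: weight_integrable_bounded hM.
  move=> i1 i2; split=> //; rewrite i2.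
  under eq_Rintegral do rewrite opprK.
  by rewrite (weight_Rintegral_sum h0K).
- move=> [c hc]; apply: np; exists c%:P => x.
  by rewrite hornerC hc.
Qed.
End integers.

(** * A smooth bump function *)

Section smooth_functions.
Context {R : realType}.
Implicit Types (f g : R -> R) (q : {poly R}).

(** Smoothness by coinduction: a class of differentiable functions that is
    stable under differentiation consists of smooth functions. *)
Lemma smooth_closed (P : (R -> R) -> Prop) :
  (forall f, P f -> (forall x, derivable f x 1) /\ P (derive1 f)) ->
  forall f, P f -> smooth f.
Proof.
move=> Pd f Pf k; suff : P (derive1n k f) by move=> /Pd[].
by elim: k => [//|k IH] /=; exact: (Pd _ IH).2.
Qed.

Lemma smooth_derivable f : smooth f -> forall x, derivable f x 1.
Proof. by move=> sf; exact: (sf 0%N). Qed.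

Lemma smooth_derive1 f : smooth f -> smooth (derive1 f).
Proof. by move=> sf k; rewrite -derive1Sn; exact: sf. Qed.

Lemma is_derive1P f (x df : R) : is_derive x 1 f df -> derivable f x 1 /\ derive1 f x = df.
Proof. by move=> [d e]; rewrite derive1E. Qed.

Lemma smooth_is_derive f (x : R) : smooth f -> is_derive x 1 f (derive1 f x).
Proof. by move=> sf; apply: DeriveDef; [exact: smooth_derivable|rewrite derive1E]. Qed.

(** The class of finite sums of products of two smooth functions is stable
    under differentiation. *)
Lemma smoothM f g : smooth f -> smooth g -> smooth (fun x => f x * g x).
Proof.
move=> sf sg.
pose P h := exists s : seq ((R -> R) * (R -> R)),
  (forall uv, List.In uv s -> smooth uv.1 /\ smooth uv.2) /\
  h = fun x => \sum_(uv <- s) uv.1 x * uv.2 x.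
apply: (@smooth_closed P) => [h [s [ss ->]]|]; last first.
  exists [:: (f, g)]; split.
    by move=> uv [<-|[]]; split; [exact: sf|exact: sg].
  by apply/funext => x; rewrite big_seq1.
elim: s ss => [|[u v] s IH] ss.
  have -> : (fun x => \sum_(uv <- [::]) uv.1 x * uv.2 x) = cst 0 :> (R -> R).
    by apply/funext => x; rewrite big_nil.
  split; first by move=> x; exact: derivable_cst.
  by exists [::]; split=> //; apply/funext => x; rewrite derive1_cst big_nil.
have [su sv] : smooth u /\ smooth v by exact: (ss (u, v) (or_introl erefl)).
have [ds [s' [ss' es']]] := IH (fun uv H => ss uv (or_intror H)).
set S := fun x => \sum_(uv <- s) uv.1 x * uv.2 x in ds es'.
have dS (x : R) : is_derive x 1 S (derive1 S x).
  by apply: DeriveDef; [exact: ds|rewrite derive1E].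
have E : (fun x => \sum_(uv <- (u, v) :: s) uv.1 x * uv.2 x) = u * v + S.
  by apply/funext => x; rewrite big_cons.
have D (x : R) : is_derive x 1 (u * v + S)
    (u x *: derive1 v x + v x *: derive1 u x + derive1 S x).
  by apply: is_deriveD; apply: is_deriveM; exact: smooth_is_derive.
rewrite E; split; first by move=> x; exact: (is_derive1P (D x)).1.
exists ((u, derive1 v) :: (derive1 u, v) :: s'); split.
  move=> uv [<-|[<-|suv]]; last exact: ss'.
    by split; [exact: su|exact: smooth_derive1].
  by split; [exact: smooth_derive1|exact: sv].
apply/funext => x; rewrite (is_derive1P (D x)).2 es' !big_cons /= addrA.
by congr (_ + _ + _); rewrite mulrC.
Qed.

Lemma smooth_affine f (c a b : R) : smooth f -> smooth (fun x => c * f (a + b * x)).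
Proof.
move=> sf.
pose P h := exists (g : R -> R) (c' : R), smooth g /\ h = fun x => c' * g (a + b * x).
apply: (@smooth_closed P); last by exists f, c.
move=> _ [g [c' [sg ->]]].
have D (x : R) : is_derive x 1 (fun x => c' * g (a + b * x))
   (c' *: (derive1 g (a + b * x) * b)).
  have -> : (fun x => c' * g (a + b * x)) = c' *: (g \o (fun x => a + b * x)).
    by apply/funext.
  apply: is_deriveZ; apply: is_derive1_comp; first exact: smooth_is_derive.
  have -> : (fun x => a + b * x) = cst a + b *: (id : R -> R) by apply/funext.
  have E : 0 + b *: (1 : R) = b by rewrite add0r /GRing.scale /= mulr1.
  rewrite -[X in is_derive _ _ _ X]E; apply: is_deriveD.
split; first by move=> x; exact: (is_derive1P (D x)).1.
exists (derive1 g), (c' * b); split; first exact: smooth_derive1.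
apply/funext => x; rewrite (is_derive1P (D x)).2 /GRing.scale /=.
by rewrite mulrAC mulrA.
Qed.

Lemma is_derive_horner q (x : R) : is_derive x 1 (horner q) (q^`()).[x].
Proof.
elim/poly_ind: q => [|q c IH].
  rewrite deriv0 horner0.
  have -> : horner (0 : {poly R}) = cst 0 by apply/funext => y; rewrite horner0.
  exact: is_derive_cst.
have -> : horner (q * 'X + c%:P) = horner q * id + cst c.
  by apply/funext => y; rewrite hornerMXaddC.
apply: is_derive_eq.
rewrite derivD derivC addr0 derivM derivX mulr1 /GRing.scale /= !hornerE.
by ring.
Qed.

Lemma horner_le_expR q : exists C : R, 0 <= C /\
  forall t, 0 <= t -> `|q.[t]| <= C * expR t.
Proof.
exists (\sum_(i < size q) `|q`_i| * i`!%:R); split.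
  by apply: sumr_ge0 => i _; rewrite mulr_ge0.
move=> t t0; rewrite horner_coef mulr_suml.
apply: (le_trans (ler_norm_sum _ _ _)); apply: ler_sum => i _.
rewrite normrM -mulrA ler_wpM2l// normrX ger0_norm//.
case: (val i) => [|n].
  by rewrite expr0 fact0 mul1r -[leLHS]addr0; apply: le_trans (expR_ge1Dx t); rewrite lerD2l.
have := expR_ge1Dxn n t0; have f0 : 0 < (n.+1)`!%:R :> R by rewrite ltr0n fact_gt0.
move=> H; rewrite mulrC -ler_pdivrMr//; apply: le_trans H; rewrite lerDr//.
Qed.

(** Polynomials in 1/x times exp(-1/x), extended by 0 to the half-line x <= 0.
    The polynomial factor makes the class stable under differentiation, see
    is_derive_flat. *)
Definition flat q (x : R) : R :=
  if 0 < x then q.[x^-1] * expR (- x^-1) else 0.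

(** Quadratic vanishing at 0, which gives the derivative there; it says that
    q(s) s^2 = O(e^s) as s = 1/x tends to infinity. *)
Lemma flat_le_sqr q : exists C : R, 0 <= C /\ forall x, `|flat q x| <= C * x ^+ 2.
Proof.
have [C [C0 hC]] := horner_le_expR (q * 'X^2); exists C; split=> // x.
rewrite /flat; case: ifPn => x0; last by rewrite normr0 mulr_ge0 ?sqr_ge0.
have xi0 : 0 < x^-1 by rewrite invr_gt0.
have := hC x^-1 (ltW xi0); rewrite hornerM hornerXn !normrM.
rewrite (gtr0_norm (expR_gt0 _)) !(gtr0_norm xi0) expRN => H.
rewrite ler_pdivrMr ?expR_gt0// mulrAC -ler_pdivrMr ?exprn_gt0//.
by rewrite expr2 invfM.
Qed.

Lemma is_derive_flat q (x : R) : is_derive x 1 (flat q) (flat ('X^2 * (q - q^`())) x).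
Proof.
have [x0|x0|x0] := ltgtP x 0.
- rewrite {2}/flat ltNge (ltW x0) /=.
  apply: (near_eq_is_derive (f := cst 0)).
  have : \forall y \near x, y < 0 by exact: lt_nbhsl.
  by apply: filterS => y y0; rewrite /flat ltNge (ltW y0).
- rewrite {2}/flat x0.
  apply: (near_eq_is_derive
    (f := (horner q \o (fun y => y^-1)) * (expR \o (fun y => - y^-1)))).
    have : \forall y \near x, 0 < y by exact: lt_nbhsr.
    by apply: filterS => y y0; rewrite /flat y0.
  have xn0 : x != 0 by rewrite gt_eqF.
  have dV : is_derive x 1 (fun y : R => y^-1) (- x ^- 2 *: 1).
    by apply: (@is_deriveV _ id).
  have d1 := is_derive1_comp (is_derive_horner q x^-1) dV.
  have dN : is_derive x 1 (fun y : R => - y^-1) (- (- x ^- 2 *: 1)).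
    exact: is_deriveN.
  have d2 := @is_derive1_comp R expR (fun y => - y^-1) x _ _ (is_derive_expR _) dN.
  apply: is_derive_eq; rewrite /GRing.scale /= hornerM hornerXn hornerD hornerN -exprVn.
  by ring.
rewrite x0 {2}/flat ltxx.
have [C [C0 hC]] := flat_le_sqr q.
(* Differentiability at 0 comes from the quadratic bound. *)
have cv : (fun h : R => h^-1 *: ((flat q \o shift 0) (h *: 1) - flat q 0)) h
    @[h --> 0^'] --> (0 : R).
  apply/cvgr0Pnorm_le => e e0.
  have C1 : 0 < C + 1 by lra.
  have : \forall h \near (0:R)^', `|h| < e / (C + 1).
    by apply: dnbhs0_lt; rewrite divr_gt0.
  have : \forall h \near (0:R)^', h != 0 by exact: nbhs_dnbhs_neq.
  apply: filterS2 => h h0 he.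
  rewrite [flat q 0]/flat ltxx subr0 /= addr0 /GRing.scale /= mulr1 normrM normfV.
  rewrite mulrC ler_pdivrMr ?normr_gt0//.
  apply: (le_trans (hC h)); rewrite -real_normK ?num_real// expr2 mulrA.
  rewrite ler_wpM2r//; move: he; rewrite ltr_pdivlMr//.
  have := normr_ge0 h; nra.
apply: DeriveDef; first by apply/cvg_ex; exists 0; exact: cv.
by apply: cvg_lim; [|exact: cv].
Qed.

Lemma smooth_flat q : smooth (flat q).
Proof.
apply: (@smooth_closed (fun f => exists q, f = flat q)); last by exists q.
move=> _ [r ->]; split=> [x|]; first exact: (is_derive1P (is_derive_flat r x)).1.
exists ('X^2 * (r - r^`())); apply/funext => x.
exact: (is_derive1P (is_derive_flat r x)).2.
Qed.

Lemma horner1 (t : R) : (1 : {poly R}).[t] = 1.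
Proof. by rewrite -polyC1 hornerC. Qed.

(** The factor exp(1)^2 normalizes the value at 0 to 1. *)
Definition bump (x : R) : R :=
  expR 1 ^+ 2 * (flat 1 (1 + 1 * x) * flat 1 (1 + (-1) * x)).

Lemma smooth_bump : smooth bump.
Proof.
have s1 := @smooth_affine _ 1 1 1 (@smooth_flat 1).
have s2 := @smooth_affine _ 1 1 (-1) (@smooth_flat 1).
have := @smooth_affine _ (expR 1 ^+ 2) 0 1 (smoothM s1 s2).
rewrite /bump; congr (smooth _); apply/funext => x.
by rewrite add0r !mul1r.
Qed.

Lemma flat1_ge0 x : 0 <= flat 1 x.
Proof.
by rewrite /flat; case: ifP => // _; rewrite horner1 mul1r expR_ge0.
Qed.

Lemma flat1_le1 x : flat 1 x <= 1.
Proof.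
rewrite /flat; case: ifP => // x0; rewrite horner1 mul1r -expR0 ler_expR.
by rewrite oppr_le0 invr_ge0 ltW.
Qed.

Lemma bump_ge0 x : 0 <= bump x.
Proof. by rewrite /bump !mulr_ge0 ?flat1_ge0 ?exprn_ge0 ?expR_ge0. Qed.

Lemma bump0 : bump 0 = 1.
Proof.
rewrite /bump !mulr0 addr0 /flat ltr01 horner1 mul1r invr1 expRN.
by rewrite expr2 mulrACA divff ?mulr1 // gt_eqF ?expR_gt0.
Qed.

Lemma bump_supp x : 1 <= `|x| -> bump x = 0.
Proof.
rewrite ler_normr /bump mul1r mulN1r => /orP[x1|x1].
  by rewrite [flat 1 (1 - x)]/flat ltNge subr_le0 x1 /= !mulr0.
by rewrite [flat 1 (1 + x)]/flat ltNge -(opprK x) subr_le0 x1 /= mul0r mulr0.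
Qed.

Lemma bump_le x : bump x <= expR 1 ^+ 2.
Proof.
rewrite /bump ger_pMr ?exprn_gt0 ?expR_gt0//.
by rewrite mulr_ile1 ?flat1_ge0 ?flat1_le1.
Qed.

Lemma smooth_continuous f : smooth f -> continuous f.
Proof.
move=> sf x; apply: differentiable_continuous; apply/derivable1_diffP.
exact: smooth_derivable.
Qed.

End smooth_functions.

(** * Invariance of Lebesgue measure; measurability on row vectors *)

Section measure_preserving.
Context d (T : measurableType d) (R : realType).
Context (mu : {measure set T -> \bar R}) (phi : {mfun T >-> T}).
Hypothesis phiP : forall A, measurable A -> mu (phi @^-1` A) = mu A.

Lemma preserving_ge0_integral (f : T -> \bar R) :
  measurable_fun setT f -> (forall x, (0 <= f x)%E) ->
  (\int[mu]_x f (phi x) = \int[mu]_x f x)%E.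
Proof.
move=> mf f0.
rewrite -[RHS](@eq_measure_integral _ _ _ _ _ (image_measure mu phi)); last first.
  by move=> A mA _; rewrite -phiP.
rewrite (ge0_integral_pushforward (phi := phi)) //.
Qed.

(** Both sides are integrals against the image of mu under phi, which is
    mu. *)
Lemma preserving_Rintegral (f : T -> R) :
  mu.-integrable setT (EFin \o f) ->
  mu.-integrable setT (EFin \o (fun x => f (phi x))) /\
  \int[mu]_(x in setT) f (phi x) = \int[mu]_(x in setT) f x.
Proof.
move=> /integrableP[mf fi].
have mphi : measurable_fun setT phi by [].
have i2 : mu.-integrable setT (EFin \o (fun x => f (phi x))).
  apply/integrableP; split; first exact: (measurableT_comp mf mphi).
  rewrite (preserving_ge0_integral (f := fun x => `|(f x)%:E|%E))//.
  exact: measurableT_comp.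
split=> //; rewrite /Rintegral; congr fine.
rewrite -[RHS](@eq_measure_integral _ _ _ _ _ (image_measure mu phi)); last first.
  by move=> A mA _; rewrite -phiP.
by rewrite (integral_pushforward mphi).
Qed.

End measure_preserving.

Lemma integrable_bounded_support d (T : measurableType d) (R : realType)
    (mu : {measure set T -> \bar R}) (f : T -> R) (A : set T) (M : R) :
  measurable A -> (mu A < +oo)%E -> measurable_fun setT f ->
  (forall x, `|f x| <= M) -> (forall x, ~ A x -> f x = 0) ->
  mu.-integrable setT (EFin \o f).
Proof.
move=> mA muA mf fM f0.
have -> : EFin \o f = (EFin \o f) \_ A.
  apply/funext => x; rewrite patchE; case: ifPn => // /negP xA /=.
  by rewrite f0// => Ax; apply: xA; rewrite inE.
apply/(integrable_mkcond _ mA); apply: measurable_bounded_integrable => //.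
  exact: measurable_funTS.
exists M; split; first exact: num_real.
by move=> M' /ltW MM' x _; exact: le_trans (fM x) MM'.
Qed.

Section lebesgue_invariance.
Context {R : realType}.
Notation leb := (@lebesgue_measure R).

Definition real_shift (a : R) (x : measurableTypeR R) : measurableTypeR R := x + a.

Lemma measurable_real_shift a : measurable_fun setT (real_shift a).
Proof. by rewrite /real_shift; apply: measurable_funD. Qed.

HB.instance Definition _ a := isMeasurableFun.Build _ _ _ _ (real_shift a)
  (measurable_real_shift a).

Definition real_opp (x : measurableTypeR R) : measurableTypeR R := - x.

Lemma measurable_real_opp : measurable_fun setT real_opp.
Proof. by apply: oppr_measurable. Qed.

HB.instance Definition _ := isMeasurableFun.Build _ _ _ _ real_opp
  measurable_real_opp.

(** It suffices to compare the two measures on half-open intervals. *)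
Lemma lebesgue_shift a A : measurable A -> leb (real_shift a @^-1` A) = leb A.
Proof.
move=> mA; rewrite [RHS](@lebesgue_measure_unique R (image_measure leb (real_shift a)))//.
move=> X [[x y] _ <-] /=.
rewrite /image_measure /pushforward /=.
have -> : real_shift a @^-1` `]x, y] = `]x - a, y - a]%classic.
  by apply/seteqP; split=> z /=; rewrite /real_shift !in_itv /= ltrBlDr lerBrDr.
rewrite !lebesgue_measure_itv /= !lte_fin ltrD2r; case: ifP => // _.
by rewrite -!EFinB; congr EFin; ring.
Qed.

Lemma lebesgue_opp A : measurable A -> leb (real_opp @^-1` A) = leb A.
Proof.
move=> mA; rewrite [RHS](@lebesgue_measure_unique R (image_measure leb real_opp))//.
move=> X [[x y] _ <-] /=.
rewrite /image_measure /pushforward /=.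
have -> : real_opp @^-1` `]x, y] = `[- y, - x[%classic.
  by apply/seteqP; split=> z /=; rewrite /real_opp !in_itv /= ltrNr lerNl andbC.
rewrite !lebesgue_measure_itv /= !lte_fin ltrN2; case: ifP => // _.
by rewrite -!EFinB; congr EFin; ring.
Qed.

Lemma integral_shift (f : R -> R) (a : R) :
  leb.-integrable setT (EFin \o f) ->
  leb.-integrable setT (EFin \o (fun x => f (x + a))) /\
  \int[leb]_(x in setT) f (x + a) = \int[leb]_(x in setT) f x.
Proof. exact: (preserving_Rintegral (phi := real_shift a) (lebesgue_shift a)). Qed.

Lemma integral_opp (f : R -> R) :
  leb.-integrable setT (EFin \o f) ->
  leb.-integrable setT (EFin \o (fun x => f (- x))) /\
  \int[leb]_(x in setT) f (- x) = \int[leb]_(x in setT) f x.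
Proof. exact: (preserving_Rintegral (phi := real_opp) lebesgue_opp). Qed.

End lebesgue_invariance.

Section lebesgue_rV_invariance.
Context {R : realType}.

Definition rV_shift n (v x : 'rV[R]_n) : 'rV[R]_n := x + v.

Lemma measurable_rV_shift n (v : 'rV[R]_n) : measurable_fun setT (rV_shift v).
Proof.
apply: measurable_fun_rV => i; under eq_fun do rewrite mxE.
by apply: measurable_funD => //; exact: measurable_rV_coord.
Qed.

HB.instance Definition _ n (v : 'rV[R]_n) :=
  isMeasurableFun.Build _ _ _ _ (rV_shift v) (measurable_rV_shift v).

Lemma rV_consD n (p : 'rV[R]_n * measurableTypeR R) (v : 'rV[R]_n.+1) :
  rV_cons p + v = rV_cons (p.1 + \row_j v 0 (lift ord0 j), p.2 + v 0 ord0).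
Proof.
apply/rowP => i; rewrite !mxE; case: unliftP => [j ->|->] //=.
by rewrite !mxE.
Qed.

(** By induction on the dimension: the slices of a translated set are the
    translated slices, so the one-dimensional invariance applies in the last
    coordinate and the inductive hypothesis to the measure of the slices. *)
Lemma lebesgue_rV_shift n (v : 'rV[R]_n) A : measurable A ->
  lebesgue_rV n (rV_shift v @^-1` A) = lebesgue_rV n A.
Proof.
elim: n v A => [|n IH] v A mA.
  have -> : rV_shift v @^-1` A = A; last by [].
  apply/seteqP; split=> x /=; rewrite /rV_shift.
    by rewrite (_ : x + v = x)//; apply/rowP => -[].
  by rewrite (_ : x + v = x)//; apply/rowP => -[].
pose w : 'rV[R]_n := \row_j v 0 (lift ord0 j).
pose B := @rV_cons R n @^-1` A.
have mB : measurable B.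
  by rewrite /B -[X in measurable X]setTI; exact: measurable_rV_cons.
transitivity (\int[lebesgue_rV n]_x (lebesgue_measure (xsection B (rV_shift w x))))%E.
  rewrite /= /image_measure /pushforward /= /product_measure1.
  apply: eq_integral => x _ /=.
  rewrite -[RHS](lebesgue_shift (v 0 ord0)); last exact: measurable_xsection.
  congr lebesgue_measure; apply/seteqP; split=> t;
  rewrite /xsection /= !inE /= /B /rV_shift /real_shift /= rV_consD //=.
rewrite (@preserving_ge0_integral _ _ _ (lebesgue_rV n) (rV_shift w) (IH w)
   (fun x => lebesgue_measure (xsection B x)))//.
exact: measurable_fun_xsection.
Qed.

Lemma integral_rV_shift n (f : 'rV[R]_n -> R) (v : 'rV[R]_n) :
  (lebesgue_rV n).-integrable setT (EFin \o f) ->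
  (lebesgue_rV n).-integrable setT (EFin \o (fun x => f (x + v))) /\
  \int[lebesgue_rV n]_(x in setT) f (x + v) = \int[lebesgue_rV n]_(x in setT) f x.
Proof.
exact: (preserving_Rintegral (phi := rV_shift v) (@lebesgue_rV_shift n v)).
Qed.

Definition rV_box n (rho : R) : set 'rV[R]_n := [set x | forall i, `|x 0 i| <= rho].

Lemma measurable_rV_box n rho : measurable (@rV_box n rho).
Proof.
have -> : @rV_box n rho =
    \bigcap_(i in [set: 'I_n]) ((fun x : 'rV[R]_n => x 0 i) @^-1` `[- rho, rho]).
  apply/seteqP; split=> [x xb i _ /=|x xb i]; first by rewrite in_itv /= -ler_norml.
  by have := xb i I; rewrite /= in_itv /= -ler_norml.
apply: fin_bigcap_measurable => // i _.
by rewrite -[X in measurable X]setTI; exact: (measurable_rV_coord i).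
Qed.

Lemma lebesgue_rV_box n rho : (lebesgue_rV n (@rV_box n rho) < +oo)%E.
Proof.
elim: n => [|n IH]; first by rewrite /= diracE ltry.
rewrite /= /image_measure /pushforward /=.
have -> : @rV_cons R n @^-1` (@rV_box n.+1 rho) = @rV_box n rho `*` `[- rho, rho].
  apply/seteqP; split=> [[x t] /= xb|[x t] [/= xb]].
    split=> [j|]; first by have := xb (lift ord0 j); rewrite mxE liftK.
    by have := xb ord0; rewrite mxE unlift_none /= in_itv /= -ler_norml.
  rewrite in_itv /= -ler_norml => tb i; rewrite mxE.
  by case: unliftP => [j _|_] //=.
rewrite product_measure1E//; last exact: measurable_rV_box.
rewrite lte_mul_pinfty//.
- by rewrite ge0_fin_numE.
- change (lebesgue_measure `[(- rho)%R, rho]%classic < +oo)%E.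
  by rewrite lebesgue_measure_itv /=; case: ifP; rewrite ltry.
Qed.

(** An open set is the union of the rational boxes that it contains. *)
Lemma open_measurable_rV n (U : set 'rV[R]_n) : open U -> measurable U.
Proof.
move=> oU.
pose E (q : 'rV[rat]_n * nat) : set 'rV[R]_n :=
  [set x | forall i, ratr (q.1 0 i) - q.2.+1%:R^-1 < x 0 i < ratr (q.1 0 i) + q.2.+1%:R^-1].
have mE q : measurable (E q).
  have -> : E q = \bigcap_(i in [set: 'I_n]) ((fun x : 'rV[R]_n => x 0 i) @^-1`
      `]ratr (q.1 0 i) - q.2.+1%:R^-1, ratr (q.1 0 i) + q.2.+1%:R^-1[).
    apply/seteqP; split=> [x xb i _ /=|x xb i]; first by rewrite in_itv /=; exact: xb.
    by have := xb i I; rewrite /= in_itv.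
  apply: fin_bigcap_measurable => // i _.
  by rewrite -[X in measurable X]setTI; exact: (measurable_rV_coord i).
have -> : U = \bigcup_q (if pselect (E q `<=` U) then E q else set0).
  apply/seteqP; split=> [x Ux|x [q _]]; last by case: pselect => // EU; exact: EU.
  have /nbhs_ballP[e /= e0 eU] : nbhs x U by exact: open_nbhs_nbhs.
  pose N := Num.bound (2 / e).
  have Ne : N.+1%:R^-1 < e / 2.
    rewrite invf_plt ?posrE ?divr_gt0// invf_div.
    apply: (@lt_trans _ _ N%:R); last by rewrite ltr_nat.
    by apply: archi_boundP; rewrite divr_ge0// ltW.
  have N0 : 0 < N.+1%:R^-1 :> R by rewrite invr_gt0.
  have [a [aE a0 ae]] : exists a : R, [/\ N.+1%:R^-1 = a, 0 < a & a < e / 2].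
    by exists N.+1%:R^-1.
  have /choice[q hq] (i : 'I_n) : exists q : rat, x 0 i - a < ratr q < x 0 i + a.
    have [|q] := @rat_in_itvoo R (x 0 i - a) (x 0 i + a); first by lra.
    by rewrite in_itv /=; exists q.
  exists (\row_i q i, N) => //; case: pselect => [_ i|[]] /=.
    by rewrite mxE aE; have /andP[] := hq i; move=> *; apply/andP; split; lra.
  move=> z zE; apply: eU; split=> //= i j; rewrite ord1.
  rewrite /ball /= ltr_norml; have := zE j; have := hq j; rewrite /= mxE aE.
  by move=> /andP[? ?] /andP[? ?]; apply/andP; split; lra.
apply: countable_bigcupT_measurable => [|q]; first exact: countableP.
by case: pselect => _ /=; [exact: mE|exact: measurable0].
Qed.

Lemma continuous_measurable_rV n (f : 'rV[R]_n -> R) :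
  continuous f -> measurable_fun setT f.
Proof.
move=> /continuousP cf; apply: (measurability _ (RGenOpens.measurableE R)).
move=> _ [_ [a [b ->] <-]]; rewrite setTI; apply: open_measurable_rV.
exact/cf/interval_open.
Qed.

End lebesgue_rV_invariance.

(** * Norms, continuity and partial derivatives on row vectors *)

Section norms.
Context {R : realType} {d : nat}.
Implicit Types x y : 'rV[R]_d.

Lemma rV_coord_le_norm x i : `|x 0 i| <= `|x|.
Proof.
rewrite [leRHS]mx_normE -[leLHS]nngE num_le.
exact: (le_bigmax _ (fun ij => `|x ij.1 ij.2|%:nng) (0, i)).
Qed.

Lemma rV_norm_le x (M : R) : 0 <= M -> (forall i, `|x 0 i| <= M) -> `|x| <= M.
Proof.
move=> M0 xM; rewrite [leLHS]mx_normE -[M]/((NngNum M0)%:num) num_le.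
apply/bigmax_leP; split=> [|[i j] _]; first by rewrite -num_le.
by rewrite -num_le /= ord1.
Qed.

(** The recursion on R^d is run in the sup norm; this inequality and the next
    transfer its growth bounds to the Euclidean norm. *)
Lemma norm_le_enorm x : `|x| <= enorm x.
Proof.
apply: rV_norm_le => [|i]; first exact: sqrtr_ge0.
rewrite -sqrtr_sqr ler_sqrt; last by apply: sumr_ge0 => *; exact: sqr_ge0.
rewrite (bigD1 i)//= lerDl; apply: sumr_ge0 => *; exact: sqr_ge0.
Qed.

Lemma enorm_le_norm x : enorm x <= d%:R * `|x|.
Proof.
have dx : 0 <= d%:R * `|x| :> R by rewrite mulr_ge0.
rewrite /enorm -(ger0_norm dx) -sqrtr_sqr ler_sqrt ?sqr_ge0// exprMn.
apply: (@le_trans _ _ (\sum_(i < d) `|x| ^+ 2)).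
  apply: ler_sum => i _; rewrite -real_normK ?num_real//.
  by rewrite lerXn2r ?nnegrE// rV_coord_le_norm.
rewrite sumr_const card_ord -[leLHS]mulr_natl ler_wpM2r ?sqr_ge0//.
by rewrite -natrX ler_nat; nia.
Qed.

Lemma sum_continuous (I : Type) (r : seq I) (f : I -> 'rV[R]_d -> R) :
  (forall i, continuous (f i)) -> continuous (fun x => \sum_(i <- r) f i x).
Proof.
move=> cf; elim: r => [|i r IH] x.
  rewrite (_ : (fun x => _) = cst 0); first exact: cst_continuous.
  by apply/funext => z; rewrite big_nil.
rewrite (_ : (fun x => _) = (f i : _ -> R) + (fun x => \sum_(j <- r) f j x)).
  by apply: continuousD; [exact: cf|exact: IH].
by apply/funext => z; rewrite big_cons.
Qed.

Lemma prod_continuous (I : Type) (r : seq I) (f : I -> 'rV[R]_d -> R) :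
  (forall i, continuous (f i)) -> continuous (fun x => \prod_(i <- r) f i x).
Proof.
move=> cf; elim: r => [|i r IH] x.
  rewrite (_ : (fun x => _) = cst 1); first exact: cst_continuous.
  by apply/funext => z; rewrite big_nil.
rewrite (_ : (fun x => _) = (f i : _ -> R) * (fun x => \prod_(j <- r) f j x)).
  by apply: continuousM; [exact: cf|exact: IH].
by apply/funext => z; rewrite big_cons.
Qed.

Lemma enorm_continuous : continuous (@enorm R d).
Proof.
move=> x; apply: (@continuous_comp _ _ _ (fun x : 'rV[R]_d => \sum_i x 0 i ^+ 2) Num.sqrt);
  last exact: sqrt_continuous.
apply: sum_continuous => i {}x.
rewrite (_ : (fun x => _) = (fun x : 'rV[R]_d => x 0 i) * (fun x => x 0 i)).
  by apply: continuousM; exact: coord_continuous.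
by apply/funext => z; rewrite expr2.
Qed.

Lemma dot_continuous (xi : 'rV[R]_d) : continuous (dot xi).
Proof.
apply: sum_continuous => i x.
rewrite (_ : (fun x => _) = cst (xi 0 i) * (fun x : 'rV[R]_d => x 0 i))//.
by apply: continuousM; [exact: cst_continuous|exact: coord_continuous].
Qed.

Lemma shift_continuous (f : 'rV[R]_d -> R) (a : 'rV[R]_d) :
  continuous f -> continuous (fun x => f (x + a)).
Proof.
move=> cf x; apply: (@continuous_comp _ _ _ (fun x => x + a) f); last exact: cf.
rewrite (_ : (fun x => _) = (id : 'rV[R]_d -> _) + cst a); last by [].
by apply: continuousD; [exact: cvg_id|exact: cst_continuous].
Qed.

Lemma tcomb_continuous l (f : 'rV[R]_d -> R) :
  continuous f -> continuous (tcomb l f).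
Proof.
move=> cf; apply: sum_continuous => -[c v] x /=.
rewrite (_ : (fun x => _) = cst c * (fun x => f (x + v)))//.
by apply: continuousM; [exact: cst_continuous|exact: shift_continuous].
Qed.

Lemma continuous_bounded_box (f : 'rV[R]_d -> R) (rho : R) :
  continuous f -> exists M : R, forall x, `|x| <= rho -> `|f x| <= M.
Proof.
move=> cf; pose A : set 'rV[R]_d := [set x | `|x| <= rho].
have cA : compact A.
  apply: bounded_closed_compact.
    exists rho; split; first exact: num_real.
    by move=> M /ltW rM x Ax; exact: le_trans Ax rM.
  have -> : A = (fun x : 'rV[R]_d => `|x|) @^-1` [set t | t <= rho] by [].
  apply: closed_comp; last exact: closed_le.
  by move=> x _; exact: norm_continuous.
have /compact_bounded[M [_ hM]] : compact (f @` A).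
  by apply: continuous_compact => //; exact: continuous_subspaceT.
exists (M + 1) => x Ax; apply: (hM (M + 1)); first by lra.
by exists x.
Qed.

Lemma integrable_continuous_support (f : 'rV[R]_d -> R) (rho : R) :
  continuous f -> (forall x, rho < `|x| -> f x = 0) ->
  (lebesgue_rV d).-integrable setT (EFin \o f).
Proof.
move=> cf f0; have [M hM] := continuous_bounded_box rho cf.
apply: (@integrable_bounded_support _ _ _ _ f (@rV_box R d rho) (Num.max M 0)).
- exact: measurable_rV_box.
- exact: lebesgue_rV_box.
- exact: continuous_measurable_rV.
- move=> x; rewrite le_max; have [/hM->//|/f0->] := leP `|x| rho.
  by rewrite normr0 lexx orbT.
- move=> x xb; apply: f0; rewrite ltNge; apply/negP => xr; apply: xb => i.
  exact: le_trans (rV_coord_le_norm x i) xr.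
Qed.

End norms.

Section partial_derivatives.
Context {R : realType} {d : nat}.
Implicit Types (f g : 'rV[R]_d -> R) (x v a : 'rV[R]_d).

Lemma smooth_rV_closed (P : ('rV[R]_d -> R) -> Prop) :
  (forall f, P f -> [/\ continuous f,
     forall i x, derivable f x (delta_mx 0 i) & forall i, P (partial i f)]) ->
  forall f, P f -> smooth_rV f.
Proof.
move=> PP f Pf s; suff /PP[] : P (partials s f) by [].
by elim: s => [//|i s IH] /=; have [_ _] := PP _ IH; exact.
Qed.

Lemma is_derive_shifted f x v a (df : R) :
  is_derive (x + a) v f df -> is_derive x v (fun z => f (z + a)) df.
Proof.
move=> [fd fe].
have E : (fun h : R => h^-1 *: (((fun z => f (z + a)) \o shift x) (h *: v) - f (x + a)))
       = (fun h => h^-1 *: ((f \o shift (x + a)) (h *: v) - f (x + a))).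
  by apply/funext => h /=; rewrite addrA.
apply: DeriveDef; first by move: fd; rewrite /derivable -E.
by move: fe; rewrite /derive -E.
Qed.

Lemma is_derive_tcomb l f (f' : 'rV[R]_d -> R) v :
  (forall x, is_derive x v f (f' x)) ->
  forall x, is_derive x v (tcomb l f) (tcomb l f' x).
Proof.
move=> df x; elim: l => [|[c a] l IH].
  have -> : tcomb [::] f = cst 0 by apply/funext => z; rewrite tcomb_nil.
  by rewrite tcomb_nil; exact: is_derive_cst.
have -> : tcomb ((c, a) :: l) f = c *: (fun z => f (z + a)) + tcomb l f.
  by apply/funext => z; rewrite tcomb_cons.
rewrite tcomb_cons; apply: is_deriveD; apply: is_deriveZ.
exact: is_derive_shifted.
Qed.

(** Along e_j only the j-th factor varies. *)
Lemma is_derive_prod (b : 'I_d -> R -> R) (j : 'I_d) x : smooth (b j) ->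
  is_derive x (delta_mx 0 j) (fun z => \prod_i b i (z 0 i))
    (\prod_i (if i == j then derive1 (b j) else b i) (x 0 i)).
Proof.
move=> sb; pose C := \prod_(i | i != j) b i (x 0 i).
have E (h : R) : \prod_i b i ((h *: delta_mx 0 j + x) 0 i) = b j (h + x 0 j) * C.
  rewrite (bigD1 j)//= !mxE !eqxx mulr1; congr (_ * _); apply: eq_bigr => i ij.
  by rewrite !mxE (negPf ij) andbF mulr0 add0r.
have -> : \prod_i (if i == j then derive1 (b j) else b i) (x 0 i) =
    derive1 (b j) (x 0 j) * C.
  rewrite (bigD1 j)//= eqxx; congr (_ * _).
  by apply: eq_bigr => i /negPf ->.
have E0 : \prod_i b i (x 0 i) = b j (x 0 j) * C by rewrite (bigD1 j).
have cb : h^-1 *: ((b j \o shift (x 0 j)) (h *: 1) - b j (x 0 j)) @[h --> 0^'] -->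
    derive1 (b j) (x 0 j).
  by rewrite derive1E; exact: (smooth_derivable sb).
have cv : h^-1 *: (((fun z : 'rV[R]_d => \prod_i b i (z 0 i)) \o shift x)
    (h *: delta_mx 0 j) - \prod_i b i (x 0 i)) @[h --> 0^'] -->
    derive1 (b j) (x 0 j) * C.
  rewrite (_ : (fun h => _) = (fun h : R =>
      h^-1 *: ((b j \o shift (x 0 j)) (h *: 1) - b j (x 0 j)) * C)).
    by apply: cvgM; [exact: cb|exact: cvg_cst].
  apply/funext => h; rewrite /= E E0 -mulrBl /GRing.scale /= mulr1.
  by rewrite mulrA.
apply: DeriveDef; first by apply/cvg_ex; eexists; exact: cv.
exact: cvg_lim cv.
Qed.

(** Translates of products of smooth functions of one coordinate form, with
    their linear combinations, a class that is stable under partial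
    derivatives. *)
Lemma smooth_tcomb_prod (l : seq (R * 'rV[R]_d)) (b : 'I_d -> R -> R) : (forall i, smooth (b i)) ->
  smooth_rV (tcomb l (fun z : 'rV[R]_d => \prod_i b i (z 0 i))).
Proof.
move=> sb; apply: (@smooth_rV_closed (fun f => exists b : 'I_d -> R -> R,
  (forall i, smooth (b i)) /\ f = tcomb l (fun z : 'rV[R]_d => \prod_i b i (z 0 i)))); last first.
  by exists b.
move=> _ [{sb}b [sb ->]].
have D j x : is_derive x (delta_mx 0 j) (tcomb l (fun z : 'rV[R]_d => \prod_i b i (z 0 i)))
    (tcomb l (fun z : 'rV[R]_d => \prod_i (if i == j then derive1 (b j) else b i) (z 0 i)) x).
  apply: (@is_derive_tcomb l _ (fun z : 'rV[R]_d =>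
    \prod_i (if i == j then derive1 (b j) else b i) (z 0 i))) => z.
  exact: is_derive_prod.
split.
- apply: tcomb_continuous; apply: prod_continuous => i x.
  apply: (@continuous_comp _ _ _ (fun x : 'rV[R]_d => x 0 i) (b i)).
    exact: coord_continuous.
  exact: smooth_continuous.
- by move=> j x; have [] := D j x.
- move=> j; exists (fun i => if i == j then derive1 (b j) else b i); split.
    by move=> i; case: eqP => // _; exact: smooth_derive1.
  by apply/funext => x; rewrite /partial; have [_ ->] := D j x.
Qed.

Lemma partials_local f g (U : set 'rV[R]_d) : open U ->
  (forall x, U x -> f x = g x) ->
  forall s x, U x -> partials s f x = partials s g x.
Proof.
move=> oU fg; elim=> [//|i s IH] x Ux /=; rewrite /partial.
apply: near_eq_derive; apply: filterS IH _.
exact: open_nbhs_nbhs.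
Qed.

Lemma smooth_rV_local f :
  (forall rho : R, exists g, smooth_rV g /\ forall x, `|x| <= rho -> f x = g x) ->
  smooth_rV f.
Proof.
move=> loc s.
have H x : {for x, continuous (partials s f)} /\
    forall i, derivable (partials s f) x (delta_mx 0 i).
  have [g [sg fg]] := loc (`|x| + 1).
  pose U : set 'rV[R]_d := [set z | `|z| < `|x| + 1].
  have oU : open U.
    have -> : U = (fun x : 'rV[R]_d => `|x|) @^-1` [set t | t < `|x| + 1] by [].
    apply: open_comp; last exact: open_lt.
    by move=> z _; exact: norm_continuous.
  have Ux : U x by rewrite /U /= ltrDl.
  have E := partials_local oU (fun z Uz => fg z (ltW Uz)) s.
  have nE : \forall z \near x, partials s g z = partials s f z.
    by apply: filterS (open_nbhs_nbhs (conj oU Ux)) => z Uz; rewrite E.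
  have [cg dg] := sg s; split=> [|i].
    have cgx := cg x; rewrite /continuous_at -(E x Ux) in cgx.
    move=> A /cgx gA; have {}gA : \forall z \near x, A (partials s g z) by exact: gA.
    have : \forall z \near x, A (partials s f z).
      by apply: filterS2 nE gA => z ->.
    by [].
  exact: near_eq_derivable (dg i x).
by split=> [x|i x]; [exact: (H x).1|exact: (H x).2].
Qed.

End partial_derivatives.

(** * Arguments where the cosine equals one *)

Section cos_one.
Context {R : realType}.

Lemma cos_periodic_int (x : R) (k : int) : cos (x + k%:~R * (pi *+ 2)) = cos x.
Proof.
have H (n : nat) (z : R) : cos (z + n%:R * (pi *+ 2)) = cos z.
  elim: n z => [|n IH] z; first by rewrite mul0r addr0.
  by rewrite -natr1 mulrDl mul1r addrA cosD2pi IH.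
case: k => n; first exact: H.
rewrite NegzE mulrNz mulNr -(H n.+1 (x - _)) subrK //.
Qed.

Lemma cos_eq1 (x : R) : cos x = 1 -> exists k : int, x = k%:~R * (pi *+ 2).
Proof.
move=> cx; have p0 : 0 < pi *+ 2 :> R by rewrite mulrn_wgt0 // pi_gt0.
pose k := Num.floor (x / (pi *+ 2)); exists k.
pose y := x - k%:~R * (pi *+ 2).
have cy : cos y = 1.
  by rewrite /y -mulNr -mulrNz cos_periodic_int.
have y0 : 0 <= y.
  by rewrite /y subr_ge0 -ler_pdivlMr// floor_le.
have y1 : y < pi *+ 2.
  have : x / (pi *+ 2) < k%:~R + 1 by have /andP[_] := floor_itv (x / (pi *+ 2)); rewrite intrD.
  by rewrite ltr_pdivrMr// mulrDl mul1r /y; lra.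
have [ypi|ypi] := leP y pi.
  have : y = 0.
    apply: cos_inj; rewrite ?cy ?cos0//.
      by rewrite in_itv /= y0.
    by rewrite in_itv /= lexx pi_ge0.
  by move=> /eqP; rewrite subr_eq0 => /eqP.
have : pi *+ 2 - y = 0.
  apply: cos_inj; rewrite ?cos0//.
  - by rewrite in_itv /=; move: y1 ypi; rewrite mulr2n; move=> *; apply/andP; split; lra.
  - by rewrite in_itv /= lexx pi_ge0.
  - by rewrite addrC cosD2pi cosN.
by move: y1; lra.
Qed.

(** By the first equation x is 2 pi k with k an integer, by the second x is an
    integer; if k were nonzero, pi would be rational. *)
Lemma cos_eq1_incommensurable (x : R) : cos x = 1 -> cos (pi *+ 2 * x) = 1 -> x = 0.
Proof.
move=> /cos_eq1[k xk] /cos_eq1[l xl].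
have p0 : pi *+ 2 != 0 :> R by rewrite gt_eqF// mulrn_wgt0 // pi_gt0.
have xl' : x = l%:~R by apply: (mulfI p0); rewrite xl mulrC.
have [k0|k0] := eqVneq k 0; first by rewrite xk k0 mul0r.
exfalso; apply: (@pi_irrationnal R); exists (l%:~R / (k%:~R * 2)) => //.
rewrite rmorphM fmorphV rmorphM /= !ratr_int ratr_nat -xl' xk mulr2n.
field.
by rewrite intr_eq0.
Qed.

End cos_one.

(** * A slowly growing harmonic function on the d-dimensional space *)

Lemma polynomial_rV_line (R : realType) (d : nat) (h : 'rV[R]_d -> R) (u : 'rV[R]_d) :
  polynomial_rV h -> exists q : {poly R}, forall t : R, h (t *: u) = q.[t].
Proof.
move=> [p hp].
exists (mpoly.mmap (fun c => c%:P) (fun i => (u 0 i)%:P * 'X) p) => t.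
rewrite hp /mpoly.meval /mpoly.mmap horner_sum; apply: eq_bigr => m _.
rewrite hornerM hornerC; congr (_ * _); rewrite /mpoly.mmap1 horner_prod.
apply: eq_bigr => i _; rewrite horner_exp hornerM hornerC hornerX mxE.
by rewrite mulrC.
Qed.

Section real_integrable.
Context d (T : measurableType d) (R : realType) (mu : {measure set T -> \bar R}).
Implicit Types f g : T -> R.
Local Notation integ f := (mu.-integrable setT (EFin \o f)).

Lemma integ0 : integ (fun _ : T => 0 : R).
Proof.
exact: (integrable0 mu setT).
Qed.

Lemma integD f g : integ f -> integ g -> integ (fun x => f x + g x).
Proof.
move=> fi gi; exact: (integrableD measurableT fi gi).
Qed.

Lemma integZ (c : R) f : integ f -> integ (fun x => c * f x).
Proof.
move=> fi; exact: (integrableZl measurableT c fi).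
Qed.

Lemma integB f g : integ f -> integ g -> integ (fun x => f x - g x).
Proof.
move=> fi gi; have := integD fi (integZ (-1) gi).
by apply: eq_integrable => // x _; rewrite /= mulN1r.
Qed.

End real_integrable.

Section weak_harmonic.
Context {R : realType} {d : nat}.
Implicit Types (h phi : 'rV[R]_d -> R) (x y : 'rV[R]_d).

Lemma integral_sum_shift K (c : nat -> R) (y : nat -> 'rV[R]_d)
    (w : nat -> 'rV[R]_d -> R) :
  (forall k, (lebesgue_rV d).-integrable setT (EFin \o w k)) ->
  [/\ (lebesgue_rV d).-integrable setT (EFin \o (fun x => \sum_(k < K) c k * w k x)),
      (lebesgue_rV d).-integrable setT
        (EFin \o (fun x => \sum_(k < K) c k * w k (x + y k))) &
      \int[lebesgue_rV d]_(x in setT) (\sum_(k < K) c k * w k x) =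
      \int[lebesgue_rV d]_(x in setT) (\sum_(k < K) c k * w k (x + y k))].
Proof.
move=> iw; elim: K => [|K [i1 i2 e]].
  rewrite (_ : (fun x => _) = (fun=> 0)); last by apply/funext => x; rewrite big_ord0.
  rewrite (_ : (fun x => \sum_(k < 0) c k * w k (x + y k)) = (fun=> 0)); last first.
    by apply/funext => x; rewrite big_ord0.
  by split=> //; exact: integ0.
have iK := integZ (c K) (iw K).
have [iK' eK] := integral_rV_shift (y K) iK.
rewrite (_ : (fun x => _) = (fun x => \sum_(k < K) c k * w k x + c K * w K x));
  last by apply/funext => x; rewrite big_ord_recr.
rewrite (_ : (fun x => \sum_(k < K.+1) c k * w k (x + y k)) =
    (fun x => \sum_(k < K) c k * w k (x + y k) + c K * w K (x + y K)));
  last by apply/funext => x; rewrite big_ord_recr.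
split; [exact: integD|exact: integD|].
by rewrite !RintegralD// e; congr (_ + _); exact/esym.
Qed.

(** The support is stated in terms of the sup norm, as in the recursion. *)
Lemma test_function_support phi : test_function phi ->
  exists2 rho : R, 0 <= rho & forall x, rho < `|x| -> phi x = 0.
Proof.
move=> [_ /compact_bounded[M [_ hM]]]; exists (Num.max M 0 + 1).
  by rewrite addr_ge0// le_max lexx orbT.
move=> x xM; apply/eqP; apply: contraT => px.
have : `|x| <= Num.max M 0 + 1.
  apply: (hM (Num.max M 0 + 1)); last exact: subset_closure.
  by rewrite (@le_lt_trans _ _ (Num.max M 0)) ?le_max ?lexx// ltrDl.
by rewrite leNgt xM.
Qed.

End weak_harmonic.

Section rV_harmonic.
Context {R : realType} (d' : nat).
Local Notation d := d'.+1.

Lemma measurable_punctured : measurable (@punctured R d).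
Proof.
apply: measurableC; rewrite (_ : [set 0] = @rV_box R d 0).
  exact: measurable_rV_box.
apply/seteqP; split=> [_ -> i|x x0]; first by rewrite mxE normr0.
by apply/rowP => i; apply/eqP; rewrite mxE -normr_le0; exact: x0.
Qed.

Lemma measurable_eball : measurable (@eball R d).
Proof.
rewrite (_ : eball = enorm @^-1` `]-oo, 1[); last first.
  by apply/seteqP; split=> x /=; rewrite in_itv.
rewrite -[X in measurable X]setTI.
exact: (continuous_measurable_rV (@enorm_continuous R d)).
Qed.

(** No jump lies in the unit ball, so the compensator is never seen, and only
    finitely many jumps contribute. *)
Lemma jump_levy_integral (y : nat -> 'rV[R]_d) (f : 'rV[R]_d -> R) x K :
  continuous f -> (forall k, 1 <= enorm (y k)) ->
  (forall k, (K <= k)%N -> f (x + y k) = 0) ->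
  (jump_measure y).-integrable punctured (EFin \o levy_integrand f x) /\
  \int[jump_measure y]_(z in punctured) levy_integrand f x z =
    \sum_(k < K) weight k * f (x + y k) - f x.
Proof.
move=> cf ye f0.
have yE k : levy_integrand f x (y k) = f (x + y k) - f x.
  rewrite /levy_integrand indicE memNset ?mul0r ?subr0//.
  by rewrite /eball /= => /(le_lt_trans (ye k)); rewrite ltxx.
have [i1 i2] := weight_Rintegral_subc (f x) f0.
have EE : (fun k => levy_integrand f x (y k)) = (fun k => f (x + y k) - f x).
  by apply/funext.
have mF : measurable_fun setT (levy_integrand f x).
  apply: measurable_funB.
    apply: measurable_funB => //; rewrite (_ : (fun z => _) = (fun z => f (z + x))).
      by apply: continuous_measurable_rV; exact: shift_continuous.
    by apply/funext => z; rewrite addrC.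
  apply: measurable_funM.
    by apply: measurable_indic; exact: measurable_eball.
  apply: continuous_measurable_rV; apply: sum_continuous => i z.
  rewrite (_ : (fun x0 => _) = (fun z : 'rV[R]_d => z 0 i) * cst (partial i f x))//.
  by apply: continuousM; [exact: coord_continuous|exact: cst_continuous].
have [] := @jump_integral R _ _ y punctured (levy_integrand f x).
- exact: measurable_punctured.
- move=> k /= yk0; have := ye k; rewrite yk0 => /le_trans/(_ (enorm_le_norm _)).
  by rewrite normr0 mulr0 ler10.
- exact: mF.
- by rewrite EE.
by rewrite EE i2.
Qed.

Definition rV_bump (x : 'rV[R]_d) : R := \prod_i bump (x 0 i).

Lemma rV_bump0 : rV_bump 0 = 1.
Proof. by rewrite /rV_bump big1// => i _; rewrite mxE bump0. Qed.

Lemma rV_bump_supp x : 1 < `|x| -> rV_bump x = 0.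
Proof.
move=> x1; suff [i xi] : exists i, 1 <= `|x 0 i|.
  by rewrite /rV_bump (bigD1 i)//= bump_supp ?mul0r.
apply: contrapT => /forallNP H; move: x1; rewrite ltNge => /negP; apply.
by apply: rV_norm_le => // i; rewrite leNgt; apply/negP => /ltW; exact: H.
Qed.

Lemma rV_bump_bounded x : `|rV_bump x| <= (expR 1 ^+ 2) ^+ d.
Proof.
rewrite /rV_bump normr_prod -[X in _ ^+ X]card_ord -prodr_const.
apply: ler_prod => i _; rewrite normr_ge0 ger0_norm ?bump_ge0//.
exact: bump_le.
Qed.

(** The vectors e_j for k < d, then 2 pi e_j for d <= k < 2 d. *)
Definition base_jump (k : nat) : 'rV[R]_d :=
  if (k < d)%N then delta_mx 0 (inord k) else (pi *+ 2) *: delta_mx 0 (inord (k - d)).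

Lemma norm_delta (i : 'I_d) : `|delta_mx 0 i : 'rV[R]_d| = 1.
Proof.
apply/le_anti; apply/andP; split.
  apply: rV_norm_le => // j; rewrite mxE eqxx andTb.
  by case: (_ == _); rewrite ?normr1 ?normr0.
apply: le_trans (rV_coord_le_norm _ i); rewrite mxE !eqxx normr1 //.
Qed.

Lemma pi2_ge1 : 1 <= pi *+ 2 :> R.
Proof. by have := @pi_ge2 R; rewrite mulr2n; lra. Qed.

Lemma base_jump_norm k : 1 <= `|base_jump k| <= pi *+ 2.
Proof.
have p1 := pi2_ge1.
rewrite /base_jump; case: ifP => _; first by rewrite norm_delta lexx.
by rewrite normrZ norm_delta mulr1 ger0_norm ?lexx ?p1// (le_trans ler01).
Qed.

Lemma dot_delta (xi : 'rV[R]_d) (c : R) (i : 'I_d) :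
  dot xi (c *: delta_mx 0 i) = c * xi 0 i.
Proof.
rewrite /dot (bigD1 i)//= big1 => [|j ji].
  by rewrite !mxE !eqxx mulr1 addr0 mulrC.
by rewrite !mxE eqxx andTb (negPf ji) !mulr0.
Qed.

(** A pure jump operator with total mass 1, without diffusion or drift, whose
    first jumps are the vectors of base_jump.  In the weak equation only
    finitely many jumps occur: if phi is supported in a ball, h(x) phi(x -
    y_k) vanishes for all x once k is large, because h vanishes on that ball
    translated by y_k.  The translation invariance of Lebesgue measure then
    moves the jumps from phi to h. *)
Theorem slowly_growing_harmonic_on_rV :
  exists (L : triplet R d) (h : 'rV[R]_d -> R),
       [/\ levy_triplet L, smooth_rV h, not_concentrated_on_subgroup L,
           forall eps : R, 0 < eps ->
             tends0_at_infinity enorm (fun x => enorm x `^ (- eps) * h x) &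
           [/\ harmonic_pointwise L h, harmonic_weak L h,
               nonconstant h & ~ polynomial_rV h]].
Proof.
pose u : 'rV[R]_d := delta_mx 0 ord0.
have normu n : `|u *+ n| = n%:R by rewrite normrMn norm_delta.
have p1 := pi2_ge1.
have bj k : (k < d + d)%N -> `|base_jump k| <= pi *+ 2.
  by move=> _; have /andP[] := base_jump_norm k.
have hs : supported (fun x : 'rV[R]_d => `|x|) (pi *+ 2) rV_bump.
  by move=> x px; apply: rV_bump_supp; exact: le_lt_trans px.
have p0 : 0 <= pi *+ 2 :> R by apply: le_trans p1.
have [y [h [[ybase ysp] hloc hloc0 hgr [h0E hz]]]] :=
  sparse_harmonic (@ler_normD _ _) (@normrN _ _) (@normr_ge0 _ _) normu
    (@weight_gt0 R) p0 bj hs rV_bump_bounded.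
have y1 k : 1 <= `|y k|.
  have [kd|dk] := ltnP k (d + d); first by rewrite ybase//; have /andP[] := base_jump_norm k.
  have [t [kt ->]] := ysp k dk; rewrite normu ler1n; exact: leq_trans kt.
have ye k : 1 <= enorm (y k) by apply: le_trans (norm_le_enorm _).
have yN0 k : y k != 0 by apply: contraTneq (y1 k) => ->; rewrite normr0 -ltNge.
have sh : smooth_rV h.
  apply: smooth_rV_local => rho; have [l hl] := hloc0 rho.
  exists (tcomb l rV_bump); split=> //.
  apply: (@smooth_tcomb_prod _ _ l (fun=> bump)) => i; exact: smooth_bump.
have ch : continuous h by exact: (sh [::]).1.
have h0 : h 0 = 1 by rewrite h0E ?normr0// rV_bump0.
have npoly : ~ polynomial_rV h.
  move=> /(polynomial_rV_line u)[q hq]; suff q0 : q = 0.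
    by have := hq 0; rewrite scale0r h0 q0 horner0 => /eqP; rewrite oner_eq0.
  apply: poly_natzeros => n; have [k [nk hk]] := hz n.
  by exists k; split=> //; rewrite -hq scaler_nat.
pose nu : {measure set 'rV[R]_d -> \bar R} := jump_measure y.
exists (Triplet 0 0 nu), h; split=> //.
- split=> /=.
  + by rewrite trmx0.
  + by move=> xi; rewrite big1// => i _; rewrite big1// => j _; rewrite mxE !mul0r.
  + rewrite /nu /jump_measure /image_measure /pushforward /=.
    rewrite (_ : _ @^-1` _ = set0) ?measure0//.
    by apply/seteqP; split=> // k /= /eqP; rewrite (negPf (yN0 k)).
  + have mF : measurable_fun setT (fun z : 'rV[R]_d => Num.min 1 (enorm z ^+ 2)).
      apply: measurable_minr => //; apply: measurable_funX.
      by apply: continuous_measurable_rV; exact: enorm_continuous.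
    have [||||/integrableP[_ +] _] :=
      @jump_integral R _ _ y punctured (fun z => Num.min 1 (enorm z ^+ 2)).
    * exact: measurable_punctured.
    * by move=> k /= /eqP; rewrite (negPf (yN0 k)).
    * exact: mF.
    * apply: (@weight_integrable_bounded _ _ 1) => k.
      by rewrite ger0_norm ?ge_min ?lexx// le_min ler01 sqr_ge0.
    rewrite (eq_integral (fun z => (Num.min 1 (enorm z ^+ 2))%:E))// => z _.
    by rewrite /= ger0_norm// le_min ler01 sqr_ge0.
- move=> xi xi0.
  have : complex.Re (char_exponent (Triplet 0 0 nu) xi) = 0 by rewrite xi0.
  rewrite /char_exponent /=; under eq_bigr do under eq_bigr do rewrite mxE !mul0r.
  rewrite big1; last by move=> *; rewrite big1.
  rewrite oppr0 !add0r.
  have mF : measurable_fun setT (fun z => 1 - cos (dot xi z) + 0).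
    apply: measurable_funD => //; apply: measurable_funB => //.
    apply: measurableT_comp; first exact: continuous_measurable_fun (@continuous_cos R).
    by apply: continuous_measurable_rV; exact: dot_continuous.
  have cb (t : R) : 0 <= 1 - cos t + 0 <= 2.
    by have := cos_le1 t; have := cos_geN1 t; move=> *; apply/andP; split; lra.
  have iF : weight_measure.-integrable setT
      (EFin \o (fun k => 1 - cos (dot xi (y k)) + 0)).
    apply: (@weight_integrable_bounded _ _ 2) => k.
    by have /andP[c1 c2] := cb (dot xi (y k)); rewrite ger0_norm.
  have [||||_ ->] := @jump_integral R _ _ y punctured (fun z => 1 - cos (dot xi z) + 0).
  + exact: measurable_punctured.
  + by move=> k /= /eqP; rewrite (negPf (yN0 k)).
  + exact: mF.
  + exact: iF.
  move=> I0.
  (* The integrand 1 - cos(xi . y) is nonnegative and every jump is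
     charged. *)
  have cos1 k : cos (dot xi (y k)) = 1.
    pose G j : R := if j == k then 1 - cos (dot xi (y j)) + 0 else 0.
    have G0 j : (k.+1 <= j)%N -> G j = 0 by rewrite /G => /gtn_eqF ->.
    have [M hM] := eventually0_bounded G0.
    have : \int[@weight_measure R]_(j in setT) G j <= 0.
      rewrite -I0; apply: le_Rintegral => //.
        exact: weight_integrable_bounded hM.
      by move=> j _; rewrite /G; case: ifP => // _; have /andP[] := cb (dot xi (y j)).
    rewrite (weight_Rintegral_sum G0) (bigD1 ord_max)//= big1; last first.
      by move=> j jk; rewrite /G ifN ?mulr0//; apply: contraNneq jk => jk; apply/eqP/val_inj.
    rewrite addr0 /G eqxx pmulr_rle0 ?weight_gt0// => le.
    by have := cos_le1 (dot xi (y k)); move=> le'; apply/eqP; rewrite eq_le le' /=; lra.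
  apply/rowP => i; rewrite mxE; apply: cos_eq1_incommensurable.
    have := cos1 (val i); rewrite ybase; last by rewrite ltn_addr ?ltn_ord.
    by rewrite /base_jump ltn_ord inord_val -[delta_mx _ _]scale1r dot_delta mul1r.
  have := cos1 (d + val i)%N; rewrite ybase; last by rewrite ltn_add2l ltn_ord.
  by rewrite /base_jump ltnNge leq_addr /= addKn inord_val dot_delta.
- apply: tends0_of_growth => [x|n]; first exact: sqrtr_ge0.
  have [M hM] := hgr n; exists (d%:R * Num.max M 0) => x xM.
  have Mx : M <= `|x|.
    have := le_trans xM (enorm_le_norm x); rewrite ler_pM2l ?ltr0n//.
    by rewrite ge_max => /andP[].
  apply: (le_trans (hM x Mx)); rewrite ler_wpM2l ?invr_ge0//.
  by apply: ge0_ler_powR; rewrite ?nnegrE ?invr_ge0 ?sqrtr_ge0// norm_le_enorm.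
- split=> //.
  + move=> x; have [K hK] := hloc `|x|; have [hK0 hKs] := hK x (lexx _).
    have [i1 i2] := jump_levy_integral ch ye hK0; split; first exact: i1.
    rewrite /levy_operator /= i2 hKs subrr addr0.
    rewrite big1 ?add0r => [|j _]; last first.
      by rewrite big1// => k _; rewrite mxE mul0r.
    by rewrite big1// => j _; rewrite mxE mul0r.
  + move=> phi tphi; have [rho rho0 phi0] := test_function_support tphi.
    have cphi : continuous phi by exact: (tphi.1 [::]).1.
    have [K hK] := hloc rho.
    have yeN k : 1 <= enorm (- y k).
      rewrite /enorm; under eq_bigr do rewrite mxE sqrrN; exact: ye.
    pose w k x := h x * phi (x - y k).
    have w0 k x : (K <= k)%N -> w k x = 0.
      move=> Kk; rewrite /w; have [xr|/phi0->] := leP `|x - y k| rho; last by rewrite mulr0.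
      by have := (hK _ xr).1 k Kk; rewrite subrK => ->; rewrite mul0r.
    (* For a fixed x, phi(x - y_k) vanishes for k large, but not uniformly in
       x; the factor h(x) makes the truncation at K uniform. *)
    have LE x : h x * levy_operator (dual (Triplet 0 0 nu)) phi x =
        \sum_(k < K) weight k * w k x - h x * phi x.
      pose N := Num.truncn (`|x| + rho).
      have phiN k : (N.+1 + (d + d) <= k)%N -> phi (x - y k) = 0.
        move=> Nk; apply: phi0; have [t [kt yk]] := ysp k (leq_trans (leq_addl _ _) Nk).
        have : `|x| + rho < t%:R.
          apply: lt_trans (truncnS_gt _) _; rewrite ltr_nat.
          by apply: leq_ltn_trans kt; apply: leq_trans Nk; exact: leq_addr.
        have := ler_normB x (x - y k); rewrite opprB addrC subrK yk normu; lra.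
      have [i1 i2] := jump_levy_integral (y := fun k => - y k) cphi yeN phiN.
      rewrite /levy_operator /dual /=.
      rewrite big1 ?add0r => [|j _]; last first.
        by rewrite big1// => k _; rewrite mxE mul0r.
      rewrite big1 ?add0r => [|j _]; last by rewrite !mxE oppr0 mul0r.
      rewrite (_ : \int[_]_(_ in _) _ = \sum_(k < N.+1 + (d + d)) weight k * phi (x - y k) - phi x);
        last exact: i2.
      rewrite mulrBr mulr_sumr; congr (_ - _).
      have ext a b : (forall k, (b <= k)%N -> w k x = 0) -> (b <= a)%N ->
          \sum_(k < a) weight k * w k x = \sum_(k < b) weight k * w k x.
        move=> wb ba; rewrite (big_ord_widen _ (fun k => weight k * w k x) ba).
        rewrite [RHS]big_mkcond /=; apply: eq_bigr => k _; case: ltnP => // bk.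
        by rewrite wb ?mulr0.
      transitivity (\sum_(k < N.+1 + (d + d)) weight k * w k x).
        by apply: eq_bigr => k _; rewrite mulrCA.
      rewrite -(ext (maxn K (N.+1 + (d + d))) (N.+1 + (d + d))%N) ?leq_maxr//; last first.
        by move=> k /phiN; rewrite /w => ->; rewrite mulr0.
      by rewrite (ext _ K) ?leq_maxl// => k; exact: w0.
    have cw k : continuous (w k).
      move=> x; rewrite (_ : w k = h * (fun x => phi (x - y k)))//.
      by apply: continuousM; [exact: ch|exact: shift_continuous].
    have iw k : (lebesgue_rV d).-integrable setT (EFin \o w k).
      apply: (@integrable_continuous_support _ _ _ (rho + `|y k|)) => // x xr.
      rewrite /w phi0 ?mulr0//; have := ler_normD (x - y k) (y k).
      by rewrite subrK; lra.
    have ihp : (lebesgue_rV d).-integrable setT (EFin \o (fun x => h x * phi x)).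
      apply: (@integrable_continuous_support _ _ _ rho) => [x|x /phi0->]; last by rewrite mulr0.
      rewrite (_ : (fun x => _) = h * phi)//.
      by apply: continuousM; [exact: ch|exact: cphi].
    have [i1 i2 e] := integral_sum_shift K weight y iw.
    rewrite (_ : (fun x => _) = (fun x => \sum_(k < K) weight k * w k x - h x * phi x));
      last by apply/funext.
    split; first exact: integB.
    rewrite RintegralB// e -RintegralB//.
    rewrite (_ : (fun x => _) = (fun=> 0)) ?Rintegral_cst ?mul0r//.
    apply/funext => x; have [xr|/phi0 p0x] := leP `|x| rho.
      rewrite -(hK x xr).2 mulr_suml -sumrB big1// => k _.
      by rewrite /w addrK mulrA subrr.
    by rewrite p0x mulr0 subr0 big1// => k _; rewrite /w addrK p0x !mulr0.
  + move=> [c hc]; have [k [_ hk]] := hz 0%N.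
    by move: h0 hk; rewrite hc /= => -> /eqP; rewrite oner_eq0.
Qed.
End rV_harmonic.

(** * Lipschitz functions, antiperiodicity and mollification *)

Section lipschitz.
Context {R : realType}.
Implicit Types (u v w : R -> R) (M L K : R).

(** One constant bounds both the function and its slope, so that products need
    only one rule, blipM. *)
Definition blip M u :=
  (forall x, `|u x| <= M) /\ (forall x y, `|u x - u y| <= M * `|x - y|).

Lemma blip_ge0 M u : blip M u -> 0 <= M.
Proof. by move=> [b _]; exact: le_trans (b 0). Qed.

Lemma blip_le M L u : M <= L -> blip M u -> blip L u.
Proof.
move=> ML [b l]; split=> [x|x y]; first exact: le_trans (b x) ML.
by apply: le_trans (l x y) _; rewrite ler_wpM2r.
Qed.

Lemma blipD M L u v : blip M u -> blip L v -> blip (M + L) (fun x => u x + v x).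
Proof.
move=> [bu lu] [bv lv]; split=> [x|x y].
  by apply: (le_trans (ler_normD _ _)); exact: lerD.
rewrite opprD addrACA mulrDl.
by apply: (le_trans (ler_normD _ _)); exact: lerD.
Qed.

Lemma blipZ (c : R) M u : blip M u -> blip (`|c| * M) (fun x => c * u x).
Proof.
move=> [bu lu]; split=> [x|x y]; first by rewrite normrM ler_wpM2l.
by rewrite -mulrBr normrM -mulrA ler_wpM2l.
Qed.

Lemma blipM M L u v : blip M u -> blip L v -> blip (2 * M * L) (fun x => u x * v x).
Proof.
move=> bM bL; have M0 := blip_ge0 bM; have L0 := blip_ge0 bL.
move: bM bL => [bu lu] [bv lv]; split=> [x|x y].
  rewrite normrM; have : `|u x| * `|v x| <= M * L by exact: ler_pM.
  have : 0 <= M * L by exact: mulr_ge0.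
  by rewrite -mulrA; lra.
have -> : u x * v x - u y * v y = u x * (v x - v y) + (u x - u y) * v y by ring.
apply: (le_trans (ler_normD _ _)); rewrite !normrM.
have h1 : `|u x| * `|v x - v y| <= M * (L * `|x - y|) by exact: ler_pM.
have h2 : `|u x - u y| * `|v y| <= M * `|x - y| * L by exact: ler_pM.
by apply: (le_trans (lerD h1 h2)); rewrite le_eqVlt; apply/orP; left; apply/eqP; ring.
Qed.

Lemma blip_cst (c : R) : blip `|c| (fun=> c).
Proof. by split=> [x|x y]; rewrite ?subrr ?normr0 ?mulr_ge0. Qed.

Lemma blip_continuous M u : blip M u -> continuous u.
Proof.
move=> bu x; have M0 := blip_ge0 bu; case: bu => _ lu.
apply/cvgrPdist_le => e e0.
have M1 : 0 < M + 1 by lra.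
have : \forall y \near x, `|x - y| <= e / (M + 1).
  apply/nbhs_ballP; exists (e / (M + 1)); first exact: divr_gt0.
  by move=> y; rewrite /ball /= => /ltW.
apply: filterS => y; rewrite ler_pdivlMr// => h.
apply: (le_trans (lu x y)); apply: le_trans h.
by rewrite mulrC ler_wpM2l//; lra.
Qed.

Lemma lipschitz_of_derive1_bound (f : R -> R) M :
  (forall x, derivable f x 1) -> (forall x, `|derive1 f x| <= M) ->
  forall x y, `|f x - f y| <= M * `|x - y|.
Proof.
move=> df bf.
have H x y : x < y -> `|f y - f x| <= M * `|y - x|.
  move=> xy; have [||c _ ->] := @MVT R f (derive1 f) x y xy.
  - move=> z _; apply: DeriveDef; [exact: df|by rewrite derive1E].
  - apply: continuous_subspaceT => z; apply: differentiable_continuous.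
    exact/derivable1_diffP.
  - by rewrite normrM ler_wpM2r.
move=> x y; have [xy|xy|->] := ltgtP x y; last by rewrite !subrr !normr0 mulr0.
- by rewrite distrC [`|x - y|]distrC; exact: H.
- exact: H.
Qed.

Lemma blip_of_derive1 (f : R -> R) M :
  (forall x, derivable f x 1) -> (forall x, `|f x| <= M) ->
  (forall x, `|derive1 f x| <= M) -> blip M f.
Proof. by move=> df bf bf'; split=> //; exact: lipschitz_of_derive1_bound. Qed.

Lemma blip_cos (k : R) : 1 <= k -> blip k (fun x => cos (k * x)).
Proof.
move=> k1; split=> [x|x y]; first exact: le_trans (cos_max _) k1.
have := @lipschitz_of_derive1_bound cos 1 (@derivable_cos R).
move=> /(_ _ (k * x) (k * y)); rewrite -mulrBr mul1r normrM ger0_norm ?(le_trans ler01)//.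
by apply=> z; rewrite derive1E derive_val normrN sin_max.
Qed.

Local Notation supp := (supported (fun x : R => `|x|)).

Lemma suppMl K u v : supp K u -> supp K (fun x => u x * v x).
Proof. by move=> su x /su->; rewrite mul0r. Qed.

Lemma suppMr K u v : supp K v -> supp K (fun x => u x * v x).
Proof. by move=> su x /su->; rewrite mulr0. Qed.

Lemma continuous_supp_bounded K u : continuous u -> supp K u ->
  exists M, forall x, `|u x| <= M.
Proof.
move=> cu su; have cA : compact `[- K, K]%classic by exact: segment_compact.
have /compact_bounded[M [_ hM]] : compact (u @` `[- K, K]%classic).
  by apply: continuous_compact => //; exact: continuous_subspaceT.
exists (Num.max (M + 1) 0) => x; rewrite le_max.
have [xK|/su->] := leP `|x| K; last by rewrite normr0 lexx orbT.
rewrite (hM (M + 1)) ?ltrDl//; exists x => //=.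
by rewrite in_itv /= -ler_norml.
Qed.

Lemma supp_derive1 K u : supp K u -> supp K (derive1 u).
Proof.
move=> su x xK; rewrite derive1E.
rewrite (@near_eq_derive _ _ _ _ (cst 0)) ?derive_cst//.
have : \forall y \near x, K < `|y|.
  have oA : open [set y : R | K < `|y|].
    rewrite (_ : mkset _ = (fun y : R => `|y|) @^-1` [set t | K < t])//.
    by apply: open_comp; [move=> z _; exact: norm_continuous|exact: open_gt].
  exact: open_nbhs_nbhs.
by apply: filterS => y /su.
Qed.

Lemma smooth_supp_blip K u : smooth u -> supp K u -> exists M, blip M u.
Proof.
move=> su sK.
have [M1 h1] := continuous_supp_bounded (smooth_continuous su) sK.
have [M2 h2] := continuous_supp_bounded
  (smooth_continuous (smooth_derive1 su)) (supp_derive1 sK).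
exists (Num.max M1 M2); apply: blip_of_derive1.
- exact: smooth_derivable.
- by move=> x; rewrite le_max h1.
- by move=> x; rewrite le_max h2 orbT.
Qed.

Notation leb := (@lebesgue_measure R).
Local Notation I u := (\int[leb]_(x in setT) u x).
Local Notation integ u := (leb.-integrable setT (EFin \o u)).

Lemma segment_finite (a b : R) : (leb `[a, b] < +oo)%E.
Proof. by rewrite lebesgue_measure_itv /=; case: ifP; rewrite ltry. Qed.

Lemma supp_integrable K M u : measurable_fun setT u -> (forall x, `|u x| <= M) ->
  supp K u -> integ u.
Proof.
move=> mu uM su.
apply: (@integrable_bounded_support _ _ _ leb u `[- K, K]%classic M) => //.
  exact: segment_finite.
move=> x xK; apply: su; rewrite ltNge; apply/negP => xK'; apply: xK.
by rewrite /= in_itv /= -ler_norml.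
Qed.

Lemma supp_integral_le K M u : 0 <= K -> measurable_fun setT u ->
  (forall x, `|u x| <= M) -> supp K u -> `|I u| <= 2 * K * M.
Proof.
move=> K0 mu uM su; have iu := supp_integrable mu uM su.
have M0 : 0 <= M by exact: le_trans (uM 0).
apply: (le_trans (le_normr_Rintegral measurableT iu)).
have iI : integ (\1_(`[- K, K]%classic) : R -> R).
  apply: (@supp_integrable K 1) => //.
  - by move=> x; rewrite indicE; case: (_ \in _); rewrite ?normr1 ?normr0.
  - move=> x xK; rewrite indicE memNset//= in_itv /= -ler_norml.
    by move: xK; rewrite ltNge => /negP.
apply: (@le_trans _ _ (I (fun x => M * \1_(`[- K, K]%classic) x))).
  apply: le_Rintegral => //.
  - apply: (@supp_integrable K M) => //.
    + exact: measurableT_comp.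
    + by move=> x; rewrite normr_id.
    + by move=> x /su->; rewrite normr0.
  - exact: integZ.
  - move=> x _; rewrite indicE; have [xK|/su->] := leP `|x| K.
      by rewrite mem_set ?mulr1//= in_itv /= -ler_norml.
    by rewrite normr0 mulr_ge0.
rewrite RintegralZl// /Rintegral integral_indic// setIT.
change (M * fine (leb `[- K, K]%classic) <= 2 * K * M).
rewrite lebesgue_measure_itv /=.
rewrite lte_fin; case: ifP => _ /=; last by rewrite mulr0 !mulr_ge0.
by rewrite opprK le_eqVlt; apply/orP; left; apply/eqP; ring.
Qed.

(** For the function cos(K x), with a = pi / K and e = 0, this is exact
    antiperiodicity. *)
Definition antiperiodic_upto (a e : R) u := forall x, `|u (x + a) + u x| <= e.

(** The integral of u is half that of u(. + a) + u, which is at most e in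
    absolute value and vanishes outside an interval of length 6. *)
Lemma anti_integral (a e : R) M u : 0 <= a <= 1 -> measurable_fun setT u ->
  (forall x, `|u x| <= M) -> supp 2 u -> antiperiodic_upto a e u -> `|I u| <= 3 * e.
Proof.
move=> /andP[a0 a1] mu uM su au; have iu := supp_integrable mu uM su.
have [iua e1] := integral_shift a iu.
have E : I (fun x => u (x + a) + u x) = 2 * I u.
  by rewrite RintegralD// e1 mulr2n mulrDl !mul1r.
have : `|I (fun x => u (x + a) + u x)| <= 2 * 3 * e.
  apply: supp_integral_le => //.
    apply: measurable_funD => //.
    exact: measurableT_comp mu (measurable_real_shift a).
  move=> x x3; rewrite !su ?addr0//; first by lra.
  by have := ler_normB (x + a) a; rewrite addrK (ger0_norm a0); lra.
rewrite E normrM ger0_norm//; lra.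
Qed.

Lemma antiM (a e A L : R) u v : 0 <= a -> 0 <= e -> antiperiodic_upto a e u ->
  (forall x, `|u x| <= A) -> blip L v -> antiperiodic_upto a (L * e + L * a * A) (fun x => u x * v x).
Proof.
move=> a0 e0 au uA bv x; have L0 := blip_ge0 bv; case: bv => bv lv.
have -> : u (x + a) * v (x + a) + u x * v x =
  v (x + a) * (u (x + a) + u x) - u x * (v (x + a) - v x) by ring.
apply: (le_trans (ler_normB _ _)); rewrite !normrM; apply: lerD; first exact: ler_pM.
rewrite mulrC; apply: ler_pM => //.
by have := lv (x + a) x; rewrite addrAC subrr add0r (ger0_norm a0).
Qed.

End lipschitz.

Section mollification.
Context {R : realType}.
Implicit Types (u v ga : R -> R).
Notation leb := (@lebesgue_measure R).
Local Notation supp := (supported (fun x : R => `|x|)).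
Local Notation integ u := (leb.-integrable setT (EFin \o u)).

Definition mollifier (eta : R) ga :=
  [/\ continuous ga, forall x, 0 <= ga x, supp eta ga &
      \int[leb]_(x in setT) ga x = 1].

Lemma mollifier_le (eta eta' : R) ga : eta <= eta' -> mollifier eta ga -> mollifier eta' ga.
Proof. by move=> le [c g s i]; split=> //; exact: supported_le s. Qed.

Definition conv u ga (x : R) : R := \int[leb]_(t in setT) (u (x - t) * ga t).

Definition bcont u := continuous u /\ exists M, forall x, `|u x| <= M.

Lemma blip_bcont M u : blip M u -> bcont u.
Proof. by move=> bu; split; [exact: blip_continuous bu|exists M; exact: bu.1]. Qed.

Lemma bcont_reflect u x : bcont u -> bcont (fun t => u (x - t)).
Proof.
move=> [cu [M hM]]; split; last by exists M.
move=> t; apply: continuous_comp; last exact: cu.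
by apply: continuousB; [exact: cvg_cst|exact: cvg_id].
Qed.

Lemma bcontD u v : bcont u -> bcont v -> bcont (fun x => u x + v x).
Proof.
move=> [cu [M hM]] [cv [L hL]]; split.
  by move=> x; apply: continuousD; [exact: cu|exact: cv].
by exists (M + L) => x; apply: (le_trans (ler_normD _ _)); exact: lerD.
Qed.

Lemma bcontZ (c : R) u : bcont u -> bcont (fun x => c * u x).
Proof.
move=> [cu [M hM]]; split.
  by move=> x; apply: continuousM; [exact: cvg_cst|exact: cu].
by exists (`|c| * M) => x; rewrite normrM ler_wpM2l.
Qed.

Lemma bcontM u v : bcont u -> bcont v -> bcont (fun x => u x * v x).
Proof.
move=> [cu [M hM]] [cv [L hL]]; split.
  by move=> x; apply: continuousM; [exact: cu|exact: cv].
by exists (M * L) => x; rewrite normrM; exact: ler_pM.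
Qed.

Section average.
Context (eta : R) (ga : R -> R) (gaP : mollifier eta ga).

Lemma mollifier_integrable : integ ga.
Proof.
case: gaP => c _ s _; have [M hM] := continuous_supp_bounded c s.
exact: supp_integrable (continuous_measurable_fun c) hM s.
Qed.

Lemma avg_integrable u : bcont u -> integ (fun t => u t * ga t).
Proof.
move=> [cu [L hL]]; case: gaP => c _ s _; have [M hM] := continuous_supp_bounded c s.
apply: (@supp_integrable _ eta (L * M)).
- by apply: continuous_measurable_fun => x; apply: continuousM; [exact: cu|exact: c].
- by move=> x; rewrite normrM; exact: ler_pM.
- exact: suppMr.
Qed.

Lemma avg_le u (e : R) : bcont u -> (forall t, `|t| <= eta -> `|u t| <= e) ->
  `|\int[leb]_(t in setT) (u t * ga t)| <= e.
Proof.
move=> bu ue; have iu := avg_integrable bu.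
have [c g0 s g1] := gaP.
apply: (le_trans (le_normr_Rintegral measurableT iu)).
rewrite -[leRHS]mulr1 -g1 -RintegralZl//; last exact: mollifier_integrable.
apply: le_Rintegral => //.
- exact: integrable_norm iu.
- exact/integZ/mollifier_integrable.
- move=> t _; rewrite normrM (ger0_norm (g0 t)).
  have [/ue te|/s ->] := leP `|t| eta; last by rewrite !mulr0.
  by rewrite ler_wpM2r.
Qed.

Lemma convD u v x : bcont u -> bcont v ->
  conv (fun x => u x + v x) ga x = conv u ga x + conv v ga x.
Proof.
move=> bu bv; rewrite /conv; under eq_Rintegral do rewrite mulrDl.
by rewrite RintegralD//; apply: avg_integrable; exact: bcont_reflect.
Qed.

Lemma convZ (c : R) u x : bcont u -> conv (fun x => c * u x) ga x = c * conv u ga x.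
Proof.
move=> bu; rewrite /conv; under eq_Rintegral do rewrite -mulrA.
by rewrite RintegralZl//; apply: avg_integrable; exact: bcont_reflect.
Qed.

Lemma conv_cst (c x : R) : conv (fun=> c) ga x = c.
Proof.
have [_ _ _ g1] := gaP.
by rewrite /conv RintegralZl ?g1 ?mulr1//; exact: mollifier_integrable.
Qed.

Lemma conv_bound u (M : R) x : bcont u -> (forall x, `|u x| <= M) ->
  `|conv u ga x| <= M.
Proof. by move=> bu uM; apply: avg_le => //; exact: bcont_reflect. Qed.

(** Mollification averages translates, so a bound on u(. + a) + c u that holds
    everywhere survives it.  With c = -1 this gives Lipschitz bounds, with c =
    1 antiperiodicity. *)
Lemma conv_shiftD u (a x : R) : bcont u -> forall c : R, forall e : R,
  (forall z, `|u (z + a) + c * u z| <= e) ->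
  `|conv u ga (x + a) + c * conv u ga x| <= e.
Proof.
move=> bu c e ue.
have b1 : bcont (fun t => u (x + a - t)) by exact: bcont_reflect.
have b2 : bcont (fun t => u (x - t)) by exact: bcont_reflect.
have -> : conv u ga (x + a) + c * conv u ga x =
   \int[leb]_(t in setT) ((u (x + a - t) + c * u (x - t)) * ga t).
  rewrite /conv -RintegralZl//; last exact: avg_integrable.
  rewrite -RintegralD//; last 2 first.
  - exact: avg_integrable.
  - by apply: integZ; exact: avg_integrable.
  by apply: eq_Rintegral => t _; ring.
apply: avg_le => [|t _]; first by apply: bcontD => //; exact: bcontZ.
by rewrite addrAC.
Qed.

Lemma conv_blip u (M : R) : blip M u -> blip M (conv u ga).
Proof.
move=> bu; have bc := blip_bcont bu; split=> [x|x y].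
  by apply: conv_bound => //; exact: bu.1.
have -> : conv u ga x - conv u ga y = conv u ga (y + (x - y)) + (-1) * conv u ga y.
  by rewrite mulN1r [y + _]addrC subrK.
apply: conv_shiftD => // z; rewrite mulN1r.
by apply: (le_trans (bu.2 _ _)); rewrite addrAC subrr add0r.
Qed.

Lemma conv_anti u (a e : R) : bcont u -> antiperiodic_upto a e u -> antiperiodic_upto a e (conv u ga).
Proof.
move=> bu au x; rewrite -[X in _ + X]mul1r; apply: conv_shiftD => // z.
by rewrite mul1r; exact: au.
Qed.

Lemma conv_periodic u (a : R) : (forall x, u (x + a) = u x) ->
  forall x, conv u ga (x + a) = conv u ga x.
Proof.
move=> pu x; apply: eq_Rintegral => t _.
by rewrite addrAC pu.
Qed.

Lemma conv_supp u (K : R) : supp K u -> supp (K + eta) (conv u ga).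
Proof.
move=> su x xK; rewrite /conv (_ : (fun t => _) = (fun=> 0)) ?Rintegral_cst ?mul0r//.
apply/funext => t; have [te|] := leP `|t| eta; last by case: gaP => _ _ s _ /s ->; rewrite mulr0.
rewrite su ?mul0r//; have := ler_normD (x - t) t; rewrite subrK; lra.
Qed.

Lemma conv_close u (M : R) x : blip M u -> `|conv u ga x - u x| <= M * eta.
Proof.
move=> bu; have bc := blip_bcont bu; have M0 := blip_ge0 bu.
have -> : conv u ga x - u x = \int[leb]_(t in setT) ((u (x - t) + (-1) * u x) * ga t).
  rewrite -[X in _ - X](conv_cst (u x) x) -[X in _ - X]mul1r -mulNr.
  rewrite /conv -RintegralZl//; last first.
    by apply: integZ; exact: mollifier_integrable.
  rewrite -RintegralD//; last 2 first.
  - by apply: avg_integrable; exact: bcont_reflect.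
  - by apply: integZ; apply: integZ; exact: mollifier_integrable.
  by apply: eq_Rintegral => t _; ring.
have bq : bcont (fun t => u (x - t) + (-1) * u x).
  apply: bcontD; first exact: bcont_reflect.
  exact: blip_bcont (blip_cst _).
apply: avg_le => // t te; rewrite mulN1r; apply: (le_trans (bu.2 _ _)).
by rewrite addrAC subrr add0r normrN ler_wpM2l.
Qed.

(** The mollification is written as an average of translates of u; the other
    form of the convolution comes from reflection and translation
    invariance. *)
Lemma conv_flip u x : bcont u ->
  \int[leb]_(y in setT) (u y * ga (x - y)) = conv u ga x /\
  integ (fun y => u y * ga (x - y)).
Proof.
move=> bu; have i1 := avg_integrable (bcont_reflect x bu).
have [i2 e2] := integral_shift x i1.
have [i3 e3] := integral_opp i2.
have E : (fun y => u (x - (- y + x)) * ga (- y + x)) = (fun y => u y * ga (x - y)).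
  by apply/funext => y; rewrite opprD opprK addrC subrK addrC.
by rewrite /= E in i3 e3; rewrite e3 e2.
Qed.

End average.
End mollification.

(** * The lacunary recursion *)

Lemma pi_le4 (R : realType) : pi <= 4 :> R.
Proof. by have := @pihalf_lt2 R; lra. Qed.

Section lacunary.
Context {R : realType} (delta : R) (g0 : R -> R) (M0 : R).
Hypothesis delta_gt0 : 0 < delta.
Hypothesis M0_ge2 : 2 <= M0.
Hypothesis g0_blip : blip M0 g0.
Hypothesis g0_supp : supported (fun x : R => `|x|) 1 g0.
Notation leb := (@lebesgue_measure R).
Local Notation supp := (supported (fun x : R => `|x|)).
Local Notation I u := (\int[leb]_(x in setT) u x).
Implicit Types (n : nat) (x : R).

Definition amp n : R := 2^-1 ^+ n.+1.

(** With a frequency above this value, the defect of stage n is at most delta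
    / 2^n. *)
Definition freq_bound n (M : R) : R := M ^+ 3 * 2 ^+ n / (amp n * delta).

(** Each frequency K_n is chosen after the bound M_n for f_n and g_n, and is
    at least 4 K_(n-1) times the required lower bound; K_n then enters the
    next bound M_(n+1), as cos(K_n x) has slope K_n. *)
Fixpoint lacunary_data n : R * nat :=
  if n is n'.+1 then
    let: (M, K) := lacunary_data n' in
    let M' := M + 8 * K%:R * M ^+ 2 / amp n' in
    (M', (4 * K * Num.bound (freq_bound n M'))%N)
  else (M0, (4 * Num.bound (freq_bound 0 M0))%N).

Definition lbound n : R := (lacunary_data n).1.
Definition freq n : R := (lacunary_data n).2%:R.
(** The factor cos(K_n x). *)
Definition osc n x : R := cos (freq n * x).

Fixpoint lac n : (R -> R) * (R -> R) :=
  if n is n'.+1 then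
    let: (f, g) := lac n' in
    (fun x => f x + amp n' * osc n' x,
     fun x => g x + (- (2 / amp n')) * (osc n' x * (f x * g x)))
  else (fun=> 2, g0).

Definition lac_f n := (lac n).1.
Definition lac_g n := (lac n).2.
Definition lac_r n x := lac_f n x * lac_g n x.

Lemma lac_fS n : lac_f n.+1 = fun x => lac_f n x + amp n * osc n x.
Proof. by rewrite /lac_f /=; case: (lac n). Qed.

Lemma lac_gS n : lac_g n.+1 = fun x => lac_g n x + (- (2 / amp n)) * (osc n x * lac_r n x).
Proof. by rewrite /lac_g /lac_r /lac_f /lac_g /=; case: (lac n). Qed.

Lemma amp_gt0 n : 0 < amp n.
Proof. by rewrite exprn_gt0// invr_gt0. Qed.

Lemma amp_le1 n : amp n <= 1.
Proof. by rewrite exprn_ile1 ?invr_ge0// invf_le1//; lra. Qed.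

Lemma freq_bound_ge0 n M : 2 <= M -> 0 <= freq_bound n M.
Proof.
move=> M2; have p0 := amp_gt0 n; have M0' : 0 <= M by apply: le_trans M2.
by apply: divr_ge0; apply: mulr_ge0; rewrite ?exprn_ge0// ltW.
Qed.

Lemma lboundS n : lbound n.+1 = lbound n + 8 * freq n * lbound n ^+ 2 / amp n.
Proof. by rewrite /lbound /freq /=; case: (lacunary_data n). Qed.

Lemma lbound_freq_ge n : 2 <= lbound n /\ 4 <= freq n.
Proof.
have B1 M n' : 2 <= M -> (0 < Num.bound (freq_bound n' M))%N.
  move=> M2; rewrite -(ltr_nat R).
  exact: le_lt_trans (freq_bound_ge0 n' M2) (archi_boundP (freq_bound_ge0 n' M2)).
elim: n => [|n [IM IK]].
  by split=> //; rewrite /freq /= ler_nat; have := B1 _ 0%N M0_ge2; lia.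
have M2 : 2 <= lbound n.+1.
  rewrite lboundS; apply: (le_trans IM); rewrite lerDl divr_ge0 ?(ltW (amp_gt0 n))//.
  by rewrite mulr_ge0 ?sqr_ge0 ?mulr_ge0// (le_trans _ IK).
split=> //; have := B1 _ n.+1 M2; move: IK; rewrite /lbound /freq /=.
case: (lacunary_data n) => M K /=; rewrite !ler_nat; nia.
Qed.

Lemma lbound_ge2 n : 2 <= lbound n. Proof. exact: (lbound_freq_ge n).1. Qed.
Lemma freq_ge4 n : 4 <= freq n. Proof. exact: (lbound_freq_ge n).2. Qed.
Lemma freq_gt0 n : 0 < freq n.
Proof. by apply: lt_le_trans (freq_ge4 n). Qed.

(** All errors of stage n are bounded by constant multiples of this quantity:
    three factors M_n from products of f_n, g_n and r_n, one factor 1 / p_n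
    from the correction of g_n, and 1 / K_n from the oscillation. *)
Definition defect n : R := lbound n ^+ 3 / (amp n * freq n).

Lemma defect_ge0 n : 0 <= defect n.
Proof.
rewrite divr_ge0 ?exprn_ge0 ?(le_trans _ (lbound_ge2 n))//.
by rewrite mulr_ge0 ?ltW ?amp_gt0 ?freq_gt0.
Qed.

Lemma defect_le n : defect n <= delta / 2 ^+ n.
Proof.
have p0 := amp_gt0 n; have k0 := freq_gt0 n.
have b0 : 0 <= freq_bound n (lbound n) by exact: freq_bound_ge0 (lbound_ge2 n).
have bk : freq_bound n (lbound n) <= freq n.
  apply: (le_trans (ltW (archi_boundP b0))).
  have := freq_ge4 n; case: n {p0 k0 b0} => [|n].
    by rewrite /freq /lbound /= => _; rewrite ler_nat; lia.
  rewrite /freq /lbound /=; case: (lacunary_data n) => M [|K] /=.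
    by rewrite muln0 mul0n ler_nat.
  by move=> _; rewrite ler_nat leq_pmull.
have d0 := delta_gt0; have e0 : 0 < 2 ^+ n :> R by exact: exprn_gt0.
rewrite /defect ler_pdivrMr ?mulr_gt0// mulrAC ler_pdivlMr//.
move: bk; rewrite /freq_bound ler_pdivrMr ?mulr_gt0//.
by move=> h; apply: (le_trans h); rewrite le_eqVlt; apply/orP; left; apply/eqP; ring.
Qed.

Lemma freq_multiple n : exists B : nat, freq n.+1 = 4 * freq n * B%:R.
Proof.
rewrite /freq /=; case: (lacunary_data n) => M K /=.
by eexists; rewrite !natrM.
Qed.

Lemma osc_blip n : blip (freq n) (osc n).
Proof. by apply: blip_cos; apply: le_trans (freq_ge4 n); lra. Qed.

Lemma osc_le1 n x : `|osc n x| <= 1.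
Proof. exact: cos_max. Qed.

Lemma osc_anti n x : osc n (x + pi / freq n) = - osc n x.
Proof.
by rewrite /osc mulrDr mulrCA divff ?gt_eqF ?freq_gt0// mulr1 cosDpi.
Qed.

(** K_(n+1) is a multiple of 4 K_n: the rapid oscillation does not see the
    shifts under which the previous one changes sign. *)
Lemma osc_periodic n x : osc n.+1 (x + pi / freq n) = osc n.+1 x.
Proof.
have k0 := freq_gt0 n; have [B Be] := freq_multiple n.
rewrite /osc -[RHS](cos_periodic_int _ (2 * B)%:Z); congr cos.
rewrite Be -pmulrn natrM mulr2n; field.
by rewrite gt_eqF.
Qed.

Lemma osc_half_periodic n x : osc n.+1 (x + pi / freq n / 2) = osc n.+1 x.
Proof.
have k0 := freq_gt0 n; have [B Be] := freq_multiple n.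
rewrite /osc -[RHS](cos_periodic_int _ B%:Z); congr cos.
rewrite Be -pmulrn mulr2n; field.
by rewrite gt_eqF.
Qed.

Definition osc2 n x : R := cos (2 * (freq n * x)).

Lemma osc2_anti n x : osc2 n (x + pi / freq n / 2) = - osc2 n x.
Proof.
rewrite /osc2 -cosDpi; congr cos; have k0 := freq_gt0 n; field.
by rewrite gt_eqF.
Qed.

Lemma osc2E n x : osc2 n x = 2 * osc n x ^+ 2 - 1.
Proof. by rewrite /osc2 /osc mulrC mulr_natr cos_mulr2n mulr_natl. Qed.

Lemma lac_blip n : blip (lbound n) (lac_f n) /\ blip (lbound n) (lac_g n).
Proof.
elim: n => [|n [bf bg]].
  split=> //; apply: blip_le (M0_ge2) _.
  by rewrite -[X in blip X](@ger0_norm _ 2)//; exact: blip_cst.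
have M2 := lbound_ge2 n; have k4 := freq_ge4 n.
have p0 := amp_gt0 n; have p1 := amp_le1 n.
rewrite lboundS lac_fS lac_gS; split.
  apply: blip_le (blipD bf (blipZ (amp n) (osc_blip n))).
  rewrite lerD2l ger0_norm ?(ltW p0)// ler_pdivlMr//.
  have : amp n * freq n * amp n <= freq n.
    have pp : amp n * amp n <= 1 by apply: mulr_ile1 => //; exact: ltW.
    by rewrite mulrAC; apply: ler_piMl => //; lra.
  have : 0 <= freq n * (lbound n ^+ 2 - 1).
    by apply: mulr_ge0; [lra|rewrite subr_ge0 exprn_ege1//; lra].
  lra.
apply: blip_le (blipD bg (blipZ (- (2 / amp n)) (blipM (osc_blip n) (blipM bf bg)))).
rewrite lerD2l normrN ger0_norm ?divr_ge0 ?(ltW p0)//.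
by rewrite le_eqVlt; apply/orP; left; apply/eqP; field; rewrite gt_eqF.
Qed.

Lemma lac_f_blip n : blip (lbound n) (lac_f n). Proof. exact: (lac_blip n).1. Qed.
Lemma lac_g_blip n : blip (lbound n) (lac_g n). Proof. exact: (lac_blip n).2. Qed.

Lemma lac_g_supp n : supp 1 (lac_g n).
Proof.
elim: n => [//|n IH]; rewrite lac_gS => x x1.
by rewrite IH// /lac_r IH// !mulr0 addr0.
Qed.

Lemma lac_r_supp n : supp 1 (lac_r n).
Proof. by move=> x x1; rewrite /lac_r lac_g_supp// mulr0. Qed.

Lemma lac_r_blip n : blip (2 * lbound n ^+ 2) (lac_r n).
Proof. by rewrite expr2 mulrA; exact: blipM (lac_f_blip n) (lac_g_blip n). Qed.

Definition lac_q n x := amp n * lac_g n x + (- (2 / amp n)) * (lac_f n x * lac_r n x).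

(** The term -2 cos^2 r_n equals -(1 + cos(2 .)) r_n, and its non-oscillating
    part cancels the r_n carried over from the previous stage. *)
Lemma lac_rS n x : lac_r n.+1 x = osc n x * lac_q n x - osc2 n x * lac_r n x.
Proof.
rewrite /lac_r lac_fS lac_gS /lac_q osc2E /lac_r; have p0 := amp_gt0 n.
by field; rewrite gt_eqF.
Qed.

Lemma lac_q_blip n : blip (9 * lbound n ^+ 3 / amp n) (lac_q n).
Proof.
have M2 := lbound_ge2 n; have p0 := amp_gt0 n; have p1 := amp_le1 n.
apply: blip_le (blipD (blipZ (amp n) (lac_g_blip n))
  (blipZ (- (2 / amp n)) (blipM (lac_f_blip n) (lac_r_blip n)))).
rewrite normrN !ger0_norm ?divr_ge0 ?(ltW p0)//.
have -> : 9 * lbound n ^+ 3 / amp n = lbound n ^+ 3 / amp n +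
    2 / amp n * (2 * lbound n * (2 * lbound n ^+ 2)) by field; rewrite gt_eqF.
rewrite lerD2r ler_pdivlMr//.
have h1 : amp n * amp n <= 1 by apply: mulr_ile1 => //; exact: ltW.
have h2 : lbound n <= lbound n ^+ 3.
  by rewrite -[leLHS]expr1 ler_weXn2l//; lra.
by apply: le_trans h2; rewrite mulrAC; apply: ler_piMl => //; lra.
Qed.

Lemma lac_q_supp n : supp 1 (lac_q n).
Proof. by move=> x x1; rewrite /lac_q lac_g_supp// lac_r_supp// !mulr0 addr0. Qed.

(** A quantitative Riemann-Lebesgue lemma. *)
Lemma osc_integral (a e A L : R) (W v : R -> R) : 0 <= a <= 1 -> 0 <= e ->
  continuous W -> (forall x, `|W x| <= A) -> antiperiodic_upto a e W -> blip L v ->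
  supp 2 (fun x => W x * v x) ->
  `|I (fun x => W x * v x)| <= 3 * (L * e + L * a * A).
Proof.
move=> a01 e0 cW bW aW bv sWv.
have A0 : 0 <= A by exact: le_trans (bW 0).
apply: (@anti_integral _ a _ (A * L)) => //.
- apply: continuous_measurable_fun => x; apply: continuousM; first exact: cW.
  exact: blip_continuous bv x.
- by move=> x; rewrite normrM ler_pM//; exact: bv.1.
- by apply: antiM => //; case/andP: a01.
Qed.

Lemma step_itv n : 0 <= pi / freq n <= 1.
Proof.
have k0 := freq_gt0 n; have k4 := freq_ge4 n.
rewrite divr_ge0 ?pi_ge0 ?(ltW k0)//= ler_pdivrMr// mul1r.
by apply: le_trans k4; exact: (@pi_le4 R).
Qed.

Lemma half_step_itv n : 0 <= pi / freq n / 2 <= 1.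
Proof. by have /andP[a b] := step_itv n; apply/andP; split; lra. Qed.

Lemma step_defect n : lbound n ^+ 3 / amp n * (pi / freq n) <= 4 * defect n.
Proof.
have k0 := freq_gt0 n; have p0 := amp_gt0 n.
rewrite (_ : lbound n ^+ 3 / amp n * (pi / freq n) = pi * defect n).
  by rewrite ler_wpM2r ?defect_ge0 ?(@pi_le4 R).
by rewrite /defect; field; rewrite !gt_eqF.
Qed.

Lemma lbound_step n k : (k <= 3)%N -> lbound n ^+ k * (pi / freq n) <= 4 * defect n.
Proof.
move=> k3; apply: le_trans (step_defect n); have /andP[a0 _] := step_itv n.
rewrite ler_wpM2r// ler_pdivlMr ?amp_gt0//.
have M2 := lbound_ge2 n.
apply: (@le_trans _ _ (lbound n ^+ k)).
  by rewrite ler_piMr ?amp_le1 ?exprn_ge0//; lra.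
by rewrite ler_weXn2l//; lra.
Qed.

(** The correction of g_n oscillates at frequency K_n, hence is small when
    tested against a Lipschitz function, although its size, of order 1 / p_n,
    grows. *)
Lemma lac_g_step n L phi : blip L phi ->
  `|I (fun x => lac_g n.+1 x * phi x) - I (fun x => lac_g n x * phi x)| <=
  96 * L * defect n.
Proof.
move=> bphi; have L0 := blip_ge0 bphi; have p0 := amp_gt0 n.
have M2 := lbound_ge2 n; have br := lac_r_blip n; have bo := osc_blip n.
have [a0 a1] := andP (step_itv n).
pose W x := osc n x * lac_r n x.
have cW : continuous W.
  by move=> x; apply: continuousM; [exact: blip_continuous bo x|exact: blip_continuous br x].
have bW x : `|W x| <= 2 * lbound n ^+ 2.
  rewrite normrM -[leRHS]mul1r; apply: ler_pM => //; first exact: osc_le1.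
  exact: br.1.
have aW : antiperiodic_upto (pi / freq n) (2 * lbound n ^+ 2 * (pi / freq n)) W.
  move=> x; rewrite /W osc_anti mulNr addrC -mulrBr normrM -[leRHS]mul1r.
  apply: ler_pM => //; first exact: osc_le1.
  by apply: (le_trans (br.2 _ _)); rewrite opprD addrA subrr add0r normrN (ger0_norm a0).
have sW : supp 1 W by move=> x x1; rewrite /W lac_r_supp// mulr0.
have s2 (u : R -> R) : supp 1 u -> supp 2 (fun x => u x * phi x).
  by move=> su x x2; rewrite su ?mul0r//; lra.
have iW : leb.-integrable setT (EFin \o (fun x => W x * phi x)).
  apply: (@supp_integrable _ 2 (2 * lbound n ^+ 2 * L)); last exact: s2.
    apply: continuous_measurable_fun => x; apply: continuousM; first exact: cW.
    exact: blip_continuous bphi x.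
  by move=> x; rewrite normrM; apply: ler_pM => //; exact: bphi.1.
have ig : leb.-integrable setT (EFin \o (fun x => lac_g n x * phi x)).
  apply: (@supp_integrable _ 2 (lbound n * L)); last by apply: s2; exact: lac_g_supp.
    apply: continuous_measurable_fun => x; apply: continuousM.
      exact: blip_continuous (lac_g_blip n) x.
    exact: blip_continuous bphi x.
  move=> x; rewrite normrM; apply: ler_pM => //; first exact: (lac_g_blip n).1.
  exact: bphi.1.
rewrite (_ : I (fun x => lac_g n.+1 x * phi x) =
  I (fun x => lac_g n x * phi x + (- (2 / amp n)) * (W x * phi x))); last first.
  by congr Rintegral; apply/funext => x; rewrite lac_gS /W; ring.
rewrite RintegralD//; last exact: integZ.
rewrite RintegralZl// addrAC subrr add0r normrM normrN.
rewrite (@ger0_norm _ (2 / amp n)) ?divr_ge0 ?(ltW p0)//.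
have H := osc_integral (step_itv n) _ cW bW aW bphi (s2 _ sW).
apply: (@le_trans _ _ (2 / amp n * (3 * (L * (2 * lbound n ^+ 2 * (pi / freq n)) +
   L * (pi / freq n) * (2 * lbound n ^+ 2))))).
  rewrite ler_wpM2l ?divr_ge0 ?(ltW p0)//; apply: H.
  by apply: mulr_ge0 => //; apply: mulr_ge0 => //; exact: sqr_ge0.
have -> : 2 / amp n * (3 * (L * (2 * lbound n ^+ 2 * (pi / freq n)) +
   L * (pi / freq n) * (2 * lbound n ^+ 2))) =
   24 * L * (lbound n ^+ 2 / amp n * (pi / freq n)) by field; rewrite !gt_eqF// freq_gt0.
apply: (@le_trans _ _ (24 * L * (lbound n ^+ 3 / amp n * (pi / freq n)))).
  rewrite ler_wpM2l ?mulr_ge0// ler_wpM2r// ler_wpM2r ?invr_ge0 ?(ltW p0)//.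
  by rewrite ler_weXn2l//; lra.
rewrite (_ : 96 * L * defect n = 24 * L * (4 * defect n)); last by ring.
by rewrite ler_wpM2l ?mulr_ge0// step_defect.
Qed.

(** The two parts of r_(n+1) in lac_rS change sign, up to a small error, under
    shifts by pi / K_n and pi / (2 K_n).  Only these properties enter, so the
    bound also applies after mollification and multiplication by functions
    with these periods. *)
Lemma two_scale_integral n L phi (Wa Wb : R -> R) : blip L phi ->
  continuous Wa -> continuous Wb -> supp 2 Wa -> supp 2 Wb ->
  (forall x, `|Wa x| <= 9 * lbound n ^+ 3 / amp n) ->
  (forall x, `|Wb x| <= 2 * lbound n ^+ 2) ->
  antiperiodic_upto (pi / freq n) (9 * lbound n ^+ 3 / amp n * (pi / freq n)) Wa ->
  antiperiodic_upto (pi / freq n / 2) (2 * lbound n ^+ 2 * (pi / freq n / 2)) Wb ->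
  `|I (fun x => (Wa x - Wb x) * phi x)| <= 240 * L * defect n.
Proof.
move=> bphi ca cb sa sb ba bb aa ab.
have L0 := blip_ge0 bphi; have p0 := amp_gt0 n; have M2 := lbound_ge2 n.
have [a0 a1] := andP (step_itv n).
have s2 (u : R -> R) : supp 2 u -> supp 2 (fun x => u x * phi x).
  by move=> su x x2; rewrite su ?mul0r//; lra.
have ii (u : R -> R) A : continuous u -> (forall x, `|u x| <= A) -> supp 2 u ->
    leb.-integrable setT (EFin \o (fun x => u x * phi x)).
  move=> cu bu su; apply: (@supp_integrable _ 2 (A * L)); last exact: s2.
    apply: continuous_measurable_fun => x; apply: continuousM; first exact: cu.
    exact: blip_continuous bphi x.
  by move=> x; rewrite normrM; apply: ler_pM => //; exact: bphi.1.
under eq_Rintegral do rewrite mulrBl.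
rewrite RintegralB//; [|exact: ii ca ba sa|exact: ii cb bb sb].
apply: (le_trans (ler_normB _ _)).
have e1 : 0 <= 9 * lbound n ^+ 3 / amp n * (pi / freq n).
  apply: mulr_ge0 => //; apply: divr_ge0; last exact: ltW.
  by apply: mulr_ge0 => //; apply: exprn_ge0; lra.
have e2 : 0 <= 2 * lbound n ^+ 2 * (pi / freq n / 2).
  apply: mulr_ge0; last by have /andP[] := half_step_itv n.
  by apply: mulr_ge0 => //; exact: sqr_ge0.
have H1 := osc_integral (step_itv n) e1 ca ba aa bphi (s2 _ sa).
have H2 := osc_integral (half_step_itv n) e2 cb bb ab bphi (s2 _ sb).
apply: (le_trans (lerD H1 H2)).
have h1 := step_defect n; have h2 := @lbound_step n 2 isT.
set a := pi / freq n in h1 h2 *; set q := lbound n ^+ 3 / amp n in h1.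
rewrite -[9 * _ / _]mulrA -/q.
apply: (@le_trans _ _ (54 * L * (q * a) + 6 * L * (lbound n ^+ 2 * a))).
  by rewrite le_eqVlt; apply/orP; left; apply/eqP; field.
apply: (@le_trans _ _ (54 * L * (4 * defect n) + 6 * L * (4 * defect n))); last first.
  by rewrite le_eqVlt; apply/orP; left; apply/eqP; ring.
by apply: lerD; rewrite ler_wpM2l ?mulr_ge0.
Qed.

Lemma lac_r_integral n L phi : blip L phi ->
  `|I (fun x => lac_r n.+1 x * phi x)| <= 240 * L * defect n.
Proof.
move=> bphi; under eq_Rintegral do rewrite lac_rS.
have [a0 a1] := andP (step_itv n); have [h0 h1] := andP (half_step_itv n).
have bq := lac_q_blip n; have br := lac_r_blip n; have bo := osc_blip n.
have co2 : continuous (osc2 n).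
  have := @blip_cos R (2 * freq n); rewrite /osc2.
  under eq_fun do rewrite -mulrA.
  by move=> H; apply: blip_continuous (H _); have := freq_ge4 n; lra.
apply: (two_scale_integral (Wa := fun x => osc n x * lac_q n x)
  (Wb := fun x => osc2 n x * lac_r n x)) => //.
- by move=> x; apply: continuousM; [exact: blip_continuous bo x|exact: blip_continuous bq x].
- by move=> x; apply: continuousM; [exact: co2|exact: blip_continuous br x].
- by move=> x x2; rewrite lac_q_supp ?mulr0//; lra.
- by move=> x x2; rewrite lac_r_supp ?mulr0//; lra.
- move=> x; rewrite normrM -[leRHS]mul1r; apply: ler_pM => //; first exact: osc_le1.
  exact: bq.1.
- move=> x; rewrite normrM -[leRHS]mul1r; apply: ler_pM => //; first exact: cos_max.
  exact: br.1.
- move=> x; rewrite osc_anti mulNr addrC -mulrBr normrM -[leRHS]mul1r.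
  apply: ler_pM => //; first exact: osc_le1.
  by apply: (le_trans (bq.2 _ _)); rewrite opprD addrA subrr add0r normrN (ger0_norm a0).
- move=> x; rewrite osc2_anti mulNr addrC -mulrBr normrM -[leRHS]mul1r.
  apply: ler_pM => //; first exact: cos_max.
  by apply: (le_trans (br.2 _ _)); rewrite opprD addrA subrr add0r normrN (ger0_norm h0).
Qed.

Lemma lac_f_close n m x : (n <= m)%N -> `|lac_f m x - lac_f n x| <= 2^-1 ^+ n - 2^-1 ^+ m.
Proof.
move=> /subnKC <-; elim: (m - n)%N => [|k IH]; first by rewrite addn0 !subrr normr0.
rewrite addnS lac_fS addrAC; apply: (le_trans (ler_normD _ _)).
apply: (le_trans (lerD IH (_ : _ <= amp (n + k)%N))).
  rewrite normrM (gtr0_norm (amp_gt0 _)) -[leRHS]mulr1.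
  by apply: ler_wpM2l; [exact/ltW/amp_gt0|exact: osc_le1].
rewrite /amp exprS; have : 0 <= 2^-1 ^+ (n + k) :> R by rewrite exprn_ge0// invr_ge0.
have : 2^-1 = 1 / 2 :> R by rewrite div1r.
move: (2^-1 ^+ n : R) (2^-1 ^+ (n + k) : R) => c b e; rewrite e; lra.
Qed.

Lemma lac_f_range n x : 1 + 2^-1 ^+ n <= lac_f n x <= 3.
Proof.
have := @lac_f_close 0 n x (leq0n n); rewrite expr0 {2}/lac_f /= ler_norml.
have : 0 <= 2^-1 ^+ n :> R by rewrite exprn_ge0// invr_ge0.
by move=> h /andP[h1 h2]; apply/andP; split; lra.
Qed.

Section mollified.
Context (al be : R -> R).
Hypothesis alP : mollifier 1 al.
Hypothesis beP : mollifier 1 be.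

(** The n-th approximation of the product, with both factors mollified, tested
    against phi. *)
Definition mol_pair n (phi : R -> R) : R :=
  I (fun x => conv (lac_f n) al x * conv (lac_g n) be x * phi x).

Lemma bcont_supp_integrable K (u : R -> R) : bcont u -> supp K u ->
  leb.-integrable setT (EFin \o u).
Proof.
move=> [cu [M hM]]; apply: supp_integrable hM.
exact: continuous_measurable_fun.
Qed.

Lemma mollified_supp (u : R -> R) : supp 1 u -> supp 2 (conv u be).
Proof. by move=> su; rewrite -[2]/(1 + 1 : R); exact: (conv_supp beP su). Qed.

Lemma osc_mul_anti n (a A : R) (u : R -> R) : (forall x, osc n (x + a) = - osc n x) ->
  0 <= a -> blip A u -> antiperiodic_upto a (A * a) (fun x => osc n x * u x).
Proof.
move=> oa a0 bu x; rewrite oa mulNr addrC -mulrBr normrM -[leRHS]mul1r.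
apply: ler_pM => //; first exact: osc_le1.
by apply: (le_trans (bu.2 _ _)); rewrite opprD addrA subrr add0r normrN (ger0_norm a0).
Qed.

Lemma mul_le_bound (A : R) (c u : R -> R) : (forall x, `|c x| <= 1) ->
  (forall x, `|u x| <= A) -> forall x, `|c x * u x| <= A.
Proof. by move=> c1 uA x; rewrite normrM -[leRHS]mul1r; exact: ler_pM. Qed.

Lemma mul_periodic_anti (a e : R) (c u : R -> R) : (forall x, `|c x| <= 1) ->
  (forall x, c (x + a) = c x) -> antiperiodic_upto a e u -> antiperiodic_upto a e (fun x => c x * u x).
Proof.
move=> c1 cp au x; rewrite cp -mulrDr normrM -[leRHS]mul1r.
by apply: ler_pM => //; exact: au.
Qed.

(** With C and W the mollifications of cos(K_m x) and cos(K_m x) r_m, the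
    increment consists of p C Y phi and (2/p) W X phi, which oscillate at
    frequency K_m, and of 2 C W phi.  In the last one the two oscillations may
    cancel, but the one of r_m at frequency K_n, m = n + 1, remains, as
    cos(K_m x) is periodic under the shifts involved; mollifying cannot
    destroy it. *)
Lemma mol_pair_step n L phi : blip L phi ->
  `|mol_pair n.+2 phi - mol_pair n.+1 phi| <=
  480 * L * defect n + 216 * L * defect n.+1.
Proof.
move=> bphi; have L0 := blip_ge0 bphi; set m := n.+1.
have M2 := lbound_ge2 m; have p0 := amp_gt0 m; have p1 := amp_le1 m.
have [a0 a1] := andP (step_itv m).
have [an0 an1] := andP (step_itv n); have [hn0 hn1] := andP (half_step_itv n).
have bf := lac_f_blip m; have bg := lac_g_blip m; have br := lac_r_blip m.
have bo := osc_blip m; have bon := osc_blip n.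
have bq := lac_q_blip n; have brn := lac_r_blip n.
have bo2 : blip (2 * freq n) (osc2 n).
  rewrite /osc2; under eq_fun do rewrite mulrA.
  by apply: blip_cos; have := freq_ge4 n; lra.
have C1 x : `|conv (osc m) al x| <= 1.
  by apply: (conv_bound alP); [exact: blip_bcont bo|exact: osc_le1].
have bC := conv_blip alP bo.
have bX := conv_blip alP bf.
have bY := conv_blip beP bg.
pose u1 x := osc n x * lac_q n x; pose u2 x := osc2 n x * lac_r n x.
have bor := blipM bo br; have bu1 := blipM bon bq; have bu2 := blipM bo2 brn.
have bou1 := blipM bo bu1; have bou2 := blipM bo bu2.
pose C := conv (osc m) al; pose X := conv (lac_f m) al; pose Y := conv (lac_g m) be.
pose W := conv (fun x => osc m x * lac_r m x) be.
pose Wa x := C x * conv (fun x => osc m x * u1 x) be x.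
pose Wb x := C x * conv (fun x => osc m x * u2 x) be x.
have s1 : supp 1 (fun x => osc m x * lac_r m x) by move=> x /lac_r_supp->; rewrite mulr0.
have su1 : supp 1 (fun x => osc m x * u1 x).
  by move=> x x1; rewrite /u1 lac_q_supp// !mulr0.
have su2 : supp 1 (fun x => osc m x * u2 x).
  by move=> x x1; rewrite /u2 lac_r_supp// !mulr0.
have sW := mollified_supp s1; have sY := mollified_supp (@lac_g_supp m).
have bW := conv_blip beP bor.
have bWa := blipM bC (conv_blip beP bou1); have bWb := blipM bC (conv_blip beP bou2).
have sWa : supp 2 Wa by apply: suppMr; exact: mollified_supp.
have sWb : supp 2 Wb by apply: suppMr; exact: mollified_supp.
have XS x : conv (lac_f m.+1) al x = X x + amp m * C x.
  by rewrite lac_fS (convD alP) ?(convZ alP)//; repeat (apply: bcontZ || exact: blip_bcont bo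
    || exact: blip_bcont bf).
have YS x : conv (lac_g m.+1) be x = Y x + (- (2 / amp m)) * W x.
  by rewrite lac_gS (convD beP) ?(convZ beP)//; repeat (apply: bcontZ || exact: blip_bcont bor
    || exact: blip_bcont bg).
have WE x : C x * W x = Wa x - Wb x.
  rewrite /Wa /Wb -mulrBr; congr (_ * _); rewrite -mulN1r.
  rewrite -(convZ beP) -?(convD beP).
  - rewrite /W; congr (conv _ be x); apply/funext => z.
    by rewrite /m lac_rS /u1 /u2; ring.
  - exact: blip_bcont bou1.
  - by apply: bcontZ; exact: blip_bcont bou2.
  - exact: blip_bcont bou2.
have bcphi := blip_bcont bphi.
have sCY : supp 2 (fun x => C x * (Y x * phi x)) by apply: suppMr; exact: suppMl.
have sWX : supp 2 (fun x => W x * (X x * phi x)) by exact: suppMl.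
have iT1 : leb.-integrable setT (EFin \o (fun x => C x * (Y x * phi x))).
  apply: (@bcont_supp_integrable 2); first exact: blip_bcont (blipM bC (blipM bY bphi)).
  by apply: suppMr; apply: suppMl.
have iT2 : leb.-integrable setT (EFin \o (fun x => W x * (X x * phi x))).
  apply: (@bcont_supp_integrable 2); first exact: blip_bcont (blipM bW (blipM bX bphi)).
  exact: suppMl.
have iT3 : leb.-integrable setT (EFin \o (fun x => (Wa x - Wb x) * phi x)).
  apply: (@bcont_supp_integrable 2); last first.
    by apply: suppMl => x x2; rewrite sWa// sWb// subrr.
  apply: bcontM => //; under eq_fun do rewrite -mulN1r.
  by apply: bcontD; [exact: blip_bcont bWa|apply: bcontZ; exact: blip_bcont bWb].
have iT0 : leb.-integrable setT (EFin \o (fun x => X x * Y x * phi x)).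
  apply: (@bcont_supp_integrable 2); first exact: blip_bcont (blipM (blipM bX bY) bphi).
  by apply: suppMl; exact: suppMr.
have T1 : `|I (fun x => C x * (Y x * phi x))| <= 24 * L * defect m.
  have aC : antiperiodic_upto (pi / freq m) 0 C.
    apply: (conv_anti alP); first exact: blip_bcont bo.
    by move=> x; rewrite osc_anti addrC subrr normr0.
  have := osc_integral (step_itv m) (lexx 0) (blip_continuous bC) C1 aC (blipM bY bphi).
  move=> /(_ sCY) /le_trans; apply.
  have := @lbound_step m 1 isT; rewrite expr1 => h.
  rewrite mulr0 add0r mulr1 (_ : _ * _ = 6 * L * (lbound m * (pi / freq m))); last by ring.
  rewrite (_ : 24 * L * defect m = 6 * L * (4 * defect m)); last by ring.
  by rewrite ler_wpM2l ?mulr_ge0.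
have T2 : 2 / amp m * `|I (fun x => W x * (X x * phi x))| <= 192 * L * defect m.
  have e0 : 0 <= 2 * lbound m ^+ 2 * (pi / freq m).
    by apply: mulr_ge0 => //; apply: mulr_ge0 => //; exact: sqr_ge0.
  have aW : antiperiodic_upto (pi / freq m) (2 * lbound m ^+ 2 * (pi / freq m)) W.
    apply: (conv_anti beP); first exact: blip_bcont bor.
    by apply: osc_mul_anti => // x; exact: osc_anti.
  have W2 x : `|W x| <= 2 * lbound m ^+ 2.
    apply: (conv_bound beP); first exact: blip_bcont bor.
    by apply: mul_le_bound; [exact: osc_le1|exact: br.1].
  have := osc_integral (step_itv m) e0 (blip_continuous bW) W2 aW (blipM bX bphi).
  move=> /(_ sWX) H.
  apply: (le_trans (ler_wpM2l _ H)); first by rewrite divr_ge0// ltW.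
  rewrite [leLHS](_ : _ = 48 * L * (lbound m ^+ 3 / amp m * (pi / freq m))); last first.
    by field; rewrite !gt_eqF ?freq_gt0.
  rewrite (_ : 192 * L * defect m = 48 * L * (4 * defect m)); last by ring.
  by rewrite ler_wpM2l ?mulr_ge0// step_defect.
(* The non-oscillating product of the two new terms, at the previous scale. *)
have T3 : `|I (fun x => (Wa x - Wb x) * phi x)| <= 240 * L * defect n.
  apply: two_scale_integral => //; try exact: blip_continuous.
  - exact: blip_continuous bWa.
  - exact: blip_continuous bWb.
  - apply: mul_le_bound => // x; apply: (conv_bound beP); first exact: blip_bcont bou1.
    apply: mul_le_bound; first exact: osc_le1.
    by apply: mul_le_bound; [exact: osc_le1|exact: bq.1].
  - apply: mul_le_bound => // x; apply: (conv_bound beP); first exact: blip_bcont bou2.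
    apply: mul_le_bound; first exact: osc_le1.
    by apply: mul_le_bound; [move=> z; exact: cos_max|exact: brn.1].
  - apply: mul_periodic_anti => //.
      by apply: conv_periodic; exact: osc_periodic.
    apply: (conv_anti beP); first exact: blip_bcont bou1.
    apply: mul_periodic_anti; [exact: osc_le1|exact: osc_periodic|].
    by apply: osc_mul_anti => // x; exact: osc_anti.
  - apply: mul_periodic_anti => //.
      by apply: conv_periodic; exact: osc_half_periodic.
    apply: (conv_anti beP); first exact: blip_bcont bou2.
    apply: mul_periodic_anti; [exact: osc_le1|exact: osc_half_periodic|].
    move=> x; rewrite /u2 osc2_anti mulNr addrC -mulrBr normrM -[leRHS]mul1r.
    apply: ler_pM => //; first exact: cos_max.
    by apply: (le_trans (brn.2 _ _)); rewrite opprD addrA subrr add0r normrN (ger0_norm hn0).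
have DE : mol_pair m.+1 phi - mol_pair m phi =
    amp m * I (fun x => C x * (Y x * phi x)) +
    (- (2 / amp m)) * I (fun x => W x * (X x * phi x)) +
    (-2) * I (fun x => (Wa x - Wb x) * phi x).
  rewrite -!RintegralZl//.
  have iZ1 := integZ (amp m) iT1; have iZ2 := integZ (- (2 / amp m)) iT2.
  have iZ3 := integZ (-2) iT3.
  rewrite -RintegralD// -RintegralD//; last exact: integD.
  apply/eqP; rewrite subr_eq; apply/eqP; rewrite /mol_pair -RintegralD//; last first.
    by apply: integD => //; exact: integD.
  congr Rintegral; apply/funext => x; rewrite XS YS -/(X x) -/(Y x) -WE.
  by field; rewrite gt_eqF.
rewrite DE; apply: (le_trans (ler_normD _ _)).
apply: (le_trans (lerD (ler_normD _ _) (lexx _))).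
have n1 (c z : R) : 0 <= c -> `|c * z| = c * `|z|.
  by move=> c0; rewrite normrM (ger0_norm c0).
have n2 (c z : R) : 0 <= c -> `|- c * z| = c * `|z|.
  by move=> c0; rewrite mulNr normrN n1.
rewrite (n1 _ _ (ltW p0)) (n2 2 _ (ler0n _ 2)) (n2 (2 / amp m)); last first.
  by apply: divr_ge0 => //; exact: ltW.
have T1' : amp m * `|I (fun x => C x * (Y x * phi x))| <= 24 * L * defect m.
  by apply: le_trans T1; rewrite ler_piMl.
apply: (le_trans (lerD (lerD T1' T2) (ler_wpM2l (ler0n R 2) T3))).
by rewrite le_eqVlt; apply/orP; left; apply/eqP; ring.
Qed.

End mollified.
End lacunary.

(** * The limit of the lacunary recursion *)

Section geometric.
Context {R : realType}.

Lemma half_powers_small (e : R) : 0 < e -> exists n, 2^-1 ^+ n < e.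
Proof.
move=> e0; exists (Num.bound e^-1).
have ei : e^-1 < (Num.bound e^-1)%:R by apply: archi_boundP; rewrite invr_ge0 ltW.
rewrite exprVn invf_plt ?posrE ?exprn_gt0//; apply: (lt_trans ei).
by rewrite -natrX ltr_nat ltn_expl.
Qed.

Lemma geometric_steps (a : nat -> R) (c : R) :
  (forall n, `|a n.+1 - a n| <= c * 2^-1 ^+ n) ->
  forall n m, (n <= m)%N -> `|a m - a n| <= 2 * c * 2^-1 ^+ n.
Proof.
move=> ac n m /subnKC <-.
suff : `|a (n + (m - n))%N - a n| <= 2 * c * 2^-1 ^+ n - 2 * c * 2^-1 ^+ (n + (m - n)).
  move/le_trans; apply; rewrite gerBl.
  have c0 : 0 <= c by have := le_trans (normr_ge0 _) (ac 0%N); rewrite expr0 mulr1.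
  by rewrite !mulr_ge0 ?exprn_ge0 ?invr_ge0.
elim: (m - n)%N => [|k IH]; first by rewrite addn0 !subrr normr0.
rewrite addnS -(subrK (a (n + k)%N) (a _.+1)) -addrA.
apply: (le_trans (ler_normD _ _)); apply: (le_trans (lerD (ac _) IH)).
by rewrite [2^-1 ^+ _.+1]exprS le_eqVlt; apply/orP; left; apply/eqP; field.
Qed.

Lemma geometric_limit (a : nat -> R) (c : R) :
  (forall n, `|a n.+1 - a n| <= c * 2^-1 ^+ n) ->
  cvgn a /\ forall n, `|limn a - a n| <= 2 * c * 2^-1 ^+ n.
Proof.
move=> ac; have H := geometric_steps ac.
have c0 : 0 <= c by have := le_trans (normr_ge0 _) (ac 0%N); rewrite expr0 mulr1.
have ca : cvgn a.
  apply/cauchy_cvgP/cauchy_exP => e e0.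
  have [n hn] : exists n, 2^-1 ^+ n < e / (2 * c + 1) :> R.
    by apply: half_powers_small; rewrite divr_gt0//; lra.
  exists (a n); exists n => //= m /= nm; rewrite /ball /= distrC.
  apply: le_lt_trans (H n m nm) _.
  move: hn; rewrite ltr_pdivlMr; last by lra.
  apply: le_lt_trans; rewrite mulrC ler_wpM2l ?exprn_ge0 ?invr_ge0//; lra.
split=> // n.
have : `|a m - a n| @[m --> \oo] --> `|limn a - a n|.
  by apply: cvg_norm; apply: cvgB => //; exact: cvg_cst.
move=> cn; rewrite -(cvg_lim _ cn)//; apply: limr_le; first by apply/cvg_ex; eexists; exact: cn.
by near=> m; apply: H; near: m; exact: nbhs_infty_ge.
Unshelve. all: by end_near. Qed.

Lemma geometric_cvg (a : nat -> R) (l c : R) :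
  (forall n, `|l - a n| <= c * 2^-1 ^+ n) -> a n @[n --> \oo] --> l.
Proof.
move=> ac; apply/cvgrPdist_le => e e0.
have c0 : 0 <= c by have := le_trans (normr_ge0 _) (ac 0%N); rewrite expr0 mulr1.
have [n hn] : exists n, 2^-1 ^+ n < e / (c + 1) :> R.
  by apply: half_powers_small; rewrite divr_gt0//; lra.
exists n => //= m /= nm; apply: (le_trans (ac m)).
have h : 2^-1 ^+ m <= 2^-1 ^+ n :> R by rewrite ler_wiXn2l ?invr_ge0// invf_le1//; lra.
move: hn; rewrite ltr_pdivlMr; last by lra.
move=> /ltW; apply: le_trans; rewrite mulrC.
by apply: ler_pM => //; lra.
Qed.

End geometric.

Section lacunary_limit.
Context {R : realType} (delta : R) (g0 : R -> R) (M0 : R).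
Hypothesis delta_gt0 : 0 < delta.
Hypothesis M0_ge2 : 2 <= M0.
Hypothesis g0_blip : blip M0 g0.
Hypothesis g0_supp : supported (fun x : R => `|x|) 1 g0.
Notation leb := (@lebesgue_measure R).
Local Notation supp := (supported (fun x : R => `|x|)).
Local Notation I u := (\int[leb]_(x in setT) u x).
Local Notation f_ := (lac_f delta g0 M0).
Local Notation g_ := (lac_g delta g0 M0).
Local Notation r_ := (lac_r delta g0 M0).
Local Notation defect_ := (defect delta M0).
Local Notation lbound_ := (lbound delta M0).

Lemma defect_half n : defect_ n <= delta * 2^-1 ^+ n.
Proof. by rewrite exprVn; exact: defect_le. Qed.

Definition lac_limit x : R := limn (fun n => f_ n x).

Lemma lac_limit_close n x : `|lac_limit x - f_ n x| <= 2^-1 ^+ n.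
Proof.
have [|_ /(_ n)] := @geometric_limit R (fun n => f_ n x) 2^-1.
  move=> k; apply: (le_trans (lac_f_close delta g0 M0 x (leqnSn k))).
  by rewrite exprS le_eqVlt; apply/orP; left; apply/eqP; field.
by rewrite divff// mul1r.
Qed.

Lemma lac_limit_range x : 1 <= lac_limit x <= 3.
Proof.
have H n : 1 <= lac_limit x + 2^-1 ^+ n /\ lac_limit x <= 3 + 2^-1 ^+ n.
  have := lac_limit_close n x; rewrite ler_norml => /andP[h1 h2].
  have /andP[h3 h4] := lac_f_range delta g0 M0 n x.
  have : 0 <= 2^-1 ^+ n :> R by rewrite exprn_ge0 ?invr_ge0.
  by split; lra.
apply/andP; split; apply/ler_addgt0Pl => e /half_powers_small[n hn];
  by have [] := H n; lra.
Qed.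

Lemma lac_limit_bound x : `|lac_limit x| <= 3.
Proof. by have /andP[a b] := lac_limit_range x; rewrite ger0_norm//; lra. Qed.

Lemma lac_limit_continuous : continuous lac_limit.
Proof.
move=> x; apply/cvgrPdist_le => e e0.
have [n hn] : exists n, 2^-1 ^+ n < e / 3 :> R by apply: half_powers_small; lra.
have cf := blip_continuous (lac_f_blip delta_gt0 M0_ge2 g0_blip n).
have /cvgrPdist_le/(_ (e / 3)) := cf x.
have e3 : 0 < e / 3 by lra.
move=> /(_ e3); apply: filterS => y xy.
have h1 := lac_limit_close n x; have h2 := lac_limit_close n y.
rewrite (_ : lac_limit x - lac_limit y = (lac_limit x - f_ n x) + (f_ n x - f_ n y)
  - (lac_limit y - f_ n y)); last by ring.
apply: (le_trans (ler_normB _ _)); apply: (le_trans (lerD (ler_normD _ _) (lexx _))).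
lra.
Qed.

Lemma lac_limit_bcont : bcont lac_limit.
Proof. by split; [exact: lac_limit_continuous|exists 3; exact: lac_limit_bound]. Qed.

(** Defined on Lipschitz functions, of which real and imaginary parts of
    Schwartz functions are examples. *)
Definition lac_distr (psi : R -> R) : R := limn (fun n => I (fun x => g_ n x * psi x)).

Lemma lac_distr_cvg L psi : blip L psi ->
  cvgn (fun n => I (fun x => g_ n x * psi x)) /\
  forall n, `|lac_distr psi - I (fun x => g_ n x * psi x)| <= 192 * L * delta * 2^-1 ^+ n.
Proof.
move=> bpsi; have L0 := blip_ge0 bpsi.
have [|cv H] := @geometric_limit R (fun n => I (fun x => g_ n x * psi x)) (96 * L * delta).
  move=> n; apply: (le_trans (lac_g_step delta_gt0 M0_ge2 g0_blip g0_supp n bpsi)).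
  by rewrite -[leRHS]mulrA ler_wpM2l ?mulr_ge0// defect_half.
split=> // n; apply: (le_trans (H n)).
by rewrite le_eqVlt; apply/orP; left; apply/eqP; ring.
Qed.

Lemma lac_g_integrable n psi : bcont psi ->
  leb.-integrable setT (EFin \o (fun x => g_ n x * psi x)).
Proof.
move=> bpsi; apply: (@bcont_supp_integrable R 1).
  by apply: bcontM => //; exact: blip_bcont (lac_g_blip delta_gt0 M0_ge2 g0_blip n).
by apply: suppMl; exact: lac_g_supp.
Qed.

Lemma lac_distr_le L psi : blip L psi -> `|lac_distr psi| <= (2 * M0 + 192 * delta) * L.
Proof.
move=> bpsi; have [_ /(_ 0%N) H] := lac_distr_cvg bpsi; have L0 := blip_ge0 bpsi.
have bg := lac_g_blip delta_gt0 M0_ge2 g0_blip 0.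
have H0 : `|I (fun x => g_ 0 x * psi x)| <= 2 * 1 * (M0 * L).
  apply: supp_integral_le => //.
  - apply: continuous_measurable_fun => x; apply: continuousM.
      exact: blip_continuous bg x.
    exact: blip_continuous bpsi x.
  - by move=> x; rewrite normrM; apply: ler_pM => //; [exact: bg.1|exact: bpsi.1].
  - by apply: suppMl; exact: lac_g_supp.
rewrite -(subrK (I (fun x => g_ 0 x * psi x)) (lac_distr psi)).
apply: (le_trans (ler_normD _ _)); apply: (le_trans (lerD H H0)).
by rewrite expr0 le_eqVlt; apply/orP; left; apply/eqP; ring.
Qed.

Lemma lac_distr_linear (c L K : R) psi chi : blip L psi -> blip K chi ->
  lac_distr (fun x => c * psi x + chi x) = c * lac_distr psi + lac_distr chi.
Proof.
move=> bp bc; have [cp _] := lac_distr_cvg bp; have [cc _] := lac_distr_cvg bc.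
rewrite /lac_distr; apply: cvg_lim => //.
rewrite (_ : (fun n => _) = fun n => c * I (fun x => g_ n x * psi x) + I (fun x => g_ n x * chi x)).
  by apply: cvgD; [apply: cvgMr; exact: cp|exact: cc].
apply/funext => n; have ip := lac_g_integrable n (blip_bcont bp).
have ic := lac_g_integrable n (blip_bcont bc).
rewrite -RintegralZl// -RintegralD//; last exact: integZ.
by apply: eq_Rintegral => x _; ring.
Qed.

Lemma lac_distr0 : lac_distr (fun=> 0) = 0.
Proof.
rewrite /lac_distr (_ : (fun n => _) = fun=> 0) ?lim_cst//.
apply/funext => n; under eq_Rintegral do rewrite mulr0.
by rewrite Rintegral_cst// mul0r.
Qed.

Section pairing.
Context (L : R) (phi : R -> R).
Hypothesis phi_blip : blip L phi.

Section fixed_mollifiers.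
Context (al be : R -> R) (Lb : R).
Hypothesis alP : mollifier 1 al.
Hypothesis beP : mollifier 1 be.
Hypothesis be_blip : blip Lb be.

Let F x := conv lac_limit al x.
Let G x := lac_distr (fun y => be (x - y)).
Let X n := conv (f_ n) al.
Let Y n := conv (g_ n) be.

Let be_shift x : blip Lb (fun y => be (x - y)).
Proof.
split=> [y|y z]; first exact: be_blip.1.
apply: (le_trans (be_blip.2 _ _)).
rewrite (_ : x - y - (x - z) = - (y - z)) ?normrN//; ring.
Qed.

Let YE n x : Y n x = I (fun y => g_ n y * be (x - y)).
Proof.
have [-> _//] := conv_flip beP x (blip_bcont (lac_g_blip delta_gt0 M0_ge2 g0_blip n)).
Qed.

Let G_close n x : `|G x - Y n x| <= 192 * Lb * delta * 2^-1 ^+ n.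
Proof. by rewrite YE; exact: (lac_distr_cvg (be_shift x)).2. Qed.

Let Y_supp n : supp 2 (Y n).
Proof. by apply: mollified_supp => //; exact: lac_g_supp. Qed.

Let G_supp : supp 2 G.
Proof.
move=> x x2; have : (fun n => Y n x) @ \oo --> G x by exact: geometric_cvg (G_close ^~ x).
move/cvg_lim => <-//; rewrite (_ : (fun n => _) = fun=> 0) ?lim_cst//.
by apply/funext => n; exact: Y_supp.
Qed.

Let F_close n x : `|F x - X n x| <= 2^-1 ^+ n.
Proof.
have bf := blip_bcont (lac_f_blip delta_gt0 M0_ge2 g0_blip n).
have -> : F x - X n x = conv (fun x => lac_limit x + (-1) * f_ n x) al x.
  by rewrite (convD alP) ?(convZ alP) ?mulN1r//; [exact: lac_limit_bcont|exact: bcontZ].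
apply: (conv_bound alP); first by apply: bcontD; [exact: lac_limit_bcont|exact: bcontZ].
by move=> z; rewrite mulN1r; exact: lac_limit_close.
Qed.

Let F_bound x : `|F x| <= 3.
Proof. by apply: (conv_bound alP); [exact: lac_limit_bcont|exact: lac_limit_bound]. Qed.

Let GB : R := M0 + 192 * Lb * delta.

Let Lb_ge0 : 0 <= Lb. Proof. exact: blip_ge0 be_blip. Qed.

Let G_bound x : `|G x| <= GB.
Proof.
have h := G_close 0 x; rewrite expr0 mulr1 in h.
have b0 := lac_g_blip delta_gt0 M0_ge2 g0_blip 0.
have h0 : `|Y 0%N x| <= M0 by apply: (conv_bound beP); [exact: blip_bcont b0|exact: b0.1].
rewrite -(subrK (Y 0%N x) (G x)) /GB; apply: (le_trans (ler_normD _ _)).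
by apply: (le_trans (lerD h h0)); rewrite addrC.
Qed.

Let mX n : measurable_fun setT (X n).
Proof.
apply: continuous_measurable_fun.
exact: blip_continuous (conv_blip alP (lac_f_blip delta_gt0 M0_ge2 g0_blip n)).
Qed.

Let mY n : measurable_fun setT (Y n).
Proof.
apply: continuous_measurable_fun.
exact: blip_continuous (conv_blip beP (lac_g_blip delta_gt0 M0_ge2 g0_blip n)).
Qed.

Let mF : measurable_fun setT F.
Proof.
apply: (measurable_fun_cvg mX) => x _.
by apply: (geometric_cvg (c := 1)) => n; rewrite mul1r; exact: F_close.
Qed.

Let mG : measurable_fun setT G.
Proof.
apply: (measurable_fun_cvg mY) => x _; exact: geometric_cvg (G_close ^~ x).
Qed.

Let mphi : measurable_fun setT phi.
Proof. exact: continuous_measurable_fun (blip_continuous phi_blip). Qed.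

Let X_bound n x : `|X n x| <= 3.
Proof.
apply: (conv_bound alP); first exact: blip_bcont (lac_f_blip delta_gt0 M0_ge2 g0_blip n).
move=> z; have /andP[a b] := lac_f_range delta g0 M0 n z.
have : 0 <= 2^-1 ^+ n :> R by rewrite exprn_ge0 ?invr_ge0.
by move=> c; rewrite ger0_norm//; lra.
Qed.

Let mol_pair_close : exists c : R, forall n,
  `|I (fun x => F x * G x * phi x) - mol_pair delta g0 M0 al be n phi| <= c * 2^-1 ^+ n.
Proof.
have L0 := blip_ge0 phi_blip.
have GB0 : 0 <= GB by apply: le_trans (G_bound 0).
(* A bound for the Y_n that is uniform in n, unlike lbound n. *)
pose YB := GB + 192 * Lb * delta.
exists (2 * 2 * ((3 * (192 * Lb * delta) + YB) * L)) => n.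
have iFG : leb.-integrable setT (EFin \o (fun x => F x * G x * phi x)).
  apply: (@supp_integrable _ 2 (3 * GB * L)).
  - by apply: measurable_funM => //; exact: measurable_funM.
  - move=> x; rewrite !normrM; apply: ler_pM => //; last exact: phi_blip.1.
    by apply: ler_pM.
  - by apply: suppMl; exact: suppMr.
have Yb x : `|Y n x| <= YB.
  rewrite -(subrK (G x) (Y n x)) /YB addrC; apply: (le_trans (ler_normD _ _)).
  apply: lerD; first exact: G_bound.
  rewrite distrC; apply: (le_trans (G_close n x)); rewrite ler_piMr//.
    by rewrite !mulr_ge0// ltW.
  by rewrite exprn_ile1 ?invr_ge0// invf_le1//; lra.
have iXY : leb.-integrable setT (EFin \o (fun x => X n x * Y n x * phi x)).
  apply: (@supp_integrable _ 2 (3 * YB * L)).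
  - by apply: measurable_funM => //; exact: measurable_funM.
  - move=> x; rewrite !normrM; apply: ler_pM => //; last exact: phi_blip.1.
    by apply: ler_pM.
  - by apply: suppMl; exact: suppMr.
rewrite /mol_pair -RintegralB//.
rewrite (_ : 2 * 2 * _ * _ = 2 * 2 * ((3 * (192 * Lb * delta) + YB) * 2^-1 ^+ n * L)); last by ring.
apply: supp_integral_le => //.
- have /integrableP[/measurable_EFinP mFG _] := iFG.
  by have /integrableP[/measurable_EFinP mXY _] := iXY; exact: measurable_funB.
- move=> x; rewrite (_ : F x * G x * phi x - X n x * Y n x * phi x =
    (F x * (G x - Y n x) + (F x - X n x) * Y n x) * phi x); last by ring.
  rewrite normrM; apply: ler_pM => //; last exact: phi_blip.1.
  apply: (le_trans (ler_normD _ _)); rewrite !normrM mulrDl; apply: lerD.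
    by rewrite -mulrA; apply: ler_pM.
  by rewrite mulrC; apply: ler_pM.
- move=> x x2; have Yx : conv (g_ n) be x = 0 by exact: (@Y_supp n).
  by rewrite G_supp// Yx !mulr0 !mul0r subrr.
Qed.

(** The steps from stage n + 1 on are summable, uniformly in the
    mollifiers. *)
Lemma pairing_close n : `|I (fun x => F x * G x * phi x) -
    mol_pair delta g0 M0 al be n.+1 phi| <= 1200 * L * delta * 2^-1 ^+ n.
Proof.
have L0 := blip_ge0 phi_blip.
have [|cv H] := @geometric_limit R
    (fun n => mol_pair delta g0 M0 al be n.+1 phi) (600 * L * delta).
  move=> k; apply: (le_trans (mol_pair_step delta_gt0 M0_ge2 g0_blip g0_supp
    alP beP k phi_blip)).
  have d0 := defect_half k; have d1 := defect_half k.+1.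
  have h0 : 480 * L * defect_ k <= 480 * L * (delta * 2^-1 ^+ k).
    exact: (ler_wpM2l (mulr_ge0 (ler0n R 480) L0) d0).
  have h1 : 216 * L * defect_ k.+1 <= 216 * L * (delta * 2^-1 ^+ k.+1).
    exact: (ler_wpM2l (mulr_ge0 (ler0n R 216) L0) d1).
  apply: (le_trans (lerD h0 h1)).
  have h2 : 0 <= L * delta * 2^-1 ^+ k.
    by rewrite !mulr_ge0 ?exprn_ge0 ?invr_ge0// ltW.
  rewrite exprS (_ : _ + _ = 588 * (L * delta * 2^-1 ^+ k)); last by field.
  rewrite -[leRHS]mulrA -[leRHS]mulrA [X in 600 * X]mulrA; lra.
have lE : limn (fun n => mol_pair delta g0 M0 al be n.+1 phi) = I (fun x => F x * G x * phi x).
  have [c hc] := mol_pair_close; apply/cvg_lim; first exact: Rhausdorff.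
  apply: (geometric_cvg (c := c * 2^-1)) => k.
  by apply: (le_trans (hc k.+1)); rewrite exprS mulrA.
rewrite -lE; apply: (le_trans (H n)).
by rewrite le_eqVlt; apply/orP; left; apply/eqP; ring.
Qed.

End fixed_mollifiers.

(** First a stage n is fixed such that both the distance to the limit of the
    pairings, which is uniform in the mollifiers, and the integral of r_(n+1)
    phi are small; at this fixed stage the functions are Lipschitz, so
    mollification at a small scale eta changes the pairing by O(eta). *)
Lemma pairing_small (e : R) : 0 < e -> exists2 eta : R, 0 < eta <= 1 &
  forall al be Lb, mollifier eta al -> mollifier eta be -> blip Lb be ->
  `|I (fun x => conv lac_limit al x * lac_distr (fun y => be (x - y)) * phi x)| <= e.
Proof.
move=> e0; have L0 := blip_ge0 phi_blip.
have Ld : 0 <= L * delta by rewrite mulr_ge0// ltW.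
have c1 : 0 < 12 * (240 * (L * delta)) + 1 by lra.
(* Half of e is left for the mollification at the chosen stage, and the other
   half covers 1200 = 5 * 240 from pairing_close and 240 from
   lac_r_integral. *)
have [n hn] : exists n, 2^-1 ^+ n < e / (12 * (240 * (L * delta)) + 1) :> R.
  by apply: half_powers_small; exact: divr_gt0.
pose M := lbound_ n.+1.
have M2 : 2 <= M by exact: lbound_ge2.
have MM : 0 <= 16 * M ^+ 2 * L.
  by apply: mulr_ge0 => //; apply: mulr_ge0 => //; exact: sqr_ge0.
exists (Num.min 1 (e / (16 * M ^+ 2 * L + 1))).
  rewrite lt_min ltr01 ge_min lexx /= andbT; apply: divr_gt0 => //; lra.
set eta := Num.min _ _ => al be Lb aleta beeta beb.
have eta1 : eta <= 1 by rewrite /eta ge_min lexx.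
have eta0 : 0 <= eta by rewrite /eta le_min ler01 divr_ge0 ?ltW//; lra.
have eta2 : 16 * M ^+ 2 * L * eta <= e.
  have : eta <= e / (16 * M ^+ 2 * L + 1) by rewrite /eta ge_min lexx orbT.
  rewrite ler_pdivlMr; last by lra.
  by move=> h; have := mulrDr eta (16 * M ^+ 2 * L) 1; rewrite mulr1 [_ * eta]mulrC; lra.
have al1 := mollifier_le eta1 aleta; have be1 := mollifier_le eta1 beeta.
have close := pairing_close al1 be1 beb n.
have rb := lac_r_integral delta_gt0 M0_ge2 g0_blip g0_supp n phi_blip.
have bf := lac_f_blip delta_gt0 M0_ge2 g0_blip n.+1.
have bg := lac_g_blip delta_gt0 M0_ge2 g0_blip n.+1.
have bX := conv_blip al1 bf; have bY := conv_blip be1 bg.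
have sY : supp 2 (conv (g_ n.+1) be) by apply: mollified_supp => //; exact: lac_g_supp.
have sg : supp 2 (g_ n.+1).
  by apply: (supported_le _ (lac_g_supp _ _ g0_supp _)); lra.
have diff : `|mol_pair delta g0 M0 al be n.+1 phi - I (fun x => r_ n.+1 x * phi x)|
    <= 2 * 2 * (2 * M ^+ 2 * eta * L).
  rewrite /mol_pair -RintegralB//; last 2 first.
  - apply: (@bcont_supp_integrable R 2); last by apply: suppMl; exact: suppMr.
    exact: blip_bcont (blipM (blipM bX bY) phi_blip).
  - apply: (@bcont_supp_integrable R 2); last by apply: suppMl; exact: suppMr.
    exact: blip_bcont (blipM (blipM bf bg) phi_blip).
  apply: supp_integral_le => //.
  - by apply: measurable_funB; apply: continuous_measurable_fun;
      [exact: blip_continuous (blipM (blipM bX bY) phi_blip)|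
       exact: blip_continuous (blipM (blipM bf bg) phi_blip)].
  - move=> x; rewrite /lac_r.
    rewrite (_ : _ - _ = (conv (f_ n.+1) al x * (conv (g_ n.+1) be x - g_ n.+1 x) +
      (conv (f_ n.+1) al x - f_ n.+1 x) * g_ n.+1 x) * phi x); last by ring.
    rewrite normrM; apply: ler_pM => //; last exact: phi_blip.1.
    apply: (le_trans (ler_normD _ _)); rewrite !normrM.
    rewrite (_ : 2 * M ^+ 2 * eta = M * (M * eta) + M * eta * M); last by ring.
    apply: lerD; apply: ler_pM => //.
    + exact: bX.1.
    + exact: (conv_close beeta).
    + exact: (conv_close aleta).
    + exact: bg.1.
  - by move=> x x2; rewrite /lac_r sY// sg// !mulr0 !mul0r subrr.
have d0 : 240 * L * defect_ n <= 240 * L * (delta * 2^-1 ^+ n).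
  exact: (ler_wpM2l (mulr_ge0 (ler0n R 240) L0) (defect_half n)).
have hn' : 12 * (240 * (L * delta * 2^-1 ^+ n)) <= e.
  move: hn; rewrite ltr_pdivlMr// => /ltW; apply: le_trans.
  have h0 : 0 <= 2^-1 ^+ n :> R by rewrite exprn_ge0// invr_ge0.
  rewrite mulrDr mulr1 (_ : 12 * _ = 2^-1 ^+ n * (12 * (240 * (L * delta)))); last by ring.
  by rewrite lerDl.
set A := I (fun x => conv lac_limit al x * _ * phi x) in close *.
set J := mol_pair _ _ _ _ _ _ _ in close diff; set Q := I (fun x => r_ n.+1 x * phi x) in diff rb.
rewrite (_ : A = (A - J) + (J - Q) + Q); last by ring.
apply: (le_trans (ler_normD _ _)); apply: (le_trans (lerD (ler_normD _ _) (lexx _))).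
apply: (le_trans (lerD (lerD close diff) (le_trans rb d0))).
rewrite (_ : _ + _ = 6 * (240 * (L * delta * 2^-1 ^+ n)) + 8 * (M ^+ 2 * L * eta)); last by ring.
have eta3 : 16 * (M ^+ 2 * L * eta) <= e by move: eta2; rewrite -!mulrA.
lra.
Qed.

End pairing.
End lacunary_limit.

(** * Schwartz functions and the vanishing product *)

Section complex_parts.
Context {R : realType}.
Implicit Types z w : R[i].
Local Notation Re := complex.Re.
Local Notation Im := complex.Im.

Lemma normr_Re_le_cabs z : `|Re z| <= cabs z.
Proof.
case: z => a b; rewrite /cabs /= -sqrtr_sqr ler_sqrt ?addr_ge0 ?sqr_ge0//.
by rewrite lerDl sqr_ge0.
Qed.

Lemma normr_Im_le_cabs z : `|Im z| <= cabs z.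
Proof.
case: z => a b; rewrite /cabs /= -sqrtr_sqr ler_sqrt ?addr_ge0 ?sqr_ge0//.
by rewrite lerDr sqr_ge0.
Qed.

Lemma cabs_le z : cabs z <= `|Re z| + `|Im z|.
Proof.
case: z => a b; rewrite /cabs /=.
rewrite -(@ger0_norm _ (`|a| + `|b|)) ?addr_ge0// -sqrtr_sqr.
rewrite ler_sqrt ?sqr_ge0// sqrrD !real_normK ?num_real//.
by rewrite -addrA lerD2l lerDr mulrn_wge0// mulr_ge0.
Qed.

Lemma ReB z w : Re (z - w) = Re z - Re w. Proof. by case: z w => ? ? [? ?]. Qed.
Lemma ImB z w : Im (z - w) = Im z - Im w. Proof. by case: z w => ? ? [? ?]. Qed.

Lemma ReMD (a : R[i]) z w : Re (a * z + w) = Re a * Re z + (- Im a * Im z + Re w).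
Proof. by case: a z w => ? ? [? ?] [? ?] /=; ring. Qed.

Lemma ImMD (a : R[i]) z w : Im (a * z + w) = Re a * Im z + (Im a * Re z + Im w).
Proof. by case: a z w => ? ? [? ?] [? ?] /=; ring. Qed.

(** Convergence may be checked on real and imaginary parts. *)
Lemma ccvg_parts (u : nat -> R[i]) l :
  (forall e : R, 0 < e -> \forall n \near \oo,
     `|Re (u n) - Re l| <= e /\ `|Im (u n) - Im l| <= e) -> ccvg u l.
Proof.
move=> H; apply/cvgr0Pnorm_le => e e0.
have e2 : 0 < e / 2 by lra.
apply: filterS (H _ e2) => n [h1 h2].
rewrite ger0_norm; last by apply: le_trans (normr_Re_le_cabs _).
by apply: (le_trans (cabs_le _)); rewrite ReB ImB; lra.
Qed.

End complex_parts.

Section schwartz.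
Context {R : realType}.
Implicit Types (phi psi : R -> R[i]).
Notation leb := (@lebesgue_measure R).
Local Notation Re := complex.Re.
Local Notation Im := complex.Im.
Local Notation integ u := (leb.-integrable setT (EFin \o u)).

Lemma cabs_bounds_blip (phi : R -> R[i]) (M : R) : csmooth phi ->
  (forall x, cabs (cderiv 0 phi x) <= M) -> (forall x, cabs (cderiv 1 phi x) <= M) ->
  blip M (fun x => Re (phi x)) /\ blip M (fun x => Im (phi x)).
Proof.
move=> [sr si] b0 b1; split; apply: blip_of_derive1.
- exact: smooth_derivable sr.
- by move=> x; apply: le_trans (b0 x); exact: (normr_Re_le_cabs (cderiv 0 phi x)).
- by move=> x; apply: le_trans (b1 x); exact: (normr_Re_le_cabs (cderiv 1 phi x)).
- exact: smooth_derivable si.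
- by move=> x; apply: le_trans (b0 x); exact: (normr_Im_le_cabs (cderiv 0 phi x)).
- by move=> x; apply: le_trans (b1 x); exact: (normr_Im_le_cabs (cderiv 1 phi x)).
Qed.

Lemma schwartz_blip phi : schwartz phi -> exists L : R,
  blip L (fun x => Re (phi x)) /\ blip L (fun x => Im (phi x)).
Proof.
move=> [sp bp]; have [C0 h0] := bp 0%N 0%N; have [C1 h1] := bp 0%N 1%N.
exists (Num.max C0 C1); apply: cabs_bounds_blip => // x; rewrite le_max.
  by have := h0 x; rewrite expr0 mul1r => ->.
by have := h1 x; rewrite expr0 mul1r => ->; rewrite orbT.
Qed.

(** The integrable weight 1 / (1 + x^2), which dominates every Schwartz
    function up to a constant. *)
Definition cauchy_weight (x : R) : R := (oneDsqr x)^-1.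

Lemma cauchy_weight_ge0 x : 0 <= cauchy_weight x.
Proof. by rewrite invr_ge0 (le_trans ler01)// oneDsqr_ge1. Qed.

Lemma cauchy_weight_integrable : integ cauchy_weight.
Proof.
have mw : measurable_fun setT cauchy_weight.
  by apply: continuous_measurable_fun; exact: continuous_oneDsqrV.
have mA : measurable (`[(0:R), +oo[%classic : set (measurableTypeR R)).
  exact: measurable_itv.
have i1 : leb.-integrable `[0, +oo[%classic (EFin \o cauchy_weight).
  apply/integrableP; split; first by apply: measurable_funTS; exact/measurable_EFinP.
  apply: (@le_lt_trans _ _ (pi / 2)%:E); last exact: ltry.
  rewrite -integral0y_oneDsqr le_eqVlt; apply/orP; left; apply/eqP.
  by apply: eq_integral => x _; rewrite /= ger0_norm// cauchy_weight_ge0.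
pose h := fun x : R => cauchy_weight x * \1_(`[0, +oo[%classic) x.
have i2 : integ h.
  have := (integrable_mkcond _ mA).1 i1; apply: eq_integrable => // x _.
  by rewrite patchE /h /= indicE; case: ifP => _; rewrite ?mulr1 ?mulr0.
have [i3 _] := integral_opp i2; have i4 := integD i2 i3.
apply: (le_integrable measurableT _ _ i4); first exact/measurable_EFinP.
move=> x _; rewrite lee_fin.
have w0 := cauchy_weight_ge0 x.
have wN : cauchy_weight (- x) = cauchy_weight x by rewrite /cauchy_weight /oneDsqr sqrrN.
rewrite [leLHS]ger0_norm// /h wN !indicE.
have i01 (b : bool) : 0 <= b%:R :> R by case: b.
have [x0|x0] := leP 0 x.
  have -> : x \in `[(0:R), +oo[%classic by apply: mem_set; rewrite /= in_itv /= x0.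
  by rewrite mulr1 ger0_norm ?lerDl ?addr_ge0 ?mulr_ge0.
have -> : - x \in `[(0:R), +oo[%classic.
  by apply: mem_set; rewrite /= in_itv /= oppr_ge0 (ltW x0).
by rewrite mulr1 ger0_norm ?lerDr ?addr_ge0 ?mulr_ge0.
Qed.

Lemma cabs_decay (phi : R -> R[i]) (C : R) :
  (forall x, cabs (phi x) <= C) -> (forall x, `|x| ^+ 2 * cabs (phi x) <= C) ->
  forall x, cabs (phi x) <= 2 * C * cauchy_weight x.
Proof.
move=> h0 h2 x; rewrite ler_pdivlMr; last by apply: lt_le_trans (oneDsqr_ge1 x).
have := h2 x; rewrite real_normK ?num_real// /oneDsqr mulrDr mulr1 [_ * x ^+ 2]mulrC.
by have := h0 x; lra.
Qed.

Lemma cderiv0 phi x : cderiv 0 phi x = phi x.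
Proof. by rewrite /cderiv /=; case: (phi x). Qed.

Lemma weight_dominated (f u : R -> R) (A C : R) :
  measurable_fun setT f -> (forall x, `|f x| <= A) -> measurable_fun setT u ->
  (forall x, `|u x| <= C * cauchy_weight x) ->
  integ (fun x => f x * u x) /\
  `|\int[leb]_(x in setT) (f x * u x)| <=
     A * C * \int[leb]_(x in setT) cauchy_weight x.
Proof.
move=> mf fA mu uC.
have mfu : measurable_fun setT (fun x => f x * u x) by exact: measurable_funM.
have iw := integZ (A * C) cauchy_weight_integrable.
have fuC x : `|f x * u x| <= A * C * cauchy_weight x.
  by rewrite normrM -mulrA; exact: ler_pM.
have ifu : integ (fun x => f x * u x).
  apply: (le_integrable measurableT _ _ iw); first exact/measurable_EFinP.
  by move=> x _; rewrite lee_fin; apply: (le_trans (fuC x)); exact: ler_norm.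
split=> //; apply: (le_trans (le_normr_Rintegral measurableT ifu)).
rewrite -RintegralZl//; last exact: cauchy_weight_integrable.
apply: le_Rintegral => //.
exact: (integrable_norm ifu).
Qed.

Lemma schwartz_measurable phi : schwartz phi ->
  measurable_fun setT (fun x => Re (phi x)) /\ measurable_fun setT (fun x => Im (phi x)).
Proof.
by move=> [[sr si] _]; split; apply: continuous_measurable_fun; exact: smooth_continuous.
Qed.

Lemma schwartz_decay phi : schwartz phi -> exists C : R,
  (forall x, `|Re (phi x)| <= C * cauchy_weight x) /\
  (forall x, `|Im (phi x)| <= C * cauchy_weight x).
Proof.
move=> [_ bp]; have [C0 h0] := bp 0%N 0%N; have [C2 h2] := bp 2%N 0%N.
have H x : cabs (phi x) <= 2 * Num.max C0 C2 * cauchy_weight x.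
  apply: cabs_decay => {}x; rewrite le_max.
    by have := h0 x; rewrite expr0 mul1r cderiv0 => ->.
  by have := h2 x; rewrite cderiv0 => ->; rewrite orbT.
exists (2 * Num.max C0 C2); split=> x; apply: le_trans (H x).
  exact: normr_Re_le_cabs.
exact: normr_Im_le_cabs.
Qed.

Lemma smooth_supp_schwartz (b : R -> R) (K : R) : 0 <= K -> smooth b ->
  supported (fun x : R => `|x|) K b -> schwartz (fun x => (b x)%:C%C).
Proof.
move=> K0 sb suppb; split.
  split=> //=; apply: (@smooth_closed _ (fun f => f = fun=> 0)) => // f ->.
  split; first by move=> x; exact: derivable_cst.
  by apply/funext => x; rewrite derive1_cst.
move=> j k; pose bk := derive1n k b.
have Z : derive1n k (fun _ : R => 0 : R) = fun=> 0.
  elim: k {bk} => [//|k IH] /=; rewrite IH.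
  by apply/funext => x; rewrite derive1_cst.
have sk : smooth bk.
  rewrite /bk; elim: k {bk Z} => [//|k IH] /=; exact: smooth_derive1.
have suppk : supported (fun x : R => `|x|) K bk.
  rewrite /bk; elim: k {bk Z sk} => [//|k IH] /=; exact: supp_derive1.
have [M hM] := continuous_supp_bounded (smooth_continuous sk) suppk.
have M0 : 0 <= M by exact: le_trans (hM 0).
exists (K ^+ j * M) => x.
have -> : cderiv k (fun x => (b x)%:C%C) x = (bk x)%:C%C by rewrite /cderiv /= Z.
have -> : cabs (bk x)%:C%C = `|bk x|.
  by rewrite /cabs /= expr0n /= addr0 sqrtr_sqr.
have [xK|/suppk ->] := leP `|x| K; last by rewrite normr0 mulr0 mulr_ge0 ?exprn_ge0.
by apply: ler_pM; rewrite ?exprn_ge0// lerXn2r ?nnegrE.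
Qed.

Lemma distr_of_bounded_fun_tempered (f : R -> R) (A : R) :
  measurable_fun setT f -> (forall x, `|f x| <= A) -> tempered (distr_of_fun f).
Proof.
move=> mf fA; have A0 : 0 <= A by exact: le_trans (fA 0).
have RE (phi : R -> R[i]) x : Re ((f x)%:C%C * phi x) = f x * Re (phi x).
  by case: (phi x) => a b /=; rewrite mul0r subr0.
have IE (phi : R -> R[i]) x : Im ((f x)%:C%C * phi x) = f x * Im (phi x).
  by case: (phi x) => a b /=; rewrite mul0r addr0.
have dE phi : distr_of_fun f phi = ((\int[leb]_(x in setT) (f x * Re (phi x))) +i*
    (\int[leb]_(x in setT) (f x * Im (phi x))))%C.
  rewrite /distr_of_fun /cint; congr (_ +i* _)%C; apply: eq_Rintegral => x _.
    exact: RE.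
  exact: IE.
have ii phi : schwartz phi -> integ (fun x => f x * Re (phi x)) /\
    integ (fun x => f x * Im (phi x)).
  move=> sp; have [C [c1 c2]] := schwartz_decay sp.
  have [m1 m2] := schwartz_measurable sp.
  by split; [exact: (weight_dominated mf fA m1 c1).1|exact: (weight_dominated mf fA m2 c2).1].
split=> [a phi psi sp ss|phi_ phi sp_ sp cv].
  have [ip1 ip2] := ii _ sp; have [is1 is2] := ii _ ss.
  rewrite !dE; case: a => a1 a2; simpc.
  apply/eqP; rewrite eq_complex /=; apply/andP; split; apply/eqP.
    rewrite -!RintegralZl// -RintegralB//; [|exact: integZ|exact: integZ].
    rewrite -RintegralD//; last by apply: integB; exact: integZ.
    by apply: eq_Rintegral => x _; rewrite ReMD /=; ring.
  rewrite -!RintegralZl// -RintegralD//; [|exact: integZ|exact: integZ].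
  rewrite -RintegralD//; last by apply: integD; exact: integZ.
  by apply: eq_Rintegral => x _; rewrite ImMD /=; ring.
apply: ccvg_parts => e e0.
set W := \int[leb]_(x in setT) cauchy_weight x.
have W0 : 0 <= W by apply: Rintegral_ge0 => x _; exact: cauchy_weight_ge0.
have AW : 0 < A * 2 * W + 1 by rewrite ltr_wpDl// !mulr_ge0.
pose e' := e / (A * 2 * W + 1).
have e'0 : 0 < e' by exact: divr_gt0.
have e'e : A * (2 * e') * W <= e.
  rewrite (_ : _ * W = e' * (A * 2 * W)); last by ring.
  have -> : e = e' * (A * 2 * W + 1) by rewrite /e' divfK// gt_eqF.
  by rewrite ler_wpM2l ?lerDl// ltW.
have := cv 0%N 0%N e' e'0; have := cv 2%N 0%N e' e'0.
apply: filterS2 => n h2 h0.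
have H := @cabs_decay (fun x => phi_ n x - phi x) e' _ _.
have {}H x : cabs (phi_ n x - phi x) <= 2 * e' * cauchy_weight x.
  apply: H => {}x; first by have := h0 x; rewrite expr0 mul1r cderiv0.
  by have := h2 x; rewrite cderiv0.
have [i1 i2] := ii _ (sp_ n); have [j1 j2] := ii _ sp.
have [m1 m2] := schwartz_measurable (sp_ n); have [l1 l2] := schwartz_measurable sp.
rewrite !dE /=; split.
  rewrite (_ : _ - _ = \int[leb]_(x in setT) (f x * (Re (phi_ n x) - Re (phi x)))); last first.
    by rewrite -RintegralB//; apply: eq_Rintegral => x _; rewrite mulrBr.
  apply: le_trans e'e; apply: (weight_dominated mf fA _ _).2.
    exact: measurable_funB.
  by move=> x; apply: le_trans (H x); rewrite -ReB; exact: normr_Re_le_cabs.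
rewrite (_ : _ - _ = \int[leb]_(x in setT) (f x * (Im (phi_ n x) - Im (phi x)))); last first.
  by rewrite -RintegralB//; apply: eq_Rintegral => x _; rewrite mulrBr.
apply: le_trans e'e; apply: (weight_dominated mf fA _ _).2.
  exact: measurable_funB.
by move=> x; apply: le_trans (H x); rewrite -ImB; exact: normr_Im_le_cabs.
Qed.

(** Continuity: convergence in the Schwartz class makes the differences and
    their derivatives uniformly small, hence makes their Lipschitz bounds
    small. *)
Lemma distr_of_lipschitz_tempered (G : (R -> R) -> R) (A : R) :
  (forall c L K u v, blip L u -> blip K v ->
     G (fun x => c * u x + v x) = c * G u + G v) ->
  (forall L u, blip L u -> `|G u| <= A * L) ->
  tempered (fun phi => (G (fun x => Re (phi x)) +i* G (fun x => Im (phi x)))%C).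
Proof.
move=> Glin Gle.
have A0 : 0 <= A.
  have b1 : blip 1 (fun _ : R => 0 : R).
    by apply: blip_le (blip_cst 0); rewrite normr0.
  by have := le_trans (normr_ge0 _) (Gle _ _ b1); rewrite mulr1.
have GB L K u v : blip L u -> blip K v -> G (fun x => u x - v x) = G u - G v.
  move=> bu bv; have := Glin (-1) K L v u bv bu.
  rewrite mulN1r addrC => <-; congr G; apply/funext => x.
  by rewrite mulN1r addrC.
split=> [a phi psi sp ss|phi_ phi sp_ sp cv].
  have [L [b1 b2]] := schwartz_blip sp; have [K [d1 d2]] := schwartz_blip ss.
  rewrite (_ : (fun x => Re _) = fun x => Re a * Re (phi x) + (- Im a * Im (phi x) + Re (psi x)));
    last by apply/funext => x; exact: ReMD.
  rewrite (_ : (fun x => Im _) = fun x => Re a * Im (phi x) + (Im a * Re (phi x) + Im (psi x)));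
    last by apply/funext => x; exact: ImMD.
  rewrite (Glin _ _ _ _ _ b1 (blipD (blipZ (- Im a) b2) d1)).
  rewrite (Glin _ _ _ _ _ b2 (blipD (blipZ (Im a) b1) d2)).
  rewrite (Glin _ _ _ _ _ b2 d1) (Glin _ _ _ _ _ b1 d2).
  case: a => a1 a2 /=; simpc.
  by apply/eqP; rewrite eq_complex /=; apply/andP; split; apply/eqP; ring.
apply: ccvg_parts => e e0 /=.
pose e' := e / (A + 1).
have A1 : 0 < A + 1 by lra.
have e'0 : 0 < e' by exact: divr_gt0.
have e'e : A * e' <= e.
  have -> : e = (A + 1) * e' by rewrite /e' mulrCA divff ?mulr1// gt_eqF.
  by rewrite ler_wpM2r ?lerDl// ltW.
have := cv 0%N 0%N e' e'0; have := cv 0%N 1%N e' e'0.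
apply: filterS2 => n h1 h0.
have [L [b1 b2]] := schwartz_blip (sp_ n); have [K [d1 d2]] := schwartz_blip sp.
rewrite -(GB _ _ _ _ b1 d1) -(GB _ _ _ _ b2 d2).
have ED (f g : R -> R) : smooth f -> smooth g -> forall x, derivable (fun x => f x - g x) x 1.
  by move=> sf sg x; apply: derivableB; exact: smooth_derivable.
have eR : (fun y => Re (phi_ n y - phi y)) = (fun y => Re (phi_ n y) - Re (phi y)).
  by apply/funext => y; exact: ReB.
have eI : (fun y => Im (phi_ n y - phi y)) = (fun y => Im (phi_ n y) - Im (phi y)).
  by apply/funext => y; exact: ImB.
have k0 x : cabs (phi_ n x - phi x) <= e'.
  by have := h0 x; rewrite expr0 mul1r cderiv0.
have k1 x : cabs (cderiv 1 (fun y => phi_ n y - phi y) x) <= e'.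
  by have := h1 x; rewrite expr0 mul1r.
split; apply: le_trans e'e; apply: Gle; apply: blip_of_derive1.
- by apply: ED; [exact: (sp_ n).1.1|exact: sp.1.1].
- by move=> x; apply: le_trans (k0 x); rewrite -ReB; exact: normr_Re_le_cabs.
- move=> x; apply: le_trans (k1 x); rewrite -eR.
  exact: (normr_Re_le_cabs (cderiv 1 _ x)).
- by apply: ED; [exact: (sp_ n).1.2|exact: sp.1.2].
- by move=> x; apply: le_trans (k0 x); rewrite -ImB; exact: normr_Im_le_cabs.
- move=> x; apply: le_trans (k1 x); rewrite -eI.
  exact: (normr_Im_le_cabs (cderiv 1 _ x)).
Qed.

End schwartz.

Section vanishing_product.
Context {R : realType}.
Notation leb := (@lebesgue_measure R).
Local Notation Re := complex.Re.
Local Notation Im := complex.Im.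
Local Notation supp := (supported (fun x : R => `|x|)).

Lemma approx_identity_mollifier (alpha : nat -> R -> R) (eta : R) :
  approx_identity alpha -> 0 < eta -> \forall n \near \oo, mollifier eta (alpha n).
Proof.
move=> [sm _ ge0 int1 shrink] eta0.
have := shrink _ (nbhsx_ballx (0 : R) eta eta0).
apply: filterS => n sub; split=> //; first exact: smooth_continuous.
move=> x ex; apply/eqP; apply: contraT => ax.
have /sub : closure [set x | alpha n x != 0] x by exact: subset_closure.
by rewrite /ball /= sub0r normrN => /(lt_trans ex); rewrite ltxx.
Qed.

(** By the Lipschitz bound, b stays above 1/2 on a neighbourhood of 0. *)
Lemma square_integral_gt0 (L : R) (b : R -> R) : blip L b -> supp 1 b -> b 0 = 1 ->
  0 < \int[leb]_(x in setT) (b x * b x).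
Proof.
move=> bb sb b0; have L0 := blip_ge0 bb.
have L1 : 0 < 2 * L + 1 by lra.
pose rho := (2 * L + 1)^-1; have rho0 : 0 < rho by rewrite invr_gt0.
have low x : `|x| <= rho -> 1 / 2 <= b x.
  move=> xr; have := bb.2 0 x; rewrite b0 sub0r normrN ler_norml => /andP[_ h].
  have h2 : L * `|x| <= L * rho by rewrite ler_wpM2l.
  have h3 : L * rho <= 1 / 2.
    by rewrite /rho ler_pdivrMr//; lra.
  lra.
have bi : leb.-integrable setT (EFin \o (fun x => b x * b x)).
  by apply: (@bcont_supp_integrable R 1); [exact: blip_bcont (blipM bb bb)|exact: suppMl].
have iI : leb.-integrable setT (EFin \o (\1_(`[- rho, rho]%classic) : R -> R)).
  apply: (@supp_integrable R rho 1) => //.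
  - by move=> x; rewrite indicE; case: (_ \in _); rewrite ?normr1 ?normr0.
  - move=> x xK; rewrite indicE memNset//= in_itv /= -ler_norml.
    by move: xK; rewrite ltNge => /negP.
apply: (@lt_le_trans _ _ (\int[leb]_(x in setT) (1 / 4 * \1_(`[- rho, rho]%classic) x))).
  rewrite RintegralZl// /Rintegral integral_indic// setIT.
  change (0 < 1 / 4 * fine (leb `[- rho, rho]%classic)).
  rewrite lebesgue_measure_itv /= lte_fin ifT; last by lra.
  by rewrite -EFinB /= mulr_gt0//; lra.
apply: le_Rintegral => //; first exact: integZ.
move=> x _; rewrite indicE; have [xr|xr] := leP `|x| rho.
  rewrite mem_set ?mulr1/= ?in_itv/= -?ler_norml//.
  have := low x xr; nra.
rewrite memNset ?mulr0; first by rewrite -expr2 sqr_ge0.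
by rewrite /= in_itv /= -ler_norml => /le_lt_trans/(_ xr); rewrite ltxx.
Qed.

(** The recursion starts from g_0 = bump, and delta is taken so small that the
    limit g still has a positive value at the test function bump. *)
Theorem vanishing_product :
  exists (f : R -> R) (g : (R -> R[i]) -> R[i]),
     [/\ bounded_fun f, forall x, 0 < f x, continuous f, tempered g &
         sproduct (distr_of_fun f) g (fun _ => 0) /\
         exists phi, schwartz phi /\ g phi <> 0].
Proof.
have sbump : supp 1 (bump : R -> R) by move=> x /ltW; exact: bump_supp.
have [L0 bb0] := smooth_supp_blip smooth_bump sbump.
have L00 := blip_ge0 bb0.
pose L := L0 + 2; have bb : blip L bump by apply: blip_le bb0; rewrite /L; lra.
have L2 : 2 <= L by rewrite /L; lra.
pose I0 := \int[leb]_(x in setT) (bump x * bump x).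
have I0gt : 0 < I0 by exact: square_integral_gt0 bb sbump (@bump0 R).
have c0 : 0 < 2 * 192 * L by lra.
(* By lac_distr_cvg, the limit differs from g_0 by at most 192 L delta = I0 /
   2 at bump. *)
pose delta := I0 / (2 * 192 * L); have delta0 : 0 < delta by exact: divr_gt0.
pose f := lac_limit delta bump L; pose G := lac_distr delta bump L.
have Glin c A B u v : blip A u -> blip B v -> G (fun x => c * u x + v x) = c * G u + G v.
  exact: lac_distr_linear.
have Gle A u : blip A u -> `|G u| <= (2 * L + 192 * delta) * A by exact: lac_distr_le.
pose g phi : R[i] := (G (fun x => Re (phi x)) +i* G (fun x => Im (phi x)))%C.
have tg : tempered g by exact: distr_of_lipschitz_tempered Glin Gle.
have cf : continuous f by exact: lac_limit_continuous.
have f3 x : `|f x| <= 3 by exact: lac_limit_bound.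
have tf : tempered (distr_of_fun f).
  by apply: distr_of_bounded_fun_tempered f3; exact: continuous_measurable_fun.
have G0 : G (fun=> 0) = 0 by exact: lac_distr0.
exists f, g; split=> //.
- exists 3; split; first exact: num_real.
  by move=> M /ltW M3 x _; exact: le_trans M3.
- by move=> x; have /andP[h _] := lac_limit_range delta bump L x; rewrite /f; lra.
split.
  split=> //.
    split=> [a phi psi _ _|phi_ phi _ _ _]; first by rewrite mulr0 addr0.
    by apply: ccvg_parts => e e0; apply: nearW => n; rewrite subrr normr0 ltW.
  move=> phi alpha beta sphi aal abe; have [Lp [bR bI]] := schwartz_blip sphi.
  apply: ccvg_parts => e e0.
  have [eta1 /andP[eta10 eta11] H1] := pairing_small delta0 L2 bb sbump bR e0.
  have [eta2 /andP[eta20 eta21] H2] := pairing_small delta0 L2 bb sbump bI e0.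
  have m1 := approx_identity_mollifier aal eta10.
  have m2 := approx_identity_mollifier abe eta10.
  have m3 := approx_identity_mollifier aal eta20.
  have m4 := approx_identity_mollifier abe eta20.
  have : \forall n \near \oo, [/\ mollifier eta1 (alpha n), mollifier eta1 (beta n),
      mollifier eta2 (alpha n) & mollifier eta2 (beta n)].
    by near=> n; split; near: n.
  apply: filterS => n [al1 be1 al2 be2].
  have [sb _ _ _ _] := abe; have [_ _ seta _] := be1.
  have [Lb bbe] := smooth_supp_blip (sb n) seta.
  have FE x : distr_conv (distr_of_fun f) (alpha n) x = (conv f (alpha n) x)%:C%C.
    rewrite /distr_conv /distr_of_fun /cint /=.
    have [<- _] := conv_flip al1 x (lac_limit_bcont delta0 L2 bb).
    congr (_ +i* _)%C; first by apply: eq_Rintegral => y _; rewrite mul0r subr0.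
    rewrite (_ : (fun y => _) = fun=> 0); first by rewrite Rintegral_cst// mul0r.
    by apply/funext => y; rewrite mulr0 mul0r addr0.
  have GE x : distr_conv g (beta n) x = (G (fun y => beta n (x - y)))%:C%C.
    by rewrite /distr_conv /g /= G0.
  rewrite /cint /= !subr0.
  split.
    rewrite (_ : \int[_]_(_ in _) _ = \int[leb]_(x in setT)
      (conv f (alpha n) x * G (fun y => beta n (x - y)) * Re (phi x))).
      exact: H1 al1 be1 bbe.
    apply: eq_Rintegral => x _; rewrite FE GE.
    by case: (phi x) => a b /=; ring.
  rewrite (_ : \int[_]_(_ in _) _ = \int[leb]_(x in setT)
      (conv f (alpha n) x * G (fun y => beta n (x - y)) * Im (phi x))).
    exact: H2 al2 be2 bbe.
  apply: eq_Rintegral => x _; rewrite FE GE.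
  by case: (phi x) => a b /=; ring.
exists (fun x => (bump x)%:C%C); split.
  exact: smooth_supp_schwartz ler01 smooth_bump sbump.
rewrite /g /= => /eqP; rewrite eq_complex /= => /andP[/eqP Gb _].
have [_ /(_ 0%N)] := lac_distr_cvg delta0 L2 bb sbump bb.
rewrite -/G Gb expr0 mulr1 sub0r normrN -/I0 gtr0_norm//.
have -> : 192 * L * delta = I0 / 2 by rewrite /delta; field; lra.
lra.
Unshelve. all: by end_near. Qed.

End vanishing_product.

Theorem theorem1p9 (R : realType) :
  (exists (f : R -> R) (g : (R -> R[i]) -> R[i]),
     [/\ bounded_fun f, forall x, 0 < f x, continuous f, tempered g &
         sproduct (distr_of_fun f) g (fun _ => 0) /\
         exists phi, schwartz phi /\ g phi <> 0]) /\
  (exists (mu : probability int R) (h : int -> R),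
     [/\ ~ is_dirac mu,
         forall eps : R, 0 < eps ->
           tends0_at_infinity int_norm (fun x => int_norm x `^ (- eps) * h x),
         int_conv_is h mu h,
         nonconstant h &
         ~ int_polynomial h]) /\
  (forall d : nat, (1 <= d)%N ->
     exists (L : triplet R d) (h : 'rV[R]_d -> R),
       [/\ levy_triplet L, smooth_rV h, not_concentrated_on_subgroup L,
           forall eps : R, 0 < eps ->
             tends0_at_infinity enorm (fun x => enorm x `^ (- eps) * h x) &
           [/\ harmonic_pointwise L h, harmonic_weak L h,
               nonconstant h & ~ polynomial_rV h]]).
Proof.
split; first exact: vanishing_product.
split; first exact: slowly_growing_harmonic_on_int.
by case=> // d _; exact: slowly_growing_harmonic_on_rV.
Qed.
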